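(* Let $p$ be an odd prime and let $G$ be a group with $|G|=p^6$ and nilpotency class $cl(G)=3$ or $4$. Then $\mathrm{Aut}_z(G)=Z(\mathrm{Inn}(G))$ if and only if $G$ belongs to one of the isoclinism families $\Phi_{25},\Phi_{26},\Phi_{28},\Phi_{29},\Phi_{40},\Phi_{41},\Phi_{42},\Phi_{43}$ (that is, $G$ is isoclinic to one of the eight groups $A_{k,e}$ with $k\in\{1,\nu\}$, $e\in\{0,1\}$, and $B_c$, $C_c$ with $c\in\{0,1\}$, defined in the context).
   Context: For a group $G$: $Z(G)$ is the center, $\gamma_2(G)$ the commutator subgroup, $\mathrm{Inn}(G)$ the group of inner automorphisms, $Z(\mathrm{Inn}(G))$ the center of $\mathrm{Inn}(G)$, and $cl(G)$ the nilpotency class. An automorphism $\alpha$ of $G$ is central if $x^{-1}\alpha(x)\in Z(G)$ for all $x\in G$; $\mathrm{Aut}_z(G)$ is the group of all central automorphisms of $G$. Commutators are $[x,y]=x^{-1}y^{-1}xy$. Isoclinism: two groups $G,H$ are isoclinic if there are isomorphisms $\theta:G/Z(G)\to H/Z(H)$ and $\phi:\gamma_2(G)\to\gamma_2(H)$ such that $\phi([x,y])=[x',y']$ whenever $x'Z(H)=\theta(xZ(G))$ and $y'Z(H)=\theta(yZ(G))$. The equivalence classes are the isoclinism families; $\Phi_n$ is the numbering of families in R. James, ''The groups of order $p^6$ ($p$ an odd prime)'', Math. Comp. 34 (1980). Let $\nu$ be a fixed integer that is a quadratic non-residue modulo $p$, and let $\delta=1$ if $p=3$, $\delta=0$ if $p>3$.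 In the presentations below, every commutator of two listed generators that is not determined by the listed commutator relations is trivial. All these groups have order $p^6$. The four families $\Phi_{25},\Phi_{26},\Phi_{28},\Phi_{29}$ are together the isoclinism classes of the four groups $A_{k,e}$, $k\in\{1,\nu\}$, $e\in\{0,1\}$, where $A_{k,e}$ is generated by $\alpha,\alpha_1,\alpha_2,\alpha_3,\alpha_4$ subject to $$[\alpha_i,\alpha]=\alpha_{i+1}\ (i=1,2,3),\quad [\alpha_1,\alpha_2]=\alpha_4^{e},\quad \alpha^{p^2}=\alpha_3^p=\alpha_4^p=1,$$ $$\alpha_1^{p}\,\alpha_2^{\binom p2}\,\alpha_3^{\binom p3}\,\alpha_4^{\binom p4}=\alpha_3^{k},\qquad \alpha_2^{p}\,\alpha_3^{\binom p2}\,\alpha_4^{\binom p3}=\alpha_4^{k}.$$ The four families $\Phi_{40},\Phi_{41},\Phi_{42},\Phi_{43}$ are together the isoclinism classes of the four groups $B_0,B_1,C_0,C_1$. Here, for $c\in\{0,1\}$, $B_c$ is generated by $\alpha_1,\alpha_2,\beta,\beta_1,\beta_2,\gamma$ subject to $$[\alpha_1,\alpha_2]=\beta,\ [\beta,\alpha_i]=\beta_i\ (i=1,2),\ [\beta_1,\alpha_2]=[\beta_2,\alpha_1]=\gamma,$$ $$\alpha_1^p=\beta_1^{c},\ \alpha_2^p=\beta_2^{-c},\ \beta^p=\gamma^{c},\ \beta_1^p=\beta_2^p=\gamma^p=1,$$ and $C_c$ is generated by $\alpha_1,\alpha_2,\beta,\beta_1,\beta_2,\gamma$ subject to $$[\alpha_1,\alpha_2]=\beta,\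 [\beta,\alpha_i]=\beta_i\ (i=1,2),\ [\beta_1,\alpha_1]=\gamma,\ [\beta_2,\alpha_2]=\gamma^{-\nu},$$ $$\alpha_1^p=\beta_2^{a},\ \alpha_2^p=\beta_1^{\delta\nu-c},\ \beta^p=\gamma^{c},\ \beta_1^p=\beta_2^p=\gamma^p=1,$$ where $a$ is an integer with $\nu a\equiv -(c+\delta)\pmod p$. The statement depends only on the union of the eight families. *)

(* Defs.v *)
From mathcomp Require Import all_boot all_order all_algebra.
From mathcomp Require Import all_fingroup all_solvable.

Set Implicit Arguments.
Unset Strict Implicit.
Unset Printing Implicit Defensive.

Local Open Scope group_scope.

Definition quad_nonresidue (p : nat) (nu : int) : Prop :=
  ~ exists x : int, (x ^+ 2 = nu %[mod p%:Z])%Z.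

Definition Inn (gT : finGroupType) (G : {group gT}) : {group {perm gT}} :=
  (conj_aut G @* G)%G.

Definition Aut_z (gT : finGroupType) (G : {group gT}) : {set {perm gT}} :=
  [set a in Aut G | [forall x in G, x^-1 * a x \in 'Z(G)]].

Definition isoclinic (gT hT : finGroupType) (G : {group gT}) (H : {group hT}) :
    Prop :=
  exists (theta : {morphism G / 'Z(G) >-> coset_of 'Z(H)})
         (phi : {morphism G^`(1) >-> hT}),
    [/\ isom (G / 'Z(G)) (H / 'Z(H)) theta,
        isom G^`(1) H^`(1) phi
      & forall x y x' y',
          x \in G -> y \in G -> x' \in H -> y' \in H ->
          coset 'Z(H) x' = theta (coset 'Z(G) x) ->
          coset 'Z(H) y' = theta (coset 'Z(G) y) ->
          phi [~ x, y] = [~ x', y']].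

(* Integer powers inside presentations: the library only has natural ones. *)
Definition Expz (t : Presentation.term) (m : int) : Presentation.term :=
  match m with
  | Posz n => Presentation.Exp t n
  | Negz n => Presentation.Inv (Presentation.Exp t n.+1)
  end.

Notation "x ^z m" := (Expz x m)
  (in custom group_presentation at level 29, m constr at level 28).

(* [H \isog Grp (...)] says that H is the largest finite quotient of the presented
   group; the groups presented below are finite (of order p ^ 6), so it says that
   H is isomorphic to the presented group. *)

Definition is_A (p : nat) (k : int) (e : bool)
    (hT : finGroupType) (H : {group hT}) : Prop :=
  H \isog Grp (a : a1 : a2 : a3 : a4 :
    [~ a1, a] = a2, [~ a2, a] = a3, [~ a3, a] = a4, [~ a1, a2] = a4 ^+ e,
    [~ a4, a], [~ a1, a3], [~ a1, a4], [~ a2, a3], [~ a2, a4], [~ a3, a4],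
    a ^+ (p ^ 2)%N, a3 ^+ p, a4 ^+ p,
    a1 ^+ p * a2 ^+ 'C(p, 2) * a3 ^+ 'C(p, 3) * a4 ^+ 'C(p, 4) = a3 ^z k,
    a2 ^+ p * a3 ^+ 'C(p, 2) * a4 ^+ 'C(p, 3) = a4 ^z k).

Definition is_B (p : nat) (c : bool) (hT : finGroupType) (H : {group hT}) :
    Prop :=
  H \isog Grp (a1 : a2 : b : b1 : b2 : g :
    [~ a1, a2] = b, [~ b, a1] = b1, [~ b, a2] = b2,
    [~ b1, a2] = g, [~ b2, a1] = g,
    [~ b1, a1], [~ b2, a2], [~ b, b1], [~ b, b2], [~ b1, b2],
    [~ g, a1], [~ g, a2], [~ g, b], [~ g, b1], [~ g, b2],
    a1 ^+ p = b1 ^+ c, a2 ^+ p = b2 ^- c, b ^+ p = g ^+ c,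
    b1 ^+ p, b2 ^+ p, g ^+ p).

Definition delta (p : nat) : int := if p == 3 then 1%R else 0%R.

(* Since b2 ^+ p = 1 and nu is invertible mod p, the choice of m is immaterial. *)
Definition is_C (p : nat) (nu : int) (c : bool)
    (hT : finGroupType) (H : {group hT}) : Prop :=
  exists m : int,
    (nu * m = - (c%:Z + delta p) %[mod p%:Z])%Z /\
    H \isog Grp (a1 : a2 : b : b1 : b2 : g :
      [~ a1, a2] = b, [~ b, a1] = b1, [~ b, a2] = b2,
      [~ b1, a1] = g, [~ b2, a2] = g ^z (- nu)%R,
      [~ b1, a2], [~ b2, a1], [~ b, b1], [~ b, b2], [~ b1, b2],
      [~ g, a1], [~ g, a2], [~ g, b], [~ g, b1], [~ g, b2],
      a1 ^+ p = b2 ^z m, a2 ^+ p = b1 ^z (delta p * nu - c%:Z)%R,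
      b ^+ p = g ^+ c, b1 ^+ p, b2 ^+ p, g ^+ p).

(* James' families Phi_25, Phi_26, Phi_28, Phi_29 are the isoclinism classes of
   the groups of is_A; Phi_40, ..., Phi_43 those of is_B and is_C. *)
Definition in_the_eight_families (p : nat) (nu : int)
    (gT : finGroupType) (G : {group gT}) : Prop :=
  exists (hT : finGroupType) (H : {group hT}),
    isoclinic G H /\
    [\/ exists e : bool, is_A p 1%R e H,
        exists e : bool, is_A p nu e H,
        exists c : bool, is_B p c H
      | exists c : bool, is_C p nu c H].

(* Main.v *)
(* The condition Aut_z(G) = Z(Inn G) makes every homomorphism from G to a cyclic
   central subgroup inner: x |-> x f(x) is a central automorphism unless f inverts
   some nontrivial element, and in that case f^-1 can be used instead.  For z of
   order p in Z(G), the elements y with [G, y] <= <z> then form a subgroup W whose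
   centralizer lies in Phi(G), and the pairing G/Phi(G) x W/Z(G) -> <z> bounds the
   ranks.  With |G| = p^6 this excludes class 3, and in class 4 it gives |Z| = p,
   |Z_2| = p^3 and Z_3 = Phi(G) = C_G(Z_2), of order p^4 and abelian.

   Fix c in Phi(G) outside Z_2.  Then (x, y) |-> [c, x, y] is a symmetric bilinear
   form on G/Phi(G) with values in Z(G).  If it is degenerate one obtains the
   commutator relations of the groups A_{k,e}; if it is nondegenerate, those of B_c
   when it is isotropic and of C_c when it is anisotropic.  Changing generators
   normalizes the remaining constants.  These relations, with the p-th powers of
   elements of G', determine G up to isoclinism: in G x H the subgroup generated by
   the pairs of corresponding generators satisfies them too, so its derived
   subgroup is no larger than G' and H'.  Conversely they exhibit two elements of
   Z_2 dual to the generators, which forces |Z| = p and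
   |Aut_z(G)| <= p^2 <= |Z(Inn G)|.

   That no relation collapses in the presented groups is seen in quotients of an
   explicit group of permutations of (Z/p^2)^6. *)

Require Import Defs.
From mathcomp Require Import all_boot all_order all_algebra.
From mathcomp Require Import all_fingroup all_solvable.
From mathcomp Require Import ring zify.
From Stdlib Require Import Classical.

Set Implicit Arguments.
Unset Strict Implicit.
Unset Printing Implicit Defensive.

Local Open Scope group_scope.

(** * Squares modulo p *)

(** A presented group is accessible only through its finite quotients, so neither the existence of a
    finite universal one nor the survival of its last generator comes for free. The relations are
    therefore split. The commutator relations and the p-th powers in the derived subgroup hold in
    the permutation model; the power relations of the two generators hold there only up to central
    elements, which are divided out. What remains is that the subgroup divided out misses the last
    generator.

    The constants come from the collection formula [x^p, y] = c^p c1^C(p,2) c2^C(p,3). As p is odd,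
    p divides C(p,2), but it divides C(p,3) only for p > 3; this is the origin of [delta]. The
    nonresidue enters because replacing a by a^s divides k by s^2, which leaves two classes of k,
    and because an anisotropic binary form over F_p is x^2 - nu y^2 up to a factor. The exponent q
    in c^p = z^q is brought to 0 or 1 by a change of generators of determinant q that multiplies the
    Gram matrix by a scalar. *)

Section Squares.

Import GRing.Theory.

Variables (p : nat) (p_pr : prime p).
Local Open Scope ring_scope.

(** The unit group is cyclic and its squares are the even powers of a generator. The nonresidue [n]
    is an odd power, so a non-square [k] differs from [n] by an even power. *)
Lemma Fp_square_or (n k : 'F_p) : (forall x, x ^+ 2 != n) -> k != 0 ->
  exists2 s, s != 0 & k = s ^+ 2 \/ k = n * s ^+ 2.
Proof.
move=> nsq nz.
have /cyclicP[g defU] : cyclic [set: {unit 'F_p}] := field_unit_group_cyclic _.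
have powg (x : 'F_p) : x != 0 -> exists i, x = val g ^+ i.
  rewrite -unitfE => Ux; have : FinRing.unit _ Ux \in <[g]>%g by rewrite -defU inE.
  by case/cycleP=> i /(congr1 val)/=; rewrite FinRing.val_unitX; exists i.
have nzg i : val g ^+ i != 0.
  by rewrite expf_neq0 // -unitfE; apply: (valP g).
have sq i : exists s, val g ^+ i = s ^+ 2 * val g ^+ odd i.
  by exists (val g ^+ i./2); rewrite -exprM -exprD muln2 addnC odd_double_half.
have nz_sq (s x y : 'F_p) : y = x * s ^+ 2 -> y != 0 -> s != 0.
  by move=> -> ; apply: contraNneq => ->; rewrite expr0n mulr0.
have [i def_k] := powg k nz; have [s es] := sq i.
have [|j def_n] := powg n.
  by rewrite eq_sym; apply: contraNneq (nsq 0) => <-; rewrite expr0n.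
have [t et] := sq j.
have oj : odd j.
  by apply: contraNT (nsq t) => /negPf ej; rewrite def_n et ej mulr1.
rewrite oj expr1 in et.
have nzt : t != 0.
  by apply: (nz_sq _ (val g) (val g ^+ j)) => //; rewrite et mulrC.
have nzs : s != 0.
  by apply: (nz_sq _ (val g ^+ odd i) (val g ^+ i)) => //; rewrite es mulrC.
case: (odd i) es => es; last by exists s => //; left; rewrite def_k es mulr1.
exists (s / t); first by rewrite mulf_neq0 ?invr_neq0.
by right; rewrite def_k def_n es et expr1; field.
Qed.

(** Surjectivity of the norm of F_p(sqrt n). Some x0^2 - n is a non-square: otherwise the squares,
    closed under adding -n, would contain all multiples of -n, hence n itself. If k is not a square,
    it is (x0^2 - n) s^2, the norm of x0 s + s sqrt n. *)
Lemma Fp_norm_form (n k : 'F_p) : (forall x, x ^+ 2 != n) -> k != 0 ->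
  exists x y, k = x ^+ 2 - n * y ^+ 2.
Proof.
move=> nsq nz.
have [x0 nsq0] : exists x0, forall x, x ^+ 2 != x0 ^+ 2 - n.
  have [/existsP[x0 /forallP h]|] :=
    boolP [exists x0 : 'F_p, [forall x, x ^+ 2 != x0 ^+ 2 - n]]; first by exists x0.
  rewrite negb_exists => /forallP h.
  have sq j : exists x : 'F_p, x ^+ 2 = - n *+ j.
    elim: j => [|j [x ex]]; first by exists 0; rewrite expr0n mulr0n.
    have := h x; rewrite negb_forall => /existsP[y]; rewrite negbK => /eqP ey.
    by exists y; rewrite ey ex mulrSr.
  have [x ex] := sq p.-1; case/negP: (nsq x); rewrite ex.
  rewrite mulNrn -subr_eq0 -opprD -mulrSr prednK ?prime_gt0 // -mulr_natr.
  by rewrite pchar_Fp_0 // mulr0 oppr0.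
have [s _ [-> | ->]] := Fp_square_or nsq0 nz; first by exists s, 0; rewrite expr0n mulr0 subr0.
by exists (x0 * s), s; ring.
Qed.

Lemma Fp_nat_inj (m n : nat) : (m%:R == n%:R :> 'F_p) = (m == n %[mod p])%N.
Proof. by rewrite -val_eqE /= !val_Fp_nat. Qed.

Lemma Fp_dvd (m : nat) : (m%:R == 0 :> 'F_p) = (p %| m)%N.
Proof. by rewrite -[0]/(0%:R) Fp_nat_inj mod0n. Qed.

Let FpE (x : 'F_p) : x = (x : nat)%:R.
Proof. by rewrite natr_Zp. Qed.

Lemma Fp_nonsquare (n : nat) : (forall x, x ^ 2 != n %[mod p])%N ->
  forall x : 'F_p, x ^+ 2 != n%:R.
Proof. by move=> nsq x; rewrite [x]FpE -natrX Fp_nat_inj. Qed.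

Lemma modn_square_or (n k : nat) : (forall x, x ^ 2 != n %[mod p])%N ->
  ~~ (p %| k)%N -> exists2 s, ~~ (p %| s)%N &
    (k = s ^ 2 %[mod p])%N \/ (k = n * s ^ 2 %[mod p])%N.
Proof.
move=> nsq nk; have nsqF := Fp_nonsquare nsq.
have nzk : k%:R != 0 :> 'F_p by rewrite Fp_dvd.
have [s nzs es] := Fp_square_or nsqF nzk; exists s; first by rewrite -Fp_dvd -FpE.
by case: es => es; [left | right]; apply/eqP;
  rewrite -Fp_nat_inj es ?[(n * _)%:R]natrM natrX -FpE eqxx.
Qed.

(** The natural number [n'] stands for -n: these congruences are applied to exponents in a group. *)
Lemma modn_norm_form (n n' k : nat) : (forall x, x ^ 2 != n %[mod p])%N ->
  (p %| n + n')%N -> ~~ (p %| k)%N ->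
  exists x y, (x ^ 2 + n' * y ^ 2 = k %[mod p])%N.
Proof.
move=> nsq nn' nk; have nsqF := Fp_nonsquare nsq.
have nzk : k%:R != 0 :> 'F_p by rewrite Fp_dvd.
have [x [y exy]] := Fp_norm_form nsqF nzk; exists x, y.
have en : n%:R = - n'%:R :> 'F_p.
  by apply/eqP; rewrite -addr_eq0 -natrD Fp_dvd.
apply/eqP; rewrite -Fp_nat_inj natrD natrM !natrX -!FpE exy en.
by rewrite mulNr opprK.
Qed.

Lemma modn_solve (e r : nat) : ~~ (p %| e)%N -> exists t, (e * t = r %[mod p])%N.
Proof.
move=> ne; have nz : e%:R != 0 :> 'F_p by rewrite Fp_dvd.
exists (r%:R / e%:R : 'F_p); apply/eqP.
by rewrite -Fp_nat_inj natrM natr_Zp mulrCA divff // mulr1.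
Qed.

(* [- m] and [n] are nonresidues, so [n' / m] is a square. *)
Lemma modn_square_ratio (n n' m : nat) : (forall x, x ^ 2 != n %[mod p])%N ->
    (p %| n + n')%N -> (forall s, ~~ (p %| s ^ 2 + m))%N ->
  exists2 t, ~~ (p %| t)%N & (m * t ^ 2 = n' %[mod p])%N.
Proof.
move=> nsq nn' nm; have nsqF := Fp_nonsquare nsq.
have en : n%:R = - n'%:R :> 'F_p.
  by apply/eqP; rewrite -addr_eq0 -natrD Fp_dvd.
have nsq_m (x : 'F_p) : x ^+ 2 + m%:R != 0.
  by rewrite [x]FpE -natrX -natrD Fp_dvd.
have nz : - m%:R != 0 :> 'F_p.
  by have := nsq_m 0; rewrite expr0n add0r oppr_eq0.
have [s nzs [] es] := Fp_square_or nsqF nz.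
  by case/negP: (nsq_m s); rewrite -es addNr.
exists (s^-1 : 'F_p); first by rewrite -Fp_dvd -FpE invr_eq0.
apply/eqP; rewrite -Fp_nat_inj natrM natrX -FpE.
have -> : n'%:R = m%:R / s ^+ 2 :> 'F_p.
  have -> : m%:R = n'%:R * s ^+ 2 :> 'F_p by apply: oppr_inj; rewrite es en mulNr.
  by rewrite mulfK // expf_neq0.
by rewrite exprVn.
Qed.

End Squares.

(** * Commutator identities and cyclic extensions *)

(** Conjugation by x takes c to c c1 and c1 to c1 c2, so passing from n to n + 1 changes the
    exponents by Pascal's rule. *)
Lemma commXg_bin (gT : finGroupType) (x y c c1 c2 : gT) n :
    [~ x, y] = c -> [~ c, x] = c1 -> [~ c1, x] = c2 ->
    commute c c1 -> commute c c2 -> commute c1 c2 -> commute c2 x ->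
  [~ x ^+ n, y] = c ^+ n * c1 ^+ 'C(n, 2) * c2 ^+ 'C(n, 3).
Proof.
move=> def_c def_c1 def_c2 cc1 cc2 c12 c2x.
elim: n => [|n IHn]; first by rewrite comm1g !mulg1.
rewrite expgSr commMgJ IHn !conjMg !conjXg [c ^ x]conjg_mulR [c1 ^ x]conjg_mulR.
rewrite [c2 ^ x]conjgE c2x mulKg def_c def_c1 def_c2 !binS bin1 !expgMn //.
rewrite ['C(n, 2) + n]addnC ['C(n, 3) + _]addnC expgSr.
rewrite [c1 ^+ (_ + _)]expgD [c2 ^+ (_ + _)]expgD -!mulgA; congr (_ * _).
have cc1X i : commute c (c1 ^+ i) by apply: commuteX.
have cc2X i : commute c (c2 ^+ i) by apply: commuteX.
by rewrite [RHS](commuteM (cc1X _) (commuteM (cc1X _) (commuteM (cc2X _) (cc2X _)))) -!mulgA.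
Qed.

(** From k C(p^2, k) = p^2 C(p^2 - 1, k - 1): if p did not divide the binomial coefficient, p^2
    would divide k. *)
Lemma dvdn_bin_sqr p k : prime p -> 0 < k < p ^ 2 -> p %| 'C(p ^ 2, k).
Proof.
move=> p_pr /andP[k_gt0 k_lt]; apply: contraLR k_lt => ndvd; rewrite -leqNgt.
apply: dvdn_leq => //; rewrite -(@Gauss_dvdl _ _ 'C(p ^ 2, k)); last first.
  by rewrite coprimeXl // prime_coprime.
case: k k_gt0 ndvd => // k _ _; rewrite -(prednK (_ : 0 < p ^ 2)) ?expn_gt0 ?prime_gt0 //.
by rewrite -mul_bin_diag dvdn_mulr.
Qed.

Section CommutatorIdentities.

Variable gT : finGroupType.
Implicit Types x y b : gT.

Lemma commVg_commute x y : commute x [~ x, y] -> [~ x^-1, y] = [~ x, y]^-1.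
Proof.
move=> cxy; apply: (conjg_inj x); rewrite conjVg.
rewrite [in RHS](conjg_fixP _); last by apply/commgP/commute_sym.
apply: (mulIg [~ x, y]).
by rewrite -commMgJ mulVg comm1g mulVg.
Qed.

Lemma commMg_commute x y b :
  commute [~ x, b] y -> [~ x * y, b] = [~ x, b] * [~ y, b].
Proof. by move=> cxy; rewrite commMgJ (conjg_fixP _) //; apply/commgP. Qed.

Lemma commute_divg x y b : [~ x, b] = [~ y, b] -> commute (x * y^-1) b.
Proof.
move=> exy; apply/commgP/conjg_fixP.
by rewrite conjMg conjVg !conjg_mulR exy invMg mulgA mulgK.
Qed.

Lemma eq_of_divg1 x y : x * y^-1 = 1 -> x = y.
Proof. by move/(canRL (mulgKV _)); rewrite mul1g. Qed.

End CommutatorIdentities.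

Lemma dvdn_bin2 p : prime p -> odd p -> p %| 'C(p, 2).
Proof. by move=> p_pr p_odd; apply: prime_dvd_bin => //; rewrite odd_prime_gt2. Qed.

Lemma expg_muln (gT : finGroupType) (x : gT) p i : x ^+ p = 1 -> x ^+ (i * p) = 1.
Proof. by move=> xp; rewrite mulnC expgM xp expg1n. Qed.

Section Join.

Variable gT : finGroupType.
Implicit Types (L K : {group gT}) (x y : gT).

Lemma card_join_cycle_order L x : x \in 'N(L) ->
  #|L <*> <[x]>| = (#|L| * #[coset L x])%N.
Proof.
move=> nLx; have nLX : <[x]> \subset 'N(L) by rewrite cycle_subG.
rewrite -(Lagrange (joing_subl L <[x]>)) /=.
rewrite -card_quotient ?join_subG ?normG // joingC quotientYidr //.
by rewrite quotient_cycle.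
Qed.

Lemma card_join_cycle_dvd L x n : x \in 'N(L) -> x ^+ n \in L ->
  exists2 m, m %| n & #|L <*> <[x]>| = (#|L| * m)%N /\ (m == 1%N -> x \in L).
Proof.
move=> nLx Lxn; exists #[coset L x]; first by rewrite order_dvdn -morphX //= coset_id.
split; first exact: card_join_cycle_order.
by rewrite order_eq1 => /eqP; apply: coset_idr.
Qed.

Lemma card_join_cycle_le L x n : 0 < n -> x \in 'N(L) -> x ^+ n \in L ->
  #|L <*> <[x]>| <= #|L| * n.
Proof.
move=> n_gt0 nLx /(card_join_cycle_dvd nLx)[m m_n [-> _]].
by rewrite leq_mul2l dvdn_leq ?orbT.
Qed.

Lemma card_join_cycle L x p : prime p -> x \in 'N(L) -> x ^+ p \in L ->
  x \notin L -> #|L <*> <[x]>| = (#|L| * p)%N.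
Proof.
move=> p_pr nLx /(card_join_cycle_dvd nLx)[m m_n [-> m1]] notLx.
case/primeP: p_pr => _ /(_ m m_n)/orP[/m1 Lx|/eqP-> //].
by rewrite Lx in notLx.
Qed.

Lemma norm_join_cycle L x y :
  x \in 'N(L) -> [~ y, x] \in L -> x \in 'N(L <*> <[y]>).
Proof.
move=> nLx Lyx; rewrite inE {1}joingE -genJ conjUg gen_subG subUset.
rewrite (normP nLx) joing_subl -cycleJ cycle_subG conjg_mulR groupM //.
  by rewrite (subsetP (joing_subr _ _)) ?cycle_id.
by rewrite (subsetP (joing_subl _ _)).
Qed.

Lemma mem_joinl L K x : x \in L -> x \in L <*> K.
Proof. exact: (subsetP (joing_subl _ _)). Qed.

Lemma mem_joinr L x : x \in L <*> <[x]>.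
Proof. by apply: (subsetP (joing_subr _ _)); apply: cycle_id. Qed.

(** Modulo L the two generators commute, so the quotient is abelian. *)
Lemma der1_gen2 L x y : x \in 'N(L) -> y \in 'N(L) -> [~ x, y] \in L ->
  (<[x]> <*> <[y]>)^`(1) \subset L.
Proof.
move=> nLx nLy Lxy; apply: der1_min; first by rewrite join_subG !cycle_subG nLx.
rewrite quotientY ?cycle_subG // !quotient_cycle // abelianY !cycle_abelian /=.
rewrite cent_cycle cycle_subG; apply/cent1P; apply/commgP; apply/eqP.
by rewrite -morphR //= coset_id // -invg_comm groupV.
Qed.

End Join.

(** * Presented groups *)

Section PresentationSemantics.

Import Presentation.

Lemma and_relE (xT : finType) (x1 x2 : xT) r :
  @and_rel xT x1 x2 r = (x1 == x2) && r :> bool.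
Proof. by case: r => //=; rewrite andbT. Qed.

Fixpoint holds (gT : finGroupType) (e : seq gT) (f : formula) : Prop :=
  match f with
  | Eq2 s t => eval e s = eval e t
  | And f1 f2 => holds e f1 /\ holds e f2
  end.

Lemma holdsP (gT : finGroupType) (e : seq gT) f (r : rel_type) :
  rel e f r <-> holds e f /\ r.
Proof.
elim: f r => [s t | f1 IH1 f2 IH2] r /=.
  by rewrite and_relE; split=> [/andP[/eqP] | [-> ->]] //; rewrite eqxx.
by rewrite IH1 IH2; tauto.
Qed.

(** A propositional reading of the boolean [sat], from which witnesses can be destructed. Generators
    form pairs nested to the left, and the environment lists them in reverse order, hence [rev]. *)
Fixpoint holds_sat (gT : finGroupType) (B : {set gT}) (vT : finType) n
    (s : vT -> env gT) (p : type) {struct p} : Prop :=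
  match p with
  | Formula f => exists v, let: Env A e := s v in A = B /\ holds (rev e) f
  | Generator p' =>
    @holds_sat gT B (vT * gT)%type n.+1 (fun v : vT * gT =>
      let: Env A e := s v.1 in Env (A <*> <[v.2]>) (v.2 :: e)) (p' (Cst n))
  end.

Lemma homGrp_holds (gT : finGroupType) (B : {set gT}) p :
  B \homg Grp p <-> holds_sat B 1 (@env1 gT) (p (Cst 0)).
Proof.
rewrite /hom; move: (p _) => {}p; move: (gT : finType) (@env1 gT) 1%N.
elim: p => [p IHp | f] vT s n /=; first exact: IHp.
split=> [/existsP[v] | [v]].
  case def_s: (s v) => [A e]; rewrite and_relE => /andP[/eqP defA /holdsP[hf _]].
  by exists v; rewrite def_s.
case def_s: (s v) => [A e] [defA hf]; apply/existsP; exists v.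
by rewrite def_s and_relE defA eqxx; apply/holdsP.
Qed.

End PresentationSemantics.

Section Subdirect.

Import Presentation.

Variables gT hT : finGroupType.

Lemma eval_zip (e1 : seq gT) (e2 : seq hT) t : size e1 = size e2 ->
  eval (zip e1 e2) t = (eval e1 t, eval e2 t).
Proof.
move=> sz12; elim: t => //=.
- by move=> i; rewrite -[1]/(1, 1) nth_zip.
- by move=> t ->.
- move=> t -> n; elim: n => [|n IHn]; first by rewrite !expg0.
  by rewrite !expgS IHn.
- by move=> t1 -> t2 ->.
- by move=> t1 -> t2 ->.
- by move=> t1 -> t2 ->.
Qed.

Lemma rel_zip (e1 : seq gT) (e2 : seq hT) f (r r1 r2 : rel_type) :
    size e1 = size e2 -> (r1 -> r2 -> r) ->
  rel e1 f r1 -> rel e2 f r2 -> rel (zip e1 e2) f r.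
Proof.
move=> sz12; elim: f r r1 r2 => [t u | f1 IH1 f2 IH2] r r1 r2 rr /=.
  rewrite !and_relE !eval_zip // => /andP[/eqP-> h1] /andP[/eqP-> h2].
  by rewrite eqxx rr.
by apply: IH1; apply: IH2.
Qed.

(** The witness is generated by the pairs of corresponding generators; a relation holds for pairs
    when it holds in both components. The invariant [link] carries this through the nested
    quantifiers over generators, whose index types grow with each generator. *)
Lemma homGrp_subdirect (G : {group gT}) (H : {group hT}) p :
    G \homg Grp p -> H \homg Grp p ->
  exists D : {group gT * hT},
    [/\ D \homg Grp p, @fst gT hT @* D = G & @snd gT hT @* D = H].
Proof.
rewrite /hom; move: {p}(p _) => p.
pose link (E1 : env gT) (E2 : env hT) (E : env (gT * hT)%type) :=
  let: Env A1 e1 := E1 in let: Env A2 e2 := E2 in let: Env A e := E in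
  [/\ size e1 = size e2, e = zip e1 e2,
      exists D : {group gT * hT}, A = D,
      @fst gT hT @* A = A1 & @snd gT hT @* A = A2].
suff gen q n (vT1 vT2 vT3 : finType) (s1 : vT1 -> env gT) (s2 : vT2 -> env hT)
    (s3 : vT3 -> env (gT * hT)%type) :
    (forall v1 v2, exists v, link (s1 v1) (s2 v2) (s3 v)) ->
  sat G n s1 q -> sat H n s2 q -> exists D : {group gT * hT},
    [/\ sat D n s3 q, @fst gT hT @* D = G & @snd gT hT @* D = H].
  apply: gen => v1 v2; exists (v1, v2); split=> //; first by exists <[(v1, v2)]>%G.
    by rewrite morphim_cycle ?inE.
  by rewrite morphim_cycle ?inE.
elim: q n vT1 vT2 vT3 s1 s2 s3 => /= [q IHq | f] n vT1 vT2 vT3 s1 s2 s3 lks.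
  apply: IHq => [[v1 x1] [v2 x2]] /=.
  have [v lkv] := lks v1 v2; exists (v, (x1, x2)) => /=.
  case: (s1 v1) (s2 v2) (s3 v) lkv => [A1 e1] [A2 e2] [A e] /=.
  case=> sz -> [D ->] <- <-.
  split; rewrite ?sz //; first by exists (D <*> <[(x1, x2)]>)%G.
    by rewrite morphimY ?subsetT // morphim_cycle ?inE.
  by rewrite morphimY ?subsetT // morphim_cycle ?inE.
case/existsP=> v1 h1 /existsP[v2 h2]; have [v] := lks v1 v2.
case: (s1 v1) h1 => A1 e1 /=; rewrite and_relE => /andP[/eqP-> h1].
case: (s2 v2) h2 => A2 e2 /=; rewrite and_relE => /andP[/eqP-> h2].
case def_v: (s3 v) => [A e] /= [sz def_e [D defA] p1 p2].
exists D; split; rewrite -?defA //.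
apply/existsP; exists v; rewrite def_v and_relE eqxx /= def_e.
rewrite (_ : rev (zip e1 e2) = zip (rev e1) (rev e2)) ?rev_zip //.
by apply: rel_zip h1 h2; rewrite ?size_rev.
Qed.

End Subdirect.

(* A quotient of maximal order is universal, since two quotients of a presented group
   are both images of a common subdirect product that is again a quotient. *)
Lemma isoGrp_exists N p :
    (exists gT : finGroupType, exists G : {group gT}, G \homg Grp p) ->
    (forall (gT : finGroupType) (G : {group gT}), G \homg Grp p -> #|G| <= N) ->
  exists gT : finGroupType, exists G : {group gT}, G \isog Grp p.
Proof.
move=> exG leN.
have [gT [G [homG maxG]]]:
  exists gT : finGroupType, exists G : {group gT}, G \homg Grp p /\
    forall (hT : finGroupType) (H : {group hT}), H \homg Grp p -> #|H| <= #|G|.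
  (* Descent on [N - #|G|]. Whether a larger quotient exists is a question about all finite groups,
     hence the excluded middle. *)
  have [n leNn] := ubnP N.
  have{exG leNn}: exists gT : finGroupType, exists G : {group gT},
    G \homg Grp p /\ N - #|G| < n.
    case: exG => gT [G homG]; exists gT, G; split=> //.
    by apply: leq_ltn_trans leNn; apply: leq_subr.
  elim: n => // [[? [? []]] // | n IHn] [gT [G [homG ltGn]]].
  have [|noBig] := classic (exists gT : finGroupType, exists G : {group gT},
    G \homg Grp p /\ N - #|G| < n).
    exact: IHn.
  exists gT, G; split=> // hT H homH; rewrite leqNgt; apply/negP=> ltGH.
  case: noBig; exists hT, H; split=> //.
  rewrite ltnS in ltGn; apply: leq_trans ltGn.
  by rewrite ltn_sub2l // (leq_trans ltGH) ?leN.
exists gT, G; apply: intro_isoGrp => // hT H homH.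
have [D [homD defG defH]] := homGrp_subdirect homG homH.
have homGD : G \homg D by rewrite -defG morphim_homg ?subsetT.
have isoDG : G \isog D.
  by rewrite isogEcard homGD maxG.
by rewrite (eq_homgr _ isoDG) -defH morphim_homg ?subsetT.
Qed.

(** * Isoclinism from commutator relations *)

(** [h] is [g] factored through [f]; equality of the kernels makes it injective. *)
Lemma isom_of_ker_eq (dT qT rT : finGroupType) (D : {group dT})
    (f : {morphism D >-> qT}) (g : {morphism D >-> rT}) A B :
    'ker f = 'ker g -> A = f @* D -> B = g @* D ->
  exists h : {morphism A >-> rT}, isom A B h /\ {in D, forall x, h (f x) = g x}.
Proof.
move=> eqK -> ->; have sK : 'ker f \subset 'ker g by rewrite eqK.
exists [morphism of factm sK (subxx D)]; split; last exact: factmE.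
by apply/isomP; split; [apply/injm_factmP | apply: morphim_factm].
Qed.

(* Both projections of D are injective on D', hence identify G' with D' and with H',
   and the preimages of the two centers in D coincide. *)
Section IsoclinicSubdirect.

Variables (gT hT : finGroupType) (G : {group gT}) (H : {group hT}).
Variable D : {group gT * hT}.
Hypotheses (defG : @fst gT hT @* D = G) (defH : @snd gT hT @* D = H).
Hypotheses (leG : #|D^`(1)| <= #|G^`(1)|) (leH : #|D^`(1)| <= #|H^`(1)|).

Let fstD x : x \in D -> x.1 \in G.
Proof. by move=> Dx; rewrite -defG (mem_morphim (fst_morphism _ _)) ?inE. Qed.

Let sndD x : x \in D -> x.2 \in H.
Proof. by move=> Dx; rewrite -defH (mem_morphim (snd_morphism _ _)) ?inE. Qed.

Let fst_lift x : x \in G -> exists2 u, u \in D & u.1 = x.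
Proof. by rewrite -defG => /morphimP[u _ Du ->]; exists u. Qed.

Let snd_lift x : x \in H -> exists2 u, u \in D & u.2 = x.
Proof. by rewrite -defH => /morphimP[u _ Du ->]; exists u. Qed.

Lemma subdirect_inj1 : {in D^`(1) &, injective (@fst gT hT)}.
Proof.
apply/imset_injP; rewrite -(morphimEsub (fst_morphism _ _)) ?subsetT //.
by rewrite eqn_leq {1}(morphimEsub (fst_morphism _ _)) ?subsetT // leq_imset_card
  morphim_der ?subsetT // defG.
Qed.

Lemma subdirect_inj2 : {in D^`(1) &, injective (@snd gT hT)}.
Proof.
apply/imset_injP; rewrite -(morphimEsub (snd_morphism _ _)) ?subsetT //.
by rewrite eqn_leq {1}(morphimEsub (snd_morphism _ _)) ?subsetT // leq_imset_card
  morphim_der ?subsetT // defH.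
Qed.

Lemma subdirect_center u : u \in D -> (u.1 \in 'Z(G)) = (u.2 \in 'Z(H)).
Proof.
move=> Du; apply/idP/idP=> /centerP[_ cu]; apply/centerP.
  split=> [|y /snd_lift[v Dv <-]]; first exact: sndD.
  have := cu _ (fstD Dv); move=> /commgP/eqP c1; apply/commgP/eqP.
  have D1 := mem_commg Du Dv.
  by rewrite -[LHS]/([~ u, v].2) (subdirect_inj1 D1 (group1 _)).
split=> [|y /fst_lift[v Dv <-]]; first exact: fstD.
have := cu _ (sndD Dv); move=> /commgP/eqP c1; apply/commgP/eqP.
have D1 := mem_commg Du Dv.
by rewrite -[LHS]/([~ u, v].1) (subdirect_inj2 D1 (group1 _)).
Qed.

Lemma isoclinic_subdirect : isoclinic G H.
Proof.
have nZG : G \subset 'N('Z(G)) by apply: normal_norm; apply: center_normal.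
have nZH : H \subset 'N('Z(H)) by apply: normal_norm; apply: center_normal.
have mF1 : {in D &, {morph (fun u : gT * hT => coset 'Z(G) u.1) : u v / u * v}}.
  by move=> u v Du Dv; rewrite morphM // (subsetP nZG) ?fstD.
have mF2 : {in D &, {morph (fun u : gT * hT => coset 'Z(H) u.2) : u v / u * v}}.
  by move=> u v Du Dv; rewrite morphM // (subsetP nZH) ?sndD.
pose F1 := Morphism mF1; pose F2 := Morphism mF2.
have eqF : 'ker F1 = 'ker F2.
  apply/setP=> u; rewrite !inE; case Du: (u \in D) => //=.
  have nZu1 := subsetP nZG _ (fstD Du); have nZu2 := subsetP nZH _ (sndD Du).
  apply/eqP/eqP=> cu; apply: coset_id.
    by rewrite -subdirect_center // coset_idr.
  by rewrite subdirect_center // coset_idr.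
have mP1 : {in D^`(1) &, {morph @fst gT hT : u v / u * v}} by [].
have mP2 : {in D^`(1) &, {morph @snd gT hT : u v / u * v}} by [].
pose P1 := Morphism mP1; pose P2 := Morphism mP2.
have kP1 : 'ker P1 = 1.
  by apply/trivgP; apply/injmP=> u v Du Dv; apply: subdirect_inj1.
have kP2 : 'ker P2 = 1.
  by apply/trivgP; apply/injmP=> u v Du Dv; apply: subdirect_inj2.
have [||theta [iso_th thE]] := @isom_of_ker_eq _ _ _ D F1 F2 (G / 'Z(G)) (H / 'Z(H)) eqF.
- rewrite /quotient morphimEdom; apply/setP=> c.
  apply/morphimP/imsetP=> [[x nx /fst_lift[u Du <-] ->] | [u Du ->]].
    by exists u.
  by exists u.1; rewrite ?(subsetP nZG) ?fstD.
- rewrite /quotient morphimEdom; apply/setP=> c.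
  apply/morphimP/imsetP=> [[x nx /snd_lift[u Du <-] ->] | [u Du ->]].
    by exists u.
  by exists u.2; rewrite ?(subsetP nZH) ?sndD.
have [||| phi [iso_phi phiE]] := @isom_of_ker_eq _ _ _ _ P1 P2 G^`(1) H^`(1).
- by rewrite kP1 kP2.
- by rewrite [RHS]morphimEdom -(morphimEsub (fst_morphism _ _)) ?subsetT //
    morphim_der ?subsetT // defG.
- by rewrite [RHS]morphimEdom -(morphimEsub (snd_morphism _ _)) ?subsetT //
    morphim_der ?subsetT // defH.
exists theta, phi; split=> // x y x' y' Gx Gy Hx' Hy'.
have [u Du <-{x Gx}] := fst_lift Gx; have [v Dv <-{y Gy}] := fst_lift Gy.
rewrite (thE u Du) (thE v Dv) => /= /eqP e1 /eqP e2.
rewrite (phiE [~ u, v]) ?mem_commg //=.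
have nZ x : x \in H -> x \in 'N('Z(H)) by apply: subsetP.
have cZ z x : z \in 'Z(H) -> x \in H -> commute z x.
  by case/centerP=> _; apply.
move: e1 e2; rewrite !(sameP eqP (rcoset_kercosetP _ _)) ?nZ ?sndD //.
case/rcosetP=> z1 Zz1 -> /rcosetP[z2 Zz2 ->].
have [Hz1 Hz2]: z1 \in H /\ z2 \in H by split; apply: subsetP (center_sub H) _ _.
have c1 w : w \in H -> [~ z1, w] = 1 by move=> Hw; apply/eqP/commgP/cZ.
have c2 w : w \in H -> [~ w, z2] = 1.
  by move=> Hw; apply/eqP/commgP/commute_sym/cZ.
by rewrite commMgJ c1 ?groupM ?sndD // commgMJ c2 ?sndD // !conj1g mul1g mulg1.
Qed.
End IsoclinicSubdirect.

(** The elements commuting with [x] modulo [L]. Being the preimage of a centralizer, it is a group,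
    so an inclusion in it can be checked on generators. *)
Definition centmod (gT : finGroupType) (L : {group gT}) (x : gT) :=
  coset L @*^-1 'C[coset L x].

Lemma centmodE (gT : finGroupType) (L : {group gT}) (x y : gT) : x \in 'N(L) ->
  (y \in centmod L x) = (y \in 'N(L)) && ([~ y, x] \in L).
Proof.
move=> nLx; apply/morphpreP/andP=> -[nLy].
  move/cent1P/commgP; rewrite -morphR //= => /eqP Lyx; split=> //.
  by apply: coset_idr => //; rewrite groupR.
by move=> Lyx; split=> //; apply/cent1P/commgP; rewrite -morphR //= coset_id.
Qed.

(** * Orders of derived subgroups from commutator relations *)

Section Frames.

Variables (p : nat) (p_pr : prime p).

(* The relations of A_{k,e} without the p-th powers of [a] and [a1], which do not affect
   the isoclinism class. *)
Record A_frame k e (gT : finGroupType) (a a1 a2 a3 a4 : gT) : Prop := AFrame {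
  A_1a : [~ a1, a] = a2; A_2a : [~ a2, a] = a3; A_3a : [~ a3, a] = a4;
  A_12 : [~ a1, a2] = a4 ^+ e;
  A_4a : commute a4 a; A_13 : commute a1 a3; A_14 : commute a1 a4;
  A_23 : commute a2 a3; A_24 : commute a2 a4; A_34 : commute a3 a4;
  A_3p : a3 ^+ p = 1; A_4p : a4 ^+ p = 1;
  A_2p : a2 ^+ p * a3 ^+ 'C(p, 2) * a4 ^+ 'C(p, 3) = a4 ^+ k }.

Section AFrameTheory.

Variables (gT : finGroupType) (k e : nat) (a a1 a2 a3 a4 : gT).
Hypothesis fA : A_frame k e a a1 a2 a3 a4.

Let L4 : {group gT} := <[a4]>%G.
Let L3 : {group gT} := (<[a4]> <*> <[a3]>)%G.
Let L2 : {group gT} := (L3 <*> <[a2]>)%G.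

Lemma norm_com1 (x y : gT) : commute y x -> x \in 'N(<[y]>).
Proof.
move=> cxy; rewrite (subsetP (cent_sub _)) // cent_cycle; apply/cent1P.
exact: commute_sym.
Qed.

Lemma A_frame_norm : [/\ a3 \in 'N(L4), a2 \in 'N(L3), a1 \in 'N(L2) & a \in 'N(L2)].
Proof.
have n4 x : commute a4 x -> x \in 'N(L4) by apply: norm_com1.
have c1 (x y : gT) : commute x y -> [~ x, y] = 1 by move=> cxy; apply/eqP/commgP.
split.
- by apply/n4/commute_sym/(A_34 fA).
- apply: norm_join_cycle; first by apply/n4/commute_sym/(A_24 fA).
  by rewrite c1 //; apply/commute_sym/(A_23 fA).
- apply: norm_join_cycle; first apply: norm_join_cycle.
  + by apply/n4/commute_sym/(A_14 fA).
  + by rewrite c1 //; apply/commute_sym/(A_13 fA).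
  by rewrite -invg_comm groupV (A_12 fA) mem_joinl ?mem_cycle.
apply: norm_join_cycle; first apply: norm_join_cycle.
- exact/n4/(A_4a fA).
- by rewrite (A_3a fA) /= cycle_id.
by rewrite (A_2a fA) mem_joinr.
Qed.

Lemma A_frame_a2p : a2 ^+ p \in L3.
Proof.
have /(canRL (mulgK _))/(canRL (mulgK _)) -> := A_2p fA.
by rewrite !groupM ?groupV ?groupX ?mem_joinr // mem_joinl ?cycle_id.
Qed.

(** The factor [#[a4]] is kept because the bound is also applied where [a4] might be trivial; the
    drop in order then exposes the collapse. *)
Lemma A_frame_card_le : #|L2| <= #[a4] * p ^ 2.
Proof.
have [n3 n2 n1 n] := A_frame_norm; have p_gt0 := prime_gt0 p_pr.
apply: (leq_trans (card_join_cycle_le p_gt0 n2 A_frame_a2p)).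
rewrite expnSr mulnA leq_mul2r expn1 orbC card_join_cycle_le //.
by rewrite (A_3p fA) group1.
Qed.

Lemma A_frame_der_sub : (<[a]> <*> <[a1]>)^`(1) \subset L2.
Proof.
have [_ _ n1 n] := A_frame_norm.
by apply: der1_gen2; rewrite // -invg_comm (A_1a fA) groupV mem_joinr.
Qed.

Lemma A_frame_card_der_le : #|(<[a]> <*> <[a1]>)^`(1)| <= #[a4] * p ^ 2.
Proof. exact: leq_trans (subset_leq_card A_frame_der_sub) A_frame_card_le. Qed.

Lemma A_frame_card_gen_le : a ^+ (p ^ 2) = 1 -> a1 ^+ p \in L2 ->
  #|<[a]> <*> <[a1]>| <= p ^ 6.
Proof.
move=> ap a1p; have [n3 n2 n1 n] := A_frame_norm; have p_gt0 := prime_gt0 p_pr.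
have n' : a \in 'N(L2 <*> <[a1]>).
  by apply: norm_join_cycle; rewrite // (A_1a fA) mem_joinr.
have sub : <[a]> <*> <[a1]> \subset L2 <*> <[a1]> <*> <[a]>.
  by rewrite join_subG !cycle_subG mem_joinr mem_joinl ?mem_joinr.
apply: leq_trans (subset_leq_card sub) _.
have h := @card_join_cycle_le _ (L2 <*> <[a1]>)%G a (p ^ 2) _ n' _.
apply: leq_trans (h _ _) _; rewrite ?expn_gt0 ?p_gt0 ?ap //.
rewrite (expnD p 4 2) leq_mul2r; apply/orP; right.
apply: leq_trans (card_join_cycle_le p_gt0 n1 a1p) _.
rewrite expnSr leq_mul2r; apply/orP; right; apply: leq_trans A_frame_card_le _.
by rewrite expnS leq_mul2r dvdn_leq ?orbT // order_dvdn (A_4p fA).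
Qed.

Hypothesis nz4 : a4 != 1.

(** Commutation with [a] takes a2 to a3 and a3 to a4, so a coincidence in the chain <a4> < <a4, a3>
    < <a4, a3, a2> would propagate down to a4 = 1. Each step has index p because the p-th power of
    the new element lies in the previous term. *)
Lemma A_frame_card_der : #|(<[a]> <*> <[a1]>)^`(1)| = (p ^ 3)%N.
Proof.
have [n3 n2 n1 n] := A_frame_norm.
set G := (<[a]> <*> <[a1]>)%G.
have Ga : a \in G by rewrite mem_joinl ?cycle_id.
have Ga1 : a1 \in G by rewrite mem_joinr.
have G'2 : a2 \in G^`(1) by rewrite -(A_1a fA) mem_commg.
have G2 := subsetP (der_sub 1 G) _ G'2.
have G'3 : a3 \in G^`(1) by rewrite -(A_2a fA) mem_commg.
have G3 := subsetP (der_sub 1 G) _ G'3.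
have G'4 : a4 \in G^`(1) by rewrite -(A_3a fA) mem_commg.
have -> : G^`(1) = L2.
  by apply/eqP; rewrite eqEsubset A_frame_der_sub !join_subG !cycle_subG G'2 G'3 G'4.
have o4 : #|L4| = p by apply/prime_nt_dvdP; rewrite ?order_dvdn ?(A_4p fA) ?order_eq1.
have na : a \in 'N(L4) := norm_com1 (A_4a fA).
have n43 : a3 \notin L4.
  apply: contra nz4 => /cycleP[i def3]; rewrite -(A_3a fA) def3.
  by apply/commgP; apply/commute_sym/commuteX/commute_sym/(A_4a fA).
rewrite !expnSr mul1n -{1}o4 -(card_join_cycle p_pr n3) ?(A_3p fA) //.
rewrite -(card_join_cycle p_pr n2) ?A_frame_a2p //.
apply: contra n43; rewrite -/L3 => /= L3a2; rewrite -(A_2a fA).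
suff: a2 \in centmod L4 a by rewrite centmodE // => /andP[].
apply: subsetP L3a2; rewrite join_subG !cycle_subG !centmodE // n3 (A_3a fA) cycle_id.
by rewrite (subsetP (normG _)) ?cycle_id //= (eqP (introT commgP (A_4a fA))) group1.
Qed.

End AFrameTheory.

(* The common shape of the relations of B_c and C_c: [m11], [m12], [m22] is the Gram
   matrix, in terms of [z], of the form (x, y) |-> [c, x, y] on the generators. *)
Record BC_frame q m11 m12 m22 (gT : finGroupType) (a b c c1 c2 z : gT) : Prop :=
  BCFrame {
  BC_ab : [~ a, b] = c; BC_ca : [~ c, a] = c1; BC_cb : [~ c, b] = c2;
  BC_1a : [~ c1, a] = z ^+ m11; BC_1b : [~ c1, b] = z ^+ m12;
  BC_2a : [~ c2, a] = z ^+ m12; BC_2b : [~ c2, b] = z ^+ m22;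
  BC_c1 : commute c c1; BC_c2 : commute c c2; BC_12 : commute c1 c2;
  BC_za : commute z a; BC_zb : commute z b;
  BC_zc : commute z c; BC_z1 : commute z c1; BC_z2 : commute z c2;
  BC_cp : c ^+ p = z ^+ q; BC_1p : c1 ^+ p = 1; BC_2p : c2 ^+ p = 1;
  BC_zp : z ^+ p = 1 }.

(* Only antidiagonal (B) and diagonal (C) nondegenerate Gram matrices are needed. *)
Definition BC_nondeg m11 m12 m22 :=
  [/\ ~~ (p %| m12), p %| m11 & p %| m22] \/ [/\ p %| m12, ~~ (p %| m11) & ~~ (p %| m22)].

Section BCFrameTheory.

Variables (gT : finGroupType) (q m11 m12 m22 : nat) (a b c c1 c2 z : gT).
Hypothesis fB : BC_frame q m11 m12 m22 a b c c1 c2 z.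

Let L4 : {group gT} := <[z]>%G.
Let L3 : {group gT} := (<[z]> <*> <[c1]>)%G.
Let L2 : {group gT} := (L3 <*> <[c2]>)%G.
Let L1 : {group gT} := (L2 <*> <[c]>)%G.

Lemma BC_frame_norm : [/\ c1 \in 'N(L4), c2 \in 'N(L3), c \in 'N(L2),
  a \in 'N(L1) & b \in 'N(L1)].
Proof.
have n4 x : commute z x -> x \in 'N(L4) by apply: norm_com1.
have k1 (x y : gT) : commute x y -> [~ x, y] = 1 by move=> cxy; apply/eqP/commgP.
split.
- exact/n4/(BC_z1 fB).
- apply: norm_join_cycle; first exact/n4/(BC_z2 fB).
  by rewrite k1 //; apply/(BC_12 fB).
- apply: norm_join_cycle; first apply: norm_join_cycle.
  + exact/n4/(BC_zc fB).
  + by rewrite k1 //; apply/commute_sym/(BC_c1 fB).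
  by rewrite k1 //; apply/commute_sym/(BC_c2 fB).
- do 3?apply: norm_join_cycle.
  + exact/n4/(BC_za fB).
  + by rewrite (BC_1a fB) mem_cycle.
  + by rewrite (BC_2a fB) mem_joinl ?mem_cycle.
  by rewrite (BC_ca fB) mem_joinl ?mem_joinr.
- do 3?apply: norm_join_cycle.
  + exact/n4/(BC_zb fB).
  + by rewrite (BC_1b fB) mem_cycle.
  + by rewrite (BC_2b fB) mem_joinl ?mem_cycle.
  by rewrite (BC_cb fB) mem_joinr.
Qed.

Lemma BC_frame_card_le : #|L1| <= #[z] * p ^ 3.
Proof.
have [n1 n2 nc na nb] := BC_frame_norm; have p_gt0 := prime_gt0 p_pr.
rewrite (leq_trans (card_join_cycle_le p_gt0 nc _)) //.
  by rewrite (BC_cp fB) !mem_joinl ?mem_cycle.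
rewrite expnSr mulnA leq_mul2r; apply/orP; right.
rewrite (leq_trans (card_join_cycle_le p_gt0 n2 _)) ?(BC_2p fB) //.
rewrite expnSr mulnA leq_mul2r expn1; apply/orP; right.
by rewrite card_join_cycle_le ?(BC_1p fB).
Qed.

Lemma BC_frame_der_sub : (<[a]> <*> <[b]>)^`(1) \subset L1.
Proof.
have [_ _ _ na nb] := BC_frame_norm.
by apply: der1_gen2; rewrite // (BC_ab fB) mem_joinr.
Qed.

Lemma BC_frame_card_der_le : #|(<[a]> <*> <[b]>)^`(1)| <= #[z] * p ^ 3.
Proof. exact: leq_trans (subset_leq_card BC_frame_der_sub) BC_frame_card_le. Qed.

Lemma BC_frame_card_gen_le : a ^+ p \in L1 -> b ^+ p \in L1 ->
  #|<[a]> <*> <[b]>| <= p ^ 6.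
Proof.
move=> ap bp; have [_ _ _ na nb] := BC_frame_norm; have p_gt0 := prime_gt0 p_pr.
have n' : b \in 'N(L1 <*> <[a]>).
  by apply: norm_join_cycle; rewrite // (BC_ab fB) mem_joinr.
have sub : <[a]> <*> <[b]> \subset L1 <*> <[a]> <*> <[b]>.
  by rewrite join_subG !cycle_subG mem_joinr mem_joinl ?mem_joinr.
apply: leq_trans (subset_leq_card sub) _.
have h := @card_join_cycle_le _ (L1 <*> <[a]>)%G b p p_gt0 n' _.
apply: leq_trans (h _) _; first by rewrite mem_joinl.
rewrite expnSr leq_mul2r; apply/orP; right.
apply: leq_trans (card_join_cycle_le p_gt0 na ap) _.
rewrite expnSr leq_mul2r; apply/orP; right; apply: leq_trans BC_frame_card_le _.
by rewrite expnS leq_mul2r dvdn_leq ?orbT // order_dvdn (BC_zp fB).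
Qed.

Hypotheses (nz : z != 1) (nd : BC_nondeg m11 m12 m22).

Lemma BC_nondeg_exp : [/\ z ^+ m12 != 1, z ^+ m11 = 1 & z ^+ m22 = 1] \/
  [/\ z ^+ m12 = 1, z ^+ m11 != 1 & z ^+ m22 != 1].
Proof.
have oz := nt_prime_order p_pr (BC_zp fB) nz.
by case: nd; rewrite -oz !order_dvdn => -[]; [left | right]; split=> //; apply/eqP.
Qed.

(** The chain <z> < <z, c1> < <z, c1, c2> < <z, c1, c2, c> is strict: c1 and c2 are detected by
    their commutators with a and b through the nondegenerate Gram matrix, and c is detected by
    [c, a] = c1. *)
Lemma BC_frame_card_der : #|(<[a]> <*> <[b]>)^`(1)| = (p ^ 4)%N.
Proof.
have [n1 n2 nc na nb] := BC_frame_norm.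
set G := (<[a]> <*> <[b]>)%G.
have Ga : a \in G by rewrite mem_joinl ?cycle_id.
have Gb : b \in G by rewrite mem_joinr.
have oz := nt_prime_order p_pr (BC_zp fB) nz.
have nzz := BC_nondeg_exp.
have o4 : #|L4| = p by apply/prime_nt_dvdP; rewrite ?order_dvdn ?(BC_zp fB) ?order_eq1.
have G'c : c \in G^`(1) by rewrite -(BC_ab fB) mem_commg.
have Gc := subsetP (der_sub 1 G) _ G'c.
have G'1 : c1 \in G^`(1) by rewrite -(BC_ca fB) mem_commg.
have G1 := subsetP (der_sub 1 G) _ G'1.
have G'2 : c2 \in G^`(1) by rewrite -(BC_cb fB) mem_commg.
have G2 := subsetP (der_sub 1 G) _ G'2.
have gen m : z ^+ m != 1 -> z ^+ m \in G^`(1) -> z \in G^`(1).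
  move=> nzm Gm; have: z \in <[z ^+ m]>; last by apply: subsetP; rewrite cycle_subG.
  by rewrite -(@nt_gen_prime _ L4) ?cycle_id ?o4 // !inE nzm mem_cycle.
have G'z : z \in G^`(1).
  case: nzz => [[nz1 _ _] | [_ nz1 _]]; apply: (gen _ nz1).
    by rewrite -(BC_1b fB) mem_commg.
  by rewrite -(BC_1a fB) mem_commg.
have -> : G^`(1) = L1.
  apply/eqP; rewrite eqEsubset BC_frame_der_sub !join_subG !cycle_subG.
  by rewrite G'c G'1 G'2 G'z.
have ncx x y : x \in L4 -> commute z y -> [~ x, y] = 1.
  case/cycleP=> i -> cy; apply/eqP/commgP/commute_sym/commuteX/commute_sym/cy.
have [za zb] : [~ z, a] = 1 /\ [~ z, b] = 1.
  by split; apply/eqP/commgP; [apply: (BC_za fB) | apply: (BC_zb fB)].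
have n41 : c1 \notin L4.
  case: nzz => [[nz1 _ _] | [_ nz1 _]]; apply: contra nz1 => /ncx c1z.
    by rewrite -(BC_1b fB) c1z //; apply: (BC_zb fB).
  by rewrite -(BC_1a fB) c1z //; apply: (BC_za fB).
(* [c2] is separated from <z, c1> by a generator that commutes with [c1]: [a] in the antidiagonal
   case, [b] in the diagonal one. *)
have n32 : c2 \notin L3.
  case: nzz => [[nz1 c11 _] | [c12 _ nz2]].
    apply: contra nz1 => L3c2; rewrite -(BC_2a fB); apply/commgP/cent1P.
    apply: subsetP L3c2; rewrite join_subG !cycle_subG.
    apply/andP; split; apply/cent1P; first exact: (BC_za fB).
    by apply/commgP; rewrite (BC_1a fB) c11.
  apply: contra nz2 => L3c2; rewrite -(BC_2b fB); apply/commgP/cent1P.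
  apply: subsetP L3c2; rewrite join_subG !cycle_subG.
  apply/andP; split; apply/cent1P; first exact: (BC_zb fB).
    by apply/commgP; rewrite (BC_1b fB) c12.
rewrite !expnSr mul1n -{1}o4 -(card_join_cycle p_pr n1) ?(BC_1p fB) //.
rewrite -(card_join_cycle p_pr n2) ?(BC_2p fB) //.
have L2cp : c ^+ p \in L2 by rewrite (BC_cp fB) !mem_joinl ?mem_cycle.
rewrite -(card_join_cycle p_pr nc) //.
have naz : a \in 'N(L4) := norm_com1 (BC_za fB).
apply: contra n41; rewrite -/L3 -/L2 => /= L2c; rewrite -(BC_ca fB).
suff: c \in centmod L4 a by rewrite centmodE // => /andP[].
have sL2 : L2 \subset centmod L4 a.
  rewrite !join_subG !cycle_subG !centmodE // za group1.
  rewrite n1 (norm_com1 (BC_z2 fB)) (BC_1a fB) (BC_2a fB) !mem_cycle.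
  by rewrite (subsetP (normG _)) ?cycle_id.
exact: (subsetP sL2).
Qed.

End BCFrameTheory.

End Frames.

Section FrameIsoclinic.

Variables (p : nat) (p_pr : prime p) (gT hT : finGroupType).
Variables (G : {group gT}) (H : {group hT}).

Lemma expg_pair (x : gT) (y : hT) n : (x, y) ^+ n = (x ^+ n, y ^+ n).
Proof. by elim: n => // n IHn; rewrite !expgS IHn. Qed.

Lemma commute_pair (x x' : gT) (y y' : hT) :
  commute x x' -> commute y y' -> commute (x, y) (x', y').
Proof. by move=> cx cy; congr (_, _). Qed.

(** The three equal orders make both projections of the group generated by the pairs injective on
    its derived subgroup. *)
Lemma isoclinic_gen2 n (a b : gT) (a' b' : hT) :
    G :=: <[a]> <*> <[b]> -> H :=: <[a']> <*> <[b']> ->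
    #|G^`(1)| = n -> #|H^`(1)| = n ->
    #|(<[(a, a')]> <*> <[(b, b')]>)^`(1)| = n ->
  isoclinic G H.
Proof.
move=> defG defH oG oH oD.
apply: (@isoclinic_subdirect _ _ _ _ (<[(a, a')]> <*> <[(b, b')]>)%G).
- by rewrite defG morphimY ?subsetT // !morphim_cycle ?inE.
- by rewrite defH morphimY ?subsetT // !morphim_cycle ?inE.
- by rewrite oG -oD.
- by rewrite oH -oD.
Qed.

Lemma A_isoclinic k e a a1 a2 a3 a4 b b1 b2 b3 b4 :
    A_frame p k e a a1 a2 a3 a4 -> A_frame p k e b b1 b2 b3 b4 ->
    G :=: <[a]> <*> <[a1]> -> H :=: <[b]> <*> <[b1]> -> a4 != 1 -> b4 != 1 ->
  isoclinic G H.
Proof.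
move=> fA fB defG defH nza nzb.
apply: (isoclinic_gen2 defG defH); first by rewrite defG (A_frame_card_der p_pr fA).
  by rewrite defH (A_frame_card_der p_pr fB).
apply: (@A_frame_card_der _ p_pr _ k e _ _ (a2, b2) (a3, b3) (a4, b4)); last first.
  by rewrite xpair_eqE negb_and nza.
case: fA => A1 A2 A3 A4 A5 A6 A7 A8 A9 A10 A11 A12 A13.
case: fB => B1 B2 B3 B4 B5 B6 B7 B8 B9 B10 B11 B12 B13.
split; try exact: commute_pair; rewrite ?expg_pair.
- by congr (_, _).
- by congr (_, _).
- by congr (_, _).
- by congr (_, _).
- by congr (_, _).
- by congr (_, _).
- by congr (_, _).
Qed.

Lemma BC_isoclinic q m11 m12 m22 a b c c1 c2 z a' b' c' c1' c2' z' :
    BC_frame p q m11 m12 m22 a b c c1 c2 z ->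
    BC_frame p q m11 m12 m22 a' b' c' c1' c2' z' ->
    BC_nondeg p m11 m12 m22 ->
    G :=: <[a]> <*> <[b]> -> H :=: <[a']> <*> <[b']> -> z != 1 -> z' != 1 ->
  isoclinic G H.
Proof.
move=> fA fB nd defG defH nza nzb.
apply: (isoclinic_gen2 defG defH); first by rewrite defG (BC_frame_card_der p_pr fA).
  by rewrite defH (BC_frame_card_der p_pr fB).
apply: (@BC_frame_card_der _ p_pr _ q m11 m12 m22 _ _ (c, c') (c1, c1') (c2, c2')
  (z, z')) nd; last first.
  by rewrite xpair_eqE negb_and nza.
case: fA => A1 A2 A3 A4 A5 A6 A7 A8 A9 A10 A11 A12 A13 A14 A15 A16 A17 A18 A19.
case: fB => B1 B2 B3 B4 B5 B6 B7 B8 B9 B10 B11 B12 B13 B14 B15 B16 B17 B18 B19.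
by split; try exact: commute_pair; rewrite ?expg_pair; congr (_, _).
Qed.

End FrameIsoclinic.

(** * Models of the eight families *)

Section Presentations.

Variable p : nat.

(** Exponents are natural residues modulo p. The frame is kept apart from the power relations of the
    generators, which are imposed later by passing to a central quotient. *)
Definition A_rels k e (gT : finGroupType) (K : {set gT}) a a1 a2 a3 a4 :=
  [/\ K = <[a]> <*> <[a1]>, A_frame p k e a a1 a2 a3 a4, a ^+ (p ^ 2) = 1
    & a1 ^+ p * a2 ^+ 'C(p, 2) * a3 ^+ 'C(p, 3) * a4 ^+ 'C(p, 4) = a3 ^+ k].

Definition BC_rels q m11 m12 m22 s1 s2 t1 t2 (gT : finGroupType) (K : {set gT})
    a b c c1 c2 z :=
  [/\ K = <[a]> <*> <[b]>, BC_frame p q m11 m12 m22 a b c c1 c2 z,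
      a ^+ p = c1 ^+ s1 * c2 ^+ s2 & b ^+ p = c1 ^+ t1 * c2 ^+ t2].

Lemma eval_Expz (gT : finGroupType) (e : seq gT) t m n :
    Presentation.eval e t ^+ p = 1 -> (m = n%:Z %[mod p%:Z])%Z ->
  Presentation.eval e (Expz t m) = Presentation.eval e t ^+ n.
Proof.
set x := Presentation.eval e t => xp; case: m => j /eqP /=; rewrite -/x.
  by rewrite !modz_nat eqz_nat => /eqP jn; rewrite -(expg_mod j xp) jn expg_mod.
rewrite eqz_mod_dvd dvdzE NegzE -GRing.opprD abszN -PoszD !absz_nat => djn.
apply: (mulgI (x ^+ j.+1)); rewrite mulgV -expgD.
by case/dvdnP: djn => i ->; rewrite mulnC expgM xp expg1n.
Qed.

Lemma join_absorb (gT : finGroupType) (K : {group gT}) (x : gT) :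
  x \in K -> K <*> <[x]> = K.
Proof. by move=> Kx; apply/joing_idPl; rewrite cycle_subG. Qed.

Lemma join_comm3 (gT : finGroupType) (a b c d e : gT) :
    [~ b, a] = c -> [~ c, a] = d -> [~ d, a] = e ->
  <[a]> <*> <[b]> <*> <[c]> <*> <[d]> <*> <[e]> = <[a]> <*> <[b]>.
Proof.
move=> <- <- <-; pose L := (<[a]> <*> <[b]>)%G.
have La : a \in L by rewrite mem_joinl ?cycle_id.
have Lb : b \in L by rewrite mem_joinr.
rewrite -[<[a]> <*> <[b]>]/(gval L).
by rewrite !(@join_absorb _ L) // ?groupR.
Qed.

Lemma join_comm4 (gT : finGroupType) (a b c c1 c2 z x : gT) :
    [~ a, b] = c -> [~ c, a] = c1 -> [~ c, b] = c2 -> [~ c1, x] = z ->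
    x \in <[a]> <*> <[b]> ->
  <[a]> <*> <[b]> <*> <[c]> <*> <[c1]> <*> <[c2]> <*> <[z]> = <[a]> <*> <[b]>.
Proof.
move=> <- <- <- <- Lx; pose L := (<[a]> <*> <[b]>)%G.
have La : a \in L by rewrite mem_joinl ?cycle_id.
have Lb : b \in L by rewrite mem_joinr.
rewrite -[<[a]> <*> <[b]>]/(gval L).
by rewrite !(@join_absorb _ L) // ?groupR.
Qed.

Lemma A_homP k n (e : bool) (gT : finGroupType) (K : {group gT}) :
  (k = n%:Z %[mod p%:Z])%Z ->
  (K \homg Grp (a : a1 : a2 : a3 : a4 :
    [~ a1, a] = a2, [~ a2, a] = a3, [~ a3, a] = a4, [~ a1, a2] = a4 ^+ e,
    [~ a4, a], [~ a1, a3], [~ a1, a4], [~ a2, a3], [~ a2, a4], [~ a3, a4],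
    a ^+ (p ^ 2)%N, a3 ^+ p, a4 ^+ p,
    a1 ^+ p * a2 ^+ 'C(p, 2) * a3 ^+ 'C(p, 3) * a4 ^+ 'C(p, 4) = a3 ^z k,
    a2 ^+ p * a3 ^+ 'C(p, 2) * a4 ^+ 'C(p, 3) = a4 ^z k)) <->
  exists a a1 a2 a3 a4, A_rels n e K a a1 a2 a3 a4.
Proof.
move=> eq_kn; split=> [/homGrp_holds|].
  case=> [[[[[a a1] a2] a3] a4]] /= [defK [r1 [r2 [r3 [r4 [/eqP/commgP r5]]]]]].
  case=> /eqP/commgP r6 [/eqP/commgP r7 [/eqP/commgP r8 [/eqP/commgP r9]]].
  case=> /eqP/commgP r10 [r11 [r12 [r13 [r14 r15]]]].
  rewrite !(@eval_Expz _ _ _ k n) // in r14 r15.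
  by exists a, a1, a2, a3, a4; split=> //; rewrite -defK (join_comm3 r1 r2 r3).
case=> a [a1 [a2 [a3 [a4 [defK fA r11 r14]]]]].
case: fA => r1 r2 r3 r4 r5 r6 r7 r8 r9 r10 r12 r13 r15.
apply/homGrp_holds; exists (a, a1, a2, a3, a4) => /=.
rewrite !(@eval_Expz _ _ _ k n) // (join_comm3 r1 r2 r3).
by do ![split=> //]; apply/eqP/commgP.
Qed.

Lemma B_homP (c : bool) (gT : finGroupType) (K : {group gT}) : 0 < p ->
  (K \homg Grp (a1 : a2 : b : b1 : b2 : g :
    [~ a1, a2] = b, [~ b, a1] = b1, [~ b, a2] = b2,
    [~ b1, a2] = g, [~ b2, a1] = g,
    [~ b1, a1], [~ b2, a2], [~ b, b1], [~ b, b2], [~ b1, b2],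
    [~ g, a1], [~ g, a2], [~ g, b], [~ g, b1], [~ g, b2],
    a1 ^+ p = b1 ^+ c, a2 ^+ p = b2 ^- c, b ^+ p = g ^+ c,
    b1 ^+ p, b2 ^+ p, g ^+ p)) <->
  exists a1 a2 b b1 b2 g,
    BC_rels c 0 1 0 c 0 0 (p.-1 * c)%N K a1 a2 b b1 b2 g.
Proof.
move=> p_gt0.
have invX (x : gT) : x ^+ p = 1 -> x ^- c = x ^+ (p.-1 * c).
  move=> xp; case: c; last by rewrite muln0 !expg0 invg1.
  rewrite muln1 expg1; apply: (mulgI x); rewrite mulgV -expgS prednK //.
split=> [/homGrp_holds|].
  case=> [[[[[[a1 a2] b] b1] b2] g]] /= [defK [r1 [r2 [r3 [r4 [r5 [r6 [r7]]]]]]]].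
  case=> /eqP/commgP r8 [/eqP/commgP r9 [/eqP/commgP r10 [/eqP/commgP r11]]].
  case=> /eqP/commgP r12 [/eqP/commgP r13 [/eqP/commgP r14 [/eqP/commgP r15]]].
  case=> r16 [r17 [r18 [r19 [r20 r21]]]].
  exists a1, a2, b, b1, b2, g; split; rewrite ?mulg1 ?mul1g //.
    by rewrite -defK (join_comm4 r1 r2 r3 r4) ?mem_joinr.
  by rewrite r17 invX.
case=> a1 [a2 [b [b1 [b2 [g [defK fB r16 r17]]]]]].
case: fB => r1 r2 r3 r4 r5 r6 r7 r8 r9 r10 r11 r12 r13 r14 r15 r18 r19 r20 r21.
rewrite ?expg0 ?expg1 ?mulg1 ?mul1g in r4 r5 r6 r7 r16 r17.
apply/homGrp_holds; exists (a1, a2, b, b1, b2, g) => /=.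
rewrite invX // (join_comm4 r1 r2 r3 r5) ?mem_joinr //.
by do ![split=> //]; apply/eqP/commgP.
Qed.

Lemma C_homP nu m (c : bool) n22 s2 t1 (gT : finGroupType) (K : {group gT}) :
  ((- nu)%R = n22%:Z %[mod p%:Z])%Z -> (m = s2%:Z %[mod p%:Z])%Z ->
  ((delta p * nu - c%:Z)%R = t1%:Z %[mod p%:Z])%Z ->
  (K \homg Grp (a1 : a2 : b : b1 : b2 : g :
      [~ a1, a2] = b, [~ b, a1] = b1, [~ b, a2] = b2,
      [~ b1, a1] = g, [~ b2, a2] = g ^z (- nu)%R,
      [~ b1, a2], [~ b2, a1], [~ b, b1], [~ b, b2], [~ b1, b2],
      [~ g, a1], [~ g, a2], [~ g, b], [~ g, b1], [~ g, b2],
      a1 ^+ p = b2 ^z m, a2 ^+ p = b1 ^z (delta p * nu - c%:Z)%R,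
      b ^+ p = g ^+ c, b1 ^+ p, b2 ^+ p, g ^+ p)) <->
  exists a1 a2 b b1 b2 g,
    BC_rels c 1 0 n22 0 s2 t1 0 K a1 a2 b b1 b2 g.
Proof.
move=> en em et.
split=> [/homGrp_holds|].
  case=> [[[[[[a1 a2] b] b1] b2] g]] /= [defK [r1 [r2 [r3 [r4 [r7 [r5 [r6]]]]]]]].
  case=> /eqP/commgP r8 [/eqP/commgP r9 [/eqP/commgP r10 [/eqP/commgP r11]]].
  case=> /eqP/commgP r12 [/eqP/commgP r13 [/eqP/commgP r14 [/eqP/commgP r15]]].
  case=> r16 [r17 [r18 [r19 [r20 r21]]]].
  rewrite (@eval_Expz _ _ _ _ n22) //= in r7.
  rewrite (@eval_Expz _ _ _ _ s2) //= in r16.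
  rewrite (@eval_Expz _ _ _ _ t1) //= in r17.
  exists a1, a2, b, b1, b2, g; split; rewrite ?mulg1 ?mul1g //.
  by rewrite -defK (join_comm4 r1 r2 r3 r4) ?mem_joinl ?cycle_id.
case=> a1 [a2 [b [b1 [b2 [g [defK fB r16 r17]]]]]].
case: fB => r1 r2 r3 r4 r5 r6 r7 r8 r9 r10 r11 r12 r13 r14 r15 r18 r19 r20 r21.
rewrite ?expg0 ?expg1 ?mulg1 ?mul1g in r4 r5 r6 r7 r16 r17.
apply/homGrp_holds; exists (a1, a2, b, b1, b2, g) => /=.
rewrite (@eval_Expz _ _ _ _ n22) // (@eval_Expz _ _ _ m s2) //.
rewrite (@eval_Expz _ _ _ (delta p * nu - c%:Z)%R t1) //.
rewrite (join_comm4 r1 r2 r3 r4) ?mem_joinl ?cycle_id //.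
by do ![split=> //]; apply/eqP/commgP.
Qed.

End Presentations.

(* [pa] and [pb] shift the first two coordinates (i, j) and act on the last four by
   unipotent matrices, [pa] with a translation depending on j chosen so that
   [[~ pa, pb]] is the translation by (p, 0, 0, q); iterated commutators are then
   translations.  The parameters [al] and [ep] distinguish the family A ([al = 0],
   where [pb] is the generator alpha and [pa] is alpha_1) from B and C ([al = 1]). *)
Section Model.

Import GRing.Theory.

Variables (p : nat) (p_pr : prime p) (p_gt2 : 2 < p).

Notation L := 'Z_(p ^ 2).
Local Open Scope ring_scope.

Variables (q m11 m12 m22 al ep : L).

Notation pL := (p%:R : L).

Definition model_pt : finType := (L * L * (L * L * L * L))%type.
Definition model_vec : finType := (L * L * L * L)%type.

Let p2_gt1 : (1 < p ^ 2)%N.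
Proof. by rewrite (ltn_exp2l 0) // prime_gt1. Qed.

Let pp0 : pL * pL = 0.
Proof. by rewrite -natrM mulnn pchar_Zp. Qed.

Definition bin_p (k : nat) (j : L) : L := pL * ('C(j, k))%:R.

Let natr_L (j : L) : (j : nat)%:R = j.
Proof. exact: natr_Zp. Qed.

Lemma val_succ (j : L) :
  (j + 1 : L) = j.+1 :> nat \/ j + 1 = 0 /\ j.+1 = (p ^ 2)%N.
Proof.
have lt_j : (j < p ^ 2)%N by have := ltn_ord j; rewrite [X in (_ < X)%N -> _]Zp_cast.
have v1 : nat_of_ord (1 : L) = 1%N by rewrite /= Zp_cast ?modn_small.
have vS : nat_of_ord (j + 1) = (j.+1 %% p ^ 2)%N.
  have -> : nat_of_ord (j + 1) =
    ((j + nat_of_ord (1%R : L)) %% (Zp_trunc (p ^ 2)).+2)%N by [].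
  by rewrite v1 addn1; congr (_ %% _)%N; apply: Zp_cast.
case: (ltngtP j.+1 (p ^ 2)) lt_j => // [lt_j _ | eq_j _].
  by left; rewrite vS modn_small.
by right; split=> //; apply: val_inj; rewrite [LHS]vS eq_j modnn.
Qed.

(** Pascal's rule is in doubt only at the wraparound j = p^2 - 1. There p divides C(p^2, k + 1),
    since 0 < k + 1 < p^2, and the additional factor p makes the discrepancy vanish modulo p^2. *)
Lemma bin_p_succ k (j : L) : (k.+1 < 4)%N ->
  bin_p k.+1 (j + 1) = bin_p k.+1 j + bin_p k j.
Proof.
move=> lt_k; rewrite /bin_p -mulrDr -natrD -binS.
case: (val_succ j) => [-> // | [-> ->]]; rewrite bin0n mulr0.
have /dvdnP[d ->] : (p %| 'C(p ^ 2, k.+1))%N.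
  apply: dvdn_bin_sqr => //=; apply: leq_trans lt_k _.
  by apply: (@leq_trans (3 ^ 2)%N); rewrite // leq_exp2r.
by rewrite natrM mulrCA pp0 mulr0.
Qed.

(** The terms in j are discrete antiderivatives. Shifting j by one changes -p j by -p, and p C(j,2)
    and p C(j,3) compensate what [model_b] then does to y and w, so that the commutator with
    [model_b] is a translation independent of j. *)
Definition model_a (u : model_pt) : model_pt :=
  let: (i, j, (t, x, y, w)) := u in
  (i + 1, j, (t - pL * j, x + al * t, y - bin_p 2 j,
   w + m11 * x + al * m12 * y + ep * t - q * j - m22 * bin_p 3 j)).

Definition model_a' (u : model_pt) : model_pt :=
  let: (i, j, (t, x, y, w)) := u in
  let t := t + pL * j in let x := x - al * t in let y := y + bin_p 2 j in
  (i - 1, j, (t, x, y,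
   w - m11 * x - al * m12 * y - ep * t + q * j + m22 * bin_p 3 j)).

Definition model_b (u : model_pt) : model_pt :=
  let: (i, j, (t, x, y, w)) := u in
  (i, j + 1, (t, x, y + t, w + m12 * x + m22 * y)).

Definition model_b' (u : model_pt) : model_pt :=
  let: (i, j, (t, x, y, w)) := u in let y := y - t in
  (i, j - 1, (t, x, y, w - m12 * x - m22 * y)).

Definition model_t (m : model_vec) (u : model_pt) : model_pt :=
  let: (i, j, (t, x, y, w)) := u in let: (t', x', y', w') := m in
  (i, j, (t + t', x + x', y + y', w + w')).

Definition model_t' (m : model_vec) (u : model_pt) : model_pt :=
  let: (i, j, (t, x, y, w)) := u in let: (t', x', y', w') := m in
  (i, j, (t - t', x - x', y - y', w - w')).

Lemma model_aK : cancel model_a model_a'.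
Proof.
move=> [[i j] [[[t x] y] w]]; rewrite /model_a /model_a'.
by congr (_, _, (_, _, _, _)); ring.
Qed.

Lemma model_bK : cancel model_b model_b'.
Proof.
move=> [[i j] [[[t x] y] w]]; rewrite /model_b /model_b'.
by congr (_, _, (_, _, _, _)); ring.
Qed.

Lemma model_tK m : cancel (model_t m) (model_t' m).
Proof.
move=> [[i j] [[[t x] y] w]]; case: m => [[[t' x'] y'] w'].
by rewrite /model_t /model_t'; congr (_, _, (_, _, _, _)); ring.
Qed.

Definition pa : {perm model_pt} := perm (can_inj model_aK).
Definition pb : {perm model_pt} := perm (can_inj model_bK).
Definition pt m : {perm model_pt} := perm (can_inj (model_tK m)).

Definition vecA (m : model_vec) : model_vec :=
  let: (t, x, y, w) := m in (t, x + al * t, y, w + m11 * x + al * m12 * y + ep * t).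
Definition vecB (m : model_vec) : model_vec :=
  let: (t, x, y, w) := m in (t, x, y + t, w + m12 * x + m22 * y).

Lemma pt_a m : (pt m * pa = pa * pt (vecA m))%g.
Proof.
apply/permP=> [[[i j] [[[t x] y] w]]]; case: m => [[[t' x'] y'] w'].
by rewrite !permM !permE /=; congr (_, _, (_, _, _, _)); ring.
Qed.

Lemma pt_b m : (pt m * pb = pb * pt (vecB m))%g.
Proof.
apply/permP=> [[[i j] [[[t x] y] w]]]; case: m => [[[t' x'] y'] w'].
by rewrite !permM !permE /=; congr (_, _, (_, _, _, _)); ring.
Qed.

Lemma pa_b : [~ pa, pb]%g = pt (pL, 0, 0, q).
Proof.
apply: (mulgI (pb * pa)%g); rewrite -commgC.
apply/permP=> [[[i j] [[[t x] y] w]]].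
rewrite !permM !permE /= (@bin_p_succ 1) // (@bin_p_succ 2) //.
have -> : bin_p 1 j = pL * j by rewrite /bin_p bin1 natr_L.
by congr (_, _, (_, _, _, _)); ring.
Qed.

Lemma ptM t x y w t' x' y' w' :
  (pt (t, x, y, w) * pt (t', x', y', w'))%g = pt (t + t', x + x', y + y', w + w').
Proof.
apply/permP=> [[[i j] [[[t1 x1] y1] w1]]].
by rewrite !permM !permE /=; congr (_, _, (_, _, _, _)); ring.
Qed.

Lemma pt_eq1 t x y w : (pt (t, x, y, w) == 1%g) = [&& t == 0, x == 0, y == 0 & w == 0].
Proof.
apply/eqP/and4P=> [/permP/(_ (0, 0, (0, 0, 0, 0))) | [/eqP-> /eqP-> /eqP-> /eqP->]].
  by rewrite perm1 permE /= !add0r => -[-> -> -> ->].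
apply/permP=> [[[i j] [[[t1 x1] y1] w1]]].
by rewrite perm1 permE /= !addr0.
Qed.

Lemma ptX t x y w n :
  (pt (t, x, y, w) ^+ n)%g = pt (t *+ n, x *+ n, y *+ n, w *+ n).
Proof.
elim: n => [|n IHn]; last by rewrite expgS IHn ptM !mulrS.
by apply/esym/eqP; rewrite pt_eq1 !mulr0n eqxx.
Qed.

Lemma ptV t x y w : ((pt (t, x, y, w))^-1)%g = pt (- t, - x, - y, - w).
Proof.
apply/eqP; rewrite eq_invg_mul ptM; apply/eqP/eqP.
by rewrite pt_eq1 !subrr eqxx.
Qed.

Lemma pt_commute m m' : commute (pt m) (pt m').
Proof.
case: m m' => [[[t x] y] w] [[[t' x'] y'] w']; rewrite /commute !ptM.
by congr (pt (_, _, _, _)); apply: addrC.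
Qed.

Lemma comm_pt_a t x y w :
  [~ pt (t, x, y, w), pa]%g = pt (0, al * t, 0, m11 * x + al * m12 * y + ep * t).
Proof.
apply: (mulgI (pa * pt (t, x, y, w))%g); rewrite -commgC pt_a -mulgA ptM /=.
by congr (pa * pt (_, _, _, _))%g; ring.
Qed.

Lemma comm_pt_b t x y w :
  [~ pt (t, x, y, w), pb]%g = pt (0, 0, t, m12 * x + m22 * y).
Proof.
apply: (mulgI (pb * pt (t, x, y, w))%g); rewrite -commgC pt_b -mulgA ptM /=.
by congr (pb * pt (_, _, _, _))%g; ring.
Qed.

Let o i j : model_pt := (i, j, (0, 0, 0, 0)).

Lemma paX n i : (pa ^+ n)%g (o i 0) = o (i + n%:R) 0.
Proof.
elim: n i => [|n IHn] i; first by rewrite expg0 perm1 addr0.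
rewrite expgS permM permE /= !(mulr0, addr0, subr0) /bin_p !bin0n !(mulr0, subr0).
by rewrite IHn -addrA -natr1 [1 + _]addrC.
Qed.

Lemma pbX n i j : (pb ^+ n)%g (o i j) = o i (j + n%:R).
Proof.
elim: n j => [|n IHn] j; first by rewrite expg0 perm1 addr0.
rewrite expgS permM permE /= !(mulr0, addr0).
by rewrite IHn -addrA -natr1 [1 + _]addrC.
Qed.

Lemma natr_L_eq0 n : (n%:R == 0 :> L) = (p ^ 2 %| n)%N.
Proof.
by rewrite -(inj_eq val_inj) /= val_Zp_nat.
Qed.

Lemma pt_fst m u : (pt m u).1 = u.1.
Proof.
by rewrite permE; case: u m => [[i j] [[[t x] y] w]] [[[t' x'] y'] w'].
Qed.

Lemma ptX_fst m n u : ((pt m ^+ n)%g u).1 = u.1.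
Proof.
by elim: n u => [|n IHn] u; rewrite ?perm1 // expgS permM IHn pt_fst.
Qed.

Lemma pbX_fst n u : ((pb ^+ n)%g u).1.1 = u.1.1.
Proof.
elim: n u => [|n IHn] u; first by rewrite perm1.
by rewrite expgS permM IHn permE; case: u => [[i j] [[[t x] y] w]].
Qed.

(** The image of the origin reads off the exponents. If u^k v^l is a translation, it fixes i and j,
    so p^2 divides n1 k and n2 l; the hypotheses then kill both translation parts, and u^k v^l fixes
    the origin, which the translation by (0, 0, 0, p) moves. *)
Lemma pt_notin n1 n2 m1 m2 (u := (pa ^+ n1 * pt m1)%g) (v := (pb ^+ n2 * pt m2)%g) :
    commute (pa ^+ n1)%g (pt m1) -> commute (pb ^+ n2)%g (pt m2) -> commute u v ->
    (forall k, p ^ 2 %| n1 * k -> (pt m1 ^+ k = 1)%g)%N ->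
    (forall k, p ^ 2 %| n2 * k -> (pt m2 ^+ k = 1)%g)%N ->
  pt (0, 0, 0, pL) \notin (<[u]> <*> <[v]>)%g.
Proof.
move=> c1 c2 cuv H1 H2; apply/negP.
rewrite norm_joinEr ?cycle_subG ?norm_com1 //.
case/mulsgP=> _ _ /cycleP[k ->] /cycleP[l ->] /(congr1 (fun s : {perm _} => s (o 0 0))).
rewrite !expgMn // -!expgM !permM paX add0r => eq_o.
have pk1 : (pt m1 ^+ k = 1)%g.
  apply: H1; rewrite -natr_L_eq0; apply/eqP.
  have := congr1 (fun w : model_pt => w.1.1) eq_o.
  by rewrite pt_fst ptX_fst pbX_fst ptX_fst /= => ->.
rewrite pk1 perm1 pbX add0r in eq_o.
have pl1 : (pt m2 ^+ l = 1)%g.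
  apply: H2; rewrite -natr_L_eq0; apply/eqP.
  have := congr1 (fun w : model_pt => w.1.2) eq_o.
  by rewrite pt_fst ptX_fst /= => ->.
move: eq_o; rewrite pl1 perm1 permE /o /= !add0r => -[_ _ /eqP].
rewrite natr_L_eq0 => /dvdn_leq; rewrite prime_gt0 // leqNgt => /(_ isT).
by rewrite (ltn_exp2l 1) ?prime_gt1.
Qed.

End Model.

(** * Homomorphic images and central quotients of systems of relations *)

Section FrameMorphism.

Variables (p : nat) (gT rT : finGroupType) (D : {group gT}) (f : {morphism D >-> rT}).

Lemma morph_commute x y : x \in D -> y \in D -> commute x y -> commute (f x) (f y).
Proof. by move=> Dx Dy cxy; rewrite /commute -!morphM // cxy. Qed.

Lemma A_frame_morph k e a a1 a2 a3 a4 : a \in D -> a1 \in D ->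
  A_frame p k e a a1 a2 a3 a4 -> A_frame p k e (f a) (f a1) (f a2) (f a3) (f a4).
Proof.
move=> Da D1 [r1 r2 r3 r4 r5 r6 r7 r8 r9 r10 r11 r12 r13].
have D2 : a2 \in D by rewrite -r1 groupR.
have D3 : a3 \in D by rewrite -r2 groupR.
have D4 : a4 \in D by rewrite -r3 groupR.
split; try exact: morph_commute; rewrite -?morphR -?morphX -?morphM ?groupM ?groupX //.
- by rewrite r1.
- by rewrite r2.
- by rewrite r3.
- by rewrite r4.
- by rewrite r11 morph1.
- by rewrite r12 morph1.
- by rewrite r13.
Qed.

Lemma BC_frame_morph q m11 m12 m22 a b c c1 c2 z : a \in D -> b \in D -> z \in D ->
  BC_frame p q m11 m12 m22 a b c c1 c2 z ->
  BC_frame p q m11 m12 m22 (f a) (f b) (f c) (f c1) (f c2) (f z).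
Proof.
move=> Da Db Dz [r1 r2 r3 r4 r5 r6 r7 r8 r9 r10 r11 r12 r13 r14 r15 r16 r17 r18 r19].
have Dc : c \in D by rewrite -r1 groupR.
have D1 : c1 \in D by rewrite -r2 groupR.
have D2 : c2 \in D by rewrite -r3 groupR.
split; try exact: morph_commute; rewrite -?morphR -?morphX //.
- by rewrite r1.
- by rewrite r2.
- by rewrite r3.
- by rewrite r4.
- by rewrite r5.
- by rewrite r6.
- by rewrite r7.
- by rewrite r16.
- by rewrite r17 morph1.
- by rewrite r18 morph1.
- by rewrite r19 morph1.
Qed.

End FrameMorphism.

Section Quotient.

Variables (p : nat) (p_pr : prime p) (p_odd : odd p) (gT : finGroupType).

(** In the collection formula the C(p,2) term vanishes because p is odd; the C(p,3) term is kept
    because it survives for p = 3. *)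
Lemma BC_frame_exp (q m11 m12 m22 : nat) (a b c c1 c2 z : gT) :
    BC_frame p q m11 m12 m22 a b c c1 c2 z ->
  [~ a ^+ p, b] = z ^+ (q + m11 * 'C(p, 3)) /\
  [~ b ^+ p, a] = z ^- (q + m22 * 'C(p, 3)).
Proof.
case=> r1 r2 r3 r4 r5 r6 r7 r8 r9 r10 r11 r12 r13 r14 r15 r16 r17 r18 r19.
have zX x i : commute z x -> commute x (z ^+ i).
  by move=> czx; apply/commuteX/commute_sym.
have [d def_d] := dvdnP (dvdn_bin2 p_pr p_odd).
split.
  rewrite (commXg_bin p r1 r2 r4) ?def_d ?expg_muln ?mulg1 ?r16 -?expgM -?expgD //.
  - exact: zX.
  - exact: zX.
  - exact/commute_sym/zX.
have r1' : [~ b, a] = c^-1 by rewrite -r1 invg_comm.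
have r3' : [~ c^-1, b] = c2^-1 by rewrite commVg_commute r3.
have r7' : [~ c2^-1, b] = z ^- m22.
  by rewrite commVg_commute r7 //; apply: zX.
have cV (x y : gT) : commute x y -> commute x^-1 y^-1.
  by move=> cxy; apply/commute_sym/commuteV/commute_sym/commuteV.
rewrite (commXg_bin p r1' r3' r7') ?def_d ?expg_muln ?expgVn ?r16 ?r18 ?invg1 ?mulg1 //.
- by rewrite -invMg -expgM -expgD addnC.
- exact: cV.
- exact/cV/zX.
- exact/cV/zX.
- by apply/commute_sym/commuteV/zX.
Qed.

Lemma central_quotient (a b u v : gT) (N := (<[u]> <*> <[v]>)%G) :
    commute u a -> commute u b -> commute v a -> commute v b ->
  [/\ a \in 'N(N), b \in 'N(N), coset N u = 1 & coset N v = 1].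
Proof.
move=> cua cub cva cvb.
have nN x : commute u x -> commute v x -> x \in 'N(N).
  move=> cux cvx; rewrite (subsetP (cent_sub _)) // centY inE !cent_cycle.
  by apply/andP; split; apply/cent1P.
by split; rewrite ?nN //; apply: coset_id; rewrite ?mem_joinr // mem_joinl ?cycle_id.
Qed.

(** [u] and [v] are the defects of the two power relations. The four congruences say that both sides
    of each relation have the same commutators with [a] and [b], as computed from the Gram matrix
    and [BC_frame_exp]. *)
Lemma BC_central q m11 m12 m22 s1 s2 t1 t2 (a b c c1 c2 z : gT)
    (u := a ^+ p * (c1 ^+ s1 * c2 ^+ s2)^-1) (v := b ^+ p * (c1 ^+ t1 * c2 ^+ t2)^-1) :
    BC_frame p q m11 m12 m22 a b c c1 c2 z ->
    s1 * m11 + s2 * m12 = 0 %[mod p] ->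
    s1 * m12 + s2 * m22 = q + m11 * 'C(p, 3) %[mod p] ->
    t1 * m11 + t2 * m12 + (q + m22 * 'C(p, 3)) = 0 %[mod p] ->
    t1 * m12 + t2 * m22 = 0 %[mod p] ->
  [/\ commute u a, commute u b, commute v a & commute v b].
Proof.
move=> fB es1 es2 et1 et2.
have [expa expb] := BC_frame_exp fB.
case: (fB) => r1 r2 r3 r4 r5 r6 r7 r8 r9 r10 r11 r12 r13 r14 r15 r16 r17 r18 r19.
have comX x i j k l m : [~ c1, x] = z ^+ k -> [~ c2, x] = z ^+ l ->
    i * k + j * l = m %[mod p] -> [~ c1 ^+ i * c2 ^+ j, x] = z ^+ m.
  move=> e1 e2 em; have c1z n : commute c1 (z ^+ n) by apply/commuteX/commute_sym.
  have c2z n : commute c2 (z ^+ n) by apply/commuteX/commute_sym.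
  rewrite commMgJ !commXg ?e1 ?e2 // -!expgM.
  rewrite (conjg_fixP _) -?expgD; last first.
    by apply/commgP/commute_sym; apply: commuteX; apply/commute_sym/commuteX/commute_sym.
  by rewrite (mulnC k) (mulnC l) -(expg_mod (i * k + j * l) r19) em expg_mod.
have aa x i : [~ x ^+ i, x] = 1 :> gT.
  by apply/eqP/commgP/commute_sym/commuteX/commute_refl.
have cua : commute u a by apply: commute_divg; rewrite aa (comX _ _ _ _ _ 0 r4 r6).
have cub : commute u b by apply: commute_divg; rewrite expa (comX _ _ _ _ _ _ r5 r7 es2).
have cvb : commute v b by apply: commute_divg; rewrite aa (comX _ _ _ _ _ 0 r5 r7).
have cva : commute v a.
  apply: commute_divg; rewrite expb; apply: (mulIg (z ^+ (q + m22 * 'C(p, 3)))).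
  rewrite mulVg (comX _ t1 t2 _ _ _ r4 r6 (erefl _)) -expgD.
  by rewrite -(expg_mod _ r19) et1 mod0n.
by [].
Qed.

Lemma BC_quotient q m11 m12 m22 s1 s2 t1 t2 (a b c c1 c2 z : gT)
    (u := a ^+ p * (c1 ^+ s1 * c2 ^+ s2)^-1) (v := b ^+ p * (c1 ^+ t1 * c2 ^+ t2)^-1) :
    BC_frame p q m11 m12 m22 a b c c1 c2 z ->
    s1 * m11 + s2 * m12 = 0 %[mod p] ->
    s1 * m12 + s2 * m22 = q + m11 * 'C(p, 3) %[mod p] ->
    t1 * m11 + t2 * m12 + (q + m22 * 'C(p, 3)) = 0 %[mod p] ->
    t1 * m12 + t2 * m22 = 0 %[mod p] ->
    z \in <[a]> <*> <[b]> -> z \notin <[u]> <*> <[v]> ->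
  exists (hT : finGroupType) (H : {group hT}) (a' b' c' c1' c2' z' : hT),
    BC_rels p q m11 m12 m22 s1 s2 t1 t2 H a' b' c' c1' c2' z' /\ z' != 1.
Proof.
move=> fB es1 es2 et1 et2 Ez nNz.
have [cua cub cva cvb] := BC_central fB es1 es2 et1 et2.
case: (fB) => r1 r2 r3 r4 r5 r6 r7 r8 r9 r10 r11 r12 r13 r14 r15 r16 r17 r18 r19.
have [Na Nb Nu Nv] := central_quotient cua cub cva cvb.
set N := (<[u]> <*> <[v]>)%G in Na Nb Nu Nv.
have sEN : <[a]> <*> <[b]> \subset 'N(N) by rewrite join_subG !cycle_subG Na.
have Nz := subsetP sEN _ Ez.
have Nc : c \in 'N(N) by rewrite -r1 groupR.
have N1 : c1 \in 'N(N) by rewrite -r2 groupR.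
have N2 : c2 \in 'N(N) by rewrite -r3 groupR.
exists (coset_of N), (<[coset N a]> <*> <[coset N b]>)%G.
exists (coset N a), (coset N b), (coset N c), (coset N c1), (coset N c2), (coset N z).
split; last by apply: contra nNz => /eqP/coset_idr->.
split=> //; first exact: (BC_frame_morph (coset_morphism N) Na Nb Nz fB).
  by apply: eq_of_divg1; rewrite -!morphX // -morphM ?groupX // -morphV ?groupM ?groupX
    // -morphM ?groupV ?groupM ?groupX.
by apply: eq_of_divg1; rewrite -!morphX // -morphM ?groupX // -morphV ?groupM ?groupX
  // -morphM ?groupV ?groupM ?groupX.
Qed.

(** Commutation with [a] turns the left side of the power relation of a1 into that of a2, which
    equals a4^k = [a3^k, a]; hence [u] commutes with [a]. For [v], the expansion of [a^(p^2), a1]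
    vanishes because a2^(p^2) = 1 and p divides C(p^2, 2) and C(p^2, 3). *)
Lemma A_central k e (a a1 a2 a3 a4 : gT)
    (u := a1 ^+ p * a2 ^+ 'C(p, 2) * a3 ^+ 'C(p, 3) * a4 ^+ 'C(p, 4) * (a3 ^+ k)^-1)
    (v := a ^+ (p ^ 2)) :
    A_frame p k e a a1 a2 a3 a4 ->
  [/\ commute u a, commute u a1, commute v a & commute v a1].
Proof.
move=> fA; case: (fA) => r1 r2 r3 r4 r5 r6 r7 r8 r9 r10 r11 r12 r13.
have k1 (x y : gT) : commute x y -> [~ x, y] = 1 by move=> cxy; apply/eqP/commgP.
have cX (x y : gT) i : commute x y -> commute (x ^+ i) y.
  by move=> cxy; apply/commute_sym/commuteX/commute_sym.
have [d def_d] := dvdnP (dvdn_bin2 p_pr p_odd).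
have r21 : [~ a2, a1] = a4 ^- e by rewrite -r4 invg_comm.
have c4e (x : gT) : commute x a4 -> commute x (a4 ^- e).
  by move=> cx4; apply: commuteV; apply: commuteX.
have e1p : [~ a1 ^+ p, a] = a2 ^+ p.
  rewrite (@commXg_bin _ _ _ a2 (a4 ^- e) 1 p) //.
  - by rewrite expg1n mulg1 def_d expg_muln ?mulg1 // expgVn -expgM mulnC expgM r12 expg1n invg1.
  - by rewrite k1 //; apply/commute_sym/c4e.
  - exact: c4e.
  - exact: commute1.
  - exact: commute1.
  - exact/commute_sym/commute1.
pose w := a2 ^+ 'C(p, 2) * a3 ^+ 'C(p, 3) * a4 ^+ 'C(p, 4).
have cw (x : gT) : commute x a2 -> commute x a3 -> commute x a4 -> commute x w.
  by move=> x2 x3 x4; do ![apply: commuteM]; apply: commuteX.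
have cw2 : commute w a2 by apply/commute_sym/cw; rewrite ?r8.
have cw3 : commute w a3 by apply/commute_sym/cw; rewrite ?r8 //; apply/commute_sym.
have cw4 : commute w a4 by apply/commute_sym/cw => //; apply/commute_sym.
have def_u : u = a1 ^+ p * w * (a3 ^+ k)^-1 by rewrite /u /w !mulgA.
have wa : [~ w, a] = a3 ^+ 'C(p, 2) * a4 ^+ 'C(p, 3).
  have e2 : [~ a2 ^+ 'C(p, 2), a] = a3 ^+ 'C(p, 2) by rewrite commXg r2.
  have e3 : [~ a3 ^+ 'C(p, 3), a] = a4 ^+ 'C(p, 3) by rewrite commXg r3.
  have e4 : [~ a4 ^+ 'C(p, 4), a] = 1 by rewrite k1 //; apply: cX.
  have e23 : [~ a2 ^+ 'C(p, 2) * a3 ^+ 'C(p, 3), a] = a3 ^+ 'C(p, 2) * a4 ^+ 'C(p, 3).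
    by rewrite commMg_commute ?e2 ?e3 //; apply/cX/commuteX/commute_refl.
  rewrite /w commMg_commute ?e23 ?e4 ?mulg1 //.
  by apply/commute_sym/commuteM; apply: cX; apply: commuteX => //; apply: commute_sym.
have cua : commute u a.
  rewrite def_u; apply: commute_divg; rewrite commMgJ e1p wa.
  rewrite (conjg_fixP _); last by apply/commgP; apply/cX/commute_sym.
  by rewrite mulgA r13 commXg ?r3.
have cu1 : commute u a1.
  rewrite def_u; apply: commute_divg; rewrite [RHS]k1; last exact/cX/commute_sym.
  rewrite commMgJ [[~ a1 ^+ p, _]]k1 ?conj1g ?mul1g; last exact/cX/commute_refl.
  rewrite /w commMgJ [[~ a4 ^+ _, _]]k1 ?mulg1; last exact/cX/commute_sym.
  rewrite commMgJ [[~ a3 ^+ _, _]]k1 ?mulg1; last exact/cX/commute_sym.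
  rewrite commXg ?r21; last exact: c4e.
  by rewrite def_d expg_muln ?conj1g // expgVn -expgM mulnC expgM r12 expg1n invg1.
have p2_gt3 : 3 < p ^ 2.
  by apply: (@leq_trans (3 ^ 2)); rewrite // leq_exp2r // odd_prime_gt2.
have [d2 def_d2] : exists d2, 'C(p ^ 2, 2) = (d2 * p)%N.
  by apply/dvdnP/dvdn_bin_sqr => //=; apply: ltnW.
have [d3 def_d3] : exists d3, 'C(p ^ 2, 3) = (d3 * p)%N.
  by apply/dvdnP/dvdn_bin_sqr.
have cV (x y : gT) : commute x y -> commute x^-1 y^-1.
  by move=> cxy; apply/commute_sym/commuteV/commute_sym/commuteV.
have a2p2 : a2 ^+ (p ^ 2) = 1.
  rewrite expnS expn1 expgM; move/(canRL (mulgK _)): r13.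
  rewrite def_d expg_muln // mulg1 => ->.
  rewrite expgMn; last by apply: commuteV; apply: commuteX; apply: cX.
  by rewrite expgVn -!expgM !expg_muln // invg1 mulg1.
have cva1 : commute v a1.
  apply/commgP; rewrite /v.
  have e1 : [~ a, a1] = a2^-1 by rewrite -r1 invg_comm.
  have e2 : [~ a2^-1, a] = a3^-1 by rewrite commVg_commute r2.
  have e3 : [~ a3^-1, a] = a4^-1 by rewrite commVg_commute r3.
  rewrite (commXg_bin _ e1 e2 e3); try exact: cV.
    by rewrite !expgVn a2p2 def_d2 def_d3 !expg_muln // invg1 !mulg1.
  by apply/commute_sym/commuteV/commute_sym.
have cva : commute v a by apply/cX/commute_refl.
by [].
Qed.

Lemma A_quotient k e (a a1 a2 a3 a4 : gT)
    (u := a1 ^+ p * a2 ^+ 'C(p, 2) * a3 ^+ 'C(p, 3) * a4 ^+ 'C(p, 4) * (a3 ^+ k)^-1)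
    (v := a ^+ (p ^ 2)) :
    A_frame p k e a a1 a2 a3 a4 -> a4 \notin <[u]> <*> <[v]> ->
  exists (hT : finGroupType) (H : {group hT}) (b b1 b2 b3 b4 : hT),
    A_rels p k e H b b1 b2 b3 b4 /\ b4 != 1.
Proof.
move=> fA nN4; have [cua cu1 cva cva1] := A_central fA.
case: (fA) => r1 r2 r3 r4 r5 r6 r7 r8 r9 r10 r11 r12 r13.
have [Na Na1 Nu Nv] := central_quotient cua cu1 cva cva1.
set N := (<[u]> <*> <[v]>)%G in Na Na1 Nu Nv.
have N2 : a2 \in 'N(N) by rewrite -r1 groupR.
have N3 : a3 \in 'N(N) by rewrite -r2 groupR.
have N4 : a4 \in 'N(N) by rewrite -r3 groupR.
exists (coset_of N), (<[coset N a]> <*> <[coset N a1]>)%G.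
exists (coset N a), (coset N a1), (coset N a2), (coset N a3), (coset N a4).
split; last by apply: contra nN4 => /eqP/coset_idr->.
split=> //; first exact: (A_frame_morph (coset_morphism N) Na Na1 fA).
  by rewrite -morphX.
apply: eq_of_divg1; rewrite -!morphX // -morphV ?groupX // -!morphM ?groupM ?groupV ?groupX //.
Qed.

End Quotient.

Lemma mem_expg_coprime (gT : finGroupType) (G : {group gT}) (z : gT) p m :
  prime p -> z ^+ p = 1 -> ~~ (p %| m) -> z ^+ m \in G -> z \in G.
Proof.
move=> p_pr zp ndv Gzm; have [-> //|nz] := eqVneq z 1.
have oz := nt_prime_order p_pr zp nz.
have: z \in <[z ^+ m]>; last by apply: subsetP; rewrite cycle_subG.
have := generator_coprime z m; rewrite oz prime_coprime // ndv /generator.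
by move/eqP <-; apply: cycle_id.
Qed.

Lemma commute_expg_cut (gT : finGroupType) (x y : gT) n :
  commute (x ^+ n * y) x -> commute (x ^+ n) y.
Proof.
move=> cxy; apply/commute_sym/commuteX.
rewrite -[y](mulKg (x ^+ n)); apply/commute_sym/commuteM; last exact/commute_sym.
by apply/commuteV/commuteX/commute_refl.
Qed.

Section ModelRels.

Import GRing.Theory.

Variables (p : nat) (p_pr : prime p) (p_odd : odd p).
Notation L := 'Z_(p ^ 2).
Local Open Scope ring_scope.

Let p_gt2 : (2 < p)%N.
Proof. exact: odd_prime_gt2. Qed.

Let p2_gt1 : (1 < p ^ 2)%N.
Proof. by rewrite (ltn_exp2l 0) // prime_gt1. Qed.

Let pp0 : (p%:R * p%:R : L) = 0.
Proof. by rewrite -natrM mulnn pchar_Zp. Qed.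

Lemma pt_eq t x y w t' x' y' w' : t = t' -> x = x' -> y = y' -> w = w' ->
  pt (t, x, y, w) = pt (t', x', y', w') :> {perm model_pt p}.
Proof. by move=> -> -> -> ->. Qed.

Let pn0 n : (p%:R *+ (n * p) : L) = 0.
Proof. by rewrite -[LHS]mulr_natr natrM mulrCA pp0 mulr0. Qed.

Let pn0X n l : (p%:R : L) *+ n *+ (l * p) = 0.
Proof. by rewrite -[LHS]mulrnA mulnA pn0. Qed.

Let dvdn_p2 k : (p ^ 2 %| p * k)%N -> exists l, k = (l * p)%N.
Proof. by rewrite expnS expn1 dvdn_pmul2l ?prime_gt0 // => /dvdnP. Qed.

Lemma model_BC_frame (q m11 m12 m22 : nat)
    (a := @pa p q%:R m11%:R m12%:R m22%:R 1 0) (b := @pb p m12%:R m22%:R) :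
  BC_frame p q m11 m12 m22 a b
    (pt (p%:R, 0, 0, q%:R)) (pt (0, p%:R, 0, 0)) (pt (0, 0, p%:R, 0))
    (pt (0, 0, 0, p%:R)).
Proof.
have cz x : [~ pt (0, 0, 0, p%:R), x]%g = 1%g -> commute (pt (0, 0, 0, p%:R)) x.
  by move=> e; apply/commgP; rewrite e.
have pp : (p%:R : L) *+ p = 0 by rewrite -[LHS]mulr_natr pp0.
split; try exact: pt_commute.
- exact: pa_b.
- by rewrite comm_pt_a; apply: pt_eq; ring.
- by rewrite comm_pt_b; apply: pt_eq; ring.
- by rewrite comm_pt_a ptX !mul0rn; apply: pt_eq => //; rewrite ?mulr_natr; ring.
- by rewrite comm_pt_b ptX !mul0rn; apply: pt_eq => //; rewrite ?mulr_natr; ring.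
- by rewrite comm_pt_a ptX !mul0rn; apply: pt_eq => //; rewrite ?mulr_natr; ring.
- by rewrite comm_pt_b ptX !mul0rn; apply: pt_eq => //; rewrite ?mulr_natr; ring.
- by apply: cz; rewrite comm_pt_a; apply/eqP; rewrite pt_eq1 !mulr0 !addr0 eqxx.
- by apply: cz; rewrite comm_pt_b; apply/eqP; rewrite pt_eq1 !mulr0 !addr0 eqxx.
- rewrite !ptX !mul0rn pp; apply: (pt_eq (erefl _) (erefl _) (erefl _)).
  by rewrite -[LHS]mulr_natr -[RHS]mulr_natr mulrC.
- by rewrite !ptX !mul0rn pp; apply/eqP; rewrite pt_eq1 eqxx.
- by rewrite !ptX !mul0rn pp; apply/eqP; rewrite pt_eq1 eqxx.
- by rewrite !ptX !mul0rn pp; apply/eqP; rewrite pt_eq1 eqxx.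
Qed.

(** a2 is the translation by (p, 0, 0, q), so its p-th power contributes p q to the last coordinate,
    and q = k - C(p,3) solves p q + p C(p,3) = p k. The value m22 = 1 gives [a3, a] = a4, and ep =
    -e gives [a1, a2] = a4^e. *)
Lemma model_A_frame (k e : nat)
    (b := @pa p (k%:R - 'C(p, 3)%:R) 0 0 1 0 (- e%:R)) (a := @pb p 0 1) :
  A_frame p k e a b
    (pt (p%:R, 0, 0, k%:R - 'C(p, 3)%:R)) (pt (0, 0, p%:R, 0)) (pt (0, 0, 0, p%:R)).
Proof.
have cz (x y : {perm model_pt p}) : [~ y, x]%g = 1%g -> commute x y.
  by move=> h; apply/commute_sym/commgP; rewrite h.
have pp : (p%:R : L) *+ p = 0 by rewrite -[LHS]mulr_natr pp0.
have [d def_d] := dvdnP (dvdn_bin2 p_pr p_odd).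
split; try exact: pt_commute.
- exact: pa_b.
- by rewrite comm_pt_b; apply: pt_eq; ring.
- by rewrite comm_pt_b; apply: pt_eq; ring.
- rewrite -invg_comm comm_pt_a ptV ptX !mul0rn -[_ *+ e]mulr_natr.
  by apply: pt_eq; ring.
- by apply/commute_sym/cz; rewrite comm_pt_b; apply/eqP; rewrite pt_eq1 !mulr0 !addr0 eqxx.
- by apply: cz; rewrite comm_pt_a; apply/eqP; rewrite pt_eq1 !(mul0r, mulr0, addr0) eqxx.
- by apply: cz; rewrite comm_pt_a; apply/eqP; rewrite pt_eq1 !(mul0r, mulr0, addr0) eqxx.
- by rewrite !ptX !mul0rn pp; apply/eqP; rewrite pt_eq1 eqxx.
- by rewrite !ptX !mul0rn pp; apply/eqP; rewrite pt_eq1 eqxx.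
rewrite !ptX !mul0rn pp def_d pn0 !ptM !add0r.
apply: (pt_eq (erefl _) (erefl _) (erefl _)).
rewrite addr0 -[_ *+ p]mulr_natr -[_ *+ 'C(p, 3)]mulr_natr -[RHS]mulr_natr.
by ring.
Qed.

Lemma BC_model q m11 m12 m22 s1 s2 t1 t2 :
    BC_nondeg p m11 m12 m22 ->
    (s1 * m11 + s2 * m12 = 0 %[mod p])%N ->
    (s1 * m12 + s2 * m22 = q + m11 * 'C(p, 3) %[mod p])%N ->
    (t1 * m11 + t2 * m12 + (q + m22 * 'C(p, 3)) = 0 %[mod p])%N ->
    (t1 * m12 + t2 * m22 = 0 %[mod p])%N ->
  exists (hT : finGroupType) (H : {group hT}) (a' b' c' c1' c2' z' : hT),
    BC_rels p q m11 m12 m22 s1 s2 t1 t2 H a' b' c' c1' c2' z' /\ z' != 1%g.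
Proof.
move=> nd es1 es2 et1 et2; have fB := model_BC_frame q m11 m12 m22.
have [cua cub cva cvb] := BC_central p_pr p_odd fB es1 es2 et1 et2.
set a := pa _ _ _ _ _ _ in fB cua cub cva cvb; set b := pb _ _ in fB cua cub cva cvb.
set c := pt (p%:R, _, _, _) in fB cua cub cva cvb.
set c1 := pt (0, p%:R, _, _) in fB cua cub cva cvb.
set c2 := pt (0, 0, p%:R, _) in fB cua cub cva cvb.
set z := pt (0, 0, 0, p%:R) in fB cua cub cva cvb.
pose E := (<[a]> <*> <[b]>)%G.
have Ea : a \in E by rewrite mem_joinl ?cycle_id.
have Eb : b \in E by rewrite mem_joinr.
have Ec : c \in E by rewrite -(BC_ab fB) groupR.
have E1 : c1 \in E by rewrite -(BC_ca fB) groupR.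
have E2 : c2 \in E by rewrite -(BC_cb fB) groupR.
have Ez : z \in E.
  case: nd => [[nd _ _] | [_ nd _]]; apply: (mem_expg_coprime p_pr (BC_zp fB) nd).
    by rewrite -(BC_1b fB) groupR.
  by rewrite -(BC_1a fB) groupR.
apply: (BC_quotient p_pr p_odd fB) => //.
have def_y i j : ((c1 ^+ i * c2 ^+ j)^-1)%g = pt (0, - (p%:R *+ i), - (p%:R *+ j), 0).
  by rewrite !ptX !mul0rn ptM ptV !(add0r, addr0, oppr0).
have ptp i j k : (p ^ 2 %| p * k)%N ->
    (pt (0, - (p%:R *+ i), - (p%:R *+ j), 0) ^+ k)%g = 1%g :> {perm model_pt p}.
  case/dvdn_p2 => l ->.
  rewrite ptX !mul0rn !mulNrn !pn0X oppr0.
  by apply/eqP; rewrite pt_eq1 eqxx.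
move: cua cub cva cvb; rewrite !def_y => cua cub cva cvb.
(* The defects are a^p and b^p times translations of order dividing p; such a translation dies in
   the k-th power whenever p^2 divides p k. *)
apply: (pt_notin p_pr); try exact: ptp; try exact: commute_expg_cut.
suff: E \subset 'C[(a ^+ p * pt (0, - (p%:R *+ s1), - (p%:R *+ s2), 0))%g].
  move/subsetP=> sEC; apply/commute_sym/cent1P/sEC.
  by rewrite -def_y groupM ?groupV ?groupM ?groupX.
by rewrite join_subG !cycle_subG; apply/andP; split; apply/cent1P.
Qed.

Lemma A_model (k e : nat) :
  exists (hT : finGroupType) (H : {group hT}) (b b1 b2 b3 b4 : hT),
    A_rels p k e H b b1 b2 b3 b4 /\ b4 != 1%g.
Proof.
have fA := model_A_frame k e.
have [cua cu1 cva cv1] := A_central p_pr p_odd fA.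
apply: (A_quotient p_pr p_odd fA).
set a1 := pa _ _ _ _ _ _ in fA cua cu1 cva cv1 *.
set a := pb _ _ in fA cua cu1 cva cv1 *.
have [d def_d] := dvdnP (dvdn_bin2 p_pr p_odd).
set c := pt (p%:R, _, _, _) in fA cua cu1 cva cv1 *.
set c3 := pt (0, 0, p%:R, _) in fA cua cu1 cva cv1 *.
set z := pt (0, 0, 0, p%:R) in fA cua cu1 cva cv1 *.
set q := k%:R - 'C(p, 3)%:R in c fA cua cu1 cva cv1 *.
(* As p divides C(p,2), every coordinate of [m1] is a multiple of p, so its translation has order
   dividing p. *)
pose m1 : model_vec p :=
  (0, 0, p%:R *+ 'C(p, 3) - p%:R *+ k, q *+ 'C(p, 2) + p%:R *+ 'C(p, 4)).
have def_m1 : (c ^+ 'C(p, 2) * c3 ^+ 'C(p, 3) * z ^+ 'C(p, 4) * (c3 ^+ k)^-1)%g = pt m1.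
  rewrite !ptX !mul0rn ptV !ptM !(add0r, addr0, oppr0, subr0).
  by apply: pt_eq => //; rewrite def_d pn0.
have def_u : (a1 ^+ p * c ^+ 'C(p, 2) * c3 ^+ 'C(p, 3) * z ^+ 'C(p, 4) * (c3 ^+ k)^-1
    = a1 ^+ p * pt m1)%g by rewrite -def_m1 !mulgA.
have pt0 : pt (0, 0, 0, 0) = 1%g :> {perm model_pt p}.
  by apply/eqP; rewrite pt_eq1 eqxx.
have def_v : (a ^+ (p ^ 2) = a ^+ (p ^ 2) * pt (0, 0, 0, 0))%g by rewrite pt0 mulg1.
rewrite def_u in cua cu1 *; rewrite def_v.
apply: (pt_notin p_pr).
- exact: commute_expg_cut.
- by rewrite pt0; apply: commute1.
- by rewrite pt0 mulg1; apply: commuteX.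
- move=> j /dvdn_p2[l ->].
  rewrite ptX !mul0rn mulrnBl mulrnDl !pn0X subr0 addr0 def_d.
  have -> : q *+ (d * p) *+ (l * p) = 0.
    by rewrite -[LHS]mulrnA -[LHS]mulr_natr !natrM mulrACA pp0 !mulr0.
  by apply/eqP; rewrite pt_eq1 eqxx.
by move=> j _; rewrite pt0 expg1n.
Qed.

End ModelRels.

(** * Existence and nontriviality of the presented groups *)

Section Families.

Variables (p : nat) (p_pr : prime p) (p_odd : odd p).

Lemma A_rels_card_le k e (gT : finGroupType) (K : {group gT}) a a1 a2 a3 a4 :
  A_rels p k e K a a1 a2 a3 a4 -> #|K| <= p ^ 6.
Proof.
case=> -> fA ap a1p; apply: (A_frame_card_gen_le p_pr fA ap).
have L3 := mem_joinl <[a2]> (mem_joinr <[a4]> a3).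
have L4 := mem_joinl <[a2]> (mem_joinl <[a3]> (cycle_id a4)).
have L2 := mem_joinr (<[a4]> <*> <[a3]>) a2.
move/(canRL (mulgK _))/(canRL (mulgK _))/(canRL (mulgK _)): a1p => ->.
by rewrite !(groupM, groupV, groupX).
Qed.

Lemma BC_rels_card_le q m11 m12 m22 s1 s2 t1 t2 (gT : finGroupType)
    (K : {group gT}) a b c c1 c2 z :
  BC_rels p q m11 m12 m22 s1 s2 t1 t2 K a b c c1 c2 z -> #|K| <= p ^ 6.
Proof.
case=> -> fB ap bp.
have L1 := mem_joinl <[c]> (mem_joinl <[c2]> (mem_joinr <[z]> c1)).
have L2 := mem_joinl <[c]> (mem_joinr (<[z]> <*> <[c1]>) c2).
by apply: (BC_frame_card_gen_le p_pr fB); rewrite ?ap ?bp groupM ?groupX.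
Qed.

(** With b4 = 1 the derived subgroup of H would have order at most p^2, yet it maps onto that of G,
    of order p^3. It is applied with the model as G and the presented group, which maps onto the
    model, as H. *)
Lemma A_rels_homg_neq1 k e (gT hT : finGroupType) (G : {group gT}) (H : {group hT})
    a a1 a2 a3 a4 b b1 b2 b3 b4 :
    A_rels p k e G a a1 a2 a3 a4 -> a4 != 1 ->
    A_rels p k e H b b1 b2 b3 b4 -> G \homg H -> b4 != 1.
Proof.
case=> defG fG _ _ nz4 [defH fH _ _] /homgP[f im_f].
have := A_frame_card_der_le p_pr fH; have := A_frame_card_der p_pr fG nz4.
rewrite -defG -defH -im_f -morphim_der // => oG leH.
have := leq_trans (leq_morphim f H^`(1)) leH; rewrite oG.
rewrite expnS leq_mul2r expn_eq0 -leqn0 leqNgt prime_gt0 //=.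
by apply: contraTneq => ->; rewrite order1 -ltnNge prime_gt1.
Qed.

Lemma BC_rels_homg_neq1 q m11 m12 m22 s1 s2 t1 t2 (gT hT : finGroupType)
    (G : {group gT}) (H : {group hT}) a b c c1 c2 z a' b' c' c1' c2' z' :
    BC_nondeg p m11 m12 m22 ->
    BC_rels p q m11 m12 m22 s1 s2 t1 t2 G a b c c1 c2 z -> z != 1 ->
    BC_rels p q m11 m12 m22 s1 s2 t1 t2 H a' b' c' c1' c2' z' -> G \homg H ->
  z' != 1.
Proof.
move=> nd [defG fG _ _] nz [defH fH _ _] /homgP[f im_f].
have := BC_frame_card_der_le p_pr fH; have := BC_frame_card_der p_pr fG nz nd.
rewrite -defG -defH -im_f -morphim_der // => oG leH.
have := leq_trans (leq_morphim f H^`(1)) leH; rewrite oG.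
rewrite expnS leq_mul2r expn_eq0 -leqn0 leqNgt prime_gt0 //=.
by apply: contraTneq => ->; rewrite order1 -ltnNge prime_gt1.
Qed.

Lemma is_A_rels k n (e : bool) (hT : finGroupType) (H : {group hT}) :
    (k = n%:Z %[mod p%:Z])%Z -> is_A p k e H ->
  exists a a1 a2 a3 a4, A_rels p n e H a a1 a2 a3 a4 /\ a4 != 1.
Proof.
move=> kn isoH; have [gT [G [b [b1 [b2 [b3 [b4 [rG nzG]]]]]]]] := A_model p_pr p_odd n e.
have homG : G \homg H by rewrite isoH; apply/(A_homP _ _ kn); exists b, b1, b2, b3, b4.
have /(A_homP _ _ kn)[a [a1 [a2 [a3 [a4 rH]]]]] := isoGrp_hom isoH.
by exists a, a1, a2, a3, a4; split=> //; apply: A_rels_homg_neq1 rG nzG rH homG.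
Qed.

Lemma modz_repr (k : int) : exists n : nat, (k = n%:Z %[mod p%:Z])%Z.
Proof.
exists `|(k %% p)%Z|%N.
by rewrite abszE Num.Theory.ger0_norm ?modz_ge0 ?modz_mod // eqz_nat -lt0n prime_gt0.
Qed.

Lemma is_A_exists k (e : bool) :
  exists (hT : finGroupType) (H : {group hT}), is_A p k e H.
Proof.
have [n kn] := modz_repr k; apply: (@isoGrp_exists (p ^ 6)).
  have [gT [G [b [b1 [b2 [b3 [b4 [rG _]]]]]]]] := A_model p_pr p_odd n e.
  by exists gT, G; apply/(A_homP _ _ kn); exists b, b1, b2, b3, b4.
by move=> gT G /(A_homP _ _ kn)[a [a1 [a2 [a3 [a4 /A_rels_card_le]]]]].
Qed.

Lemma eq_modzP (x y : int) : (x = y %[mod p%:Z])%Z <-> exists d : int, (x = y + d * Posz p)%R.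
Proof.
split=> [/eqP | [d ->]]; last by rewrite GRing.addrC modzMDl.
rewrite eqz_mod_dvd => /dvdzP[d e]; exists d.
by rewrite -e GRing.addrC GRing.subrK.
Qed.

Lemma eq_modn_modz (m n : nat) : (m%:Z = n%:Z %[mod p%:Z])%Z -> m = n %[mod p].
Proof. by rewrite !modz_nat => -[]. Qed.

Lemma bin3_modp : exists d, (Posz 'C(p, 3) = delta p + d * Posz p)%R.
Proof.
rewrite /delta; case: eqP => [-> | p_neq3]; first by exists 0%R.
have /dvdnP[d ->] : p %| 'C(p, 3).
  apply: prime_dvd_bin => //=; have := odd_prime_gt2 p_odd p_pr.
  by rewrite leq_eqVlt => /predU1P[/esym|].
by exists (Posz d); rewrite PoszM GRing.add0r.
Qed.

Lemma B_nondeg : BC_nondeg p 0 1 0.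
Proof. by left; split; rewrite // Euclid_dvd1. Qed.

Lemma B_model (c : bool) :
  exists (hT : finGroupType) (H : {group hT}) (a' b' c' c1' c2' z' : hT),
    BC_rels p c 0 1 0 c 0 0 (p.-1 * c)%N H a' b' c' c1' c2' z' /\ z' != 1.
Proof.
apply: (BC_model p_pr p_odd B_nondeg); rewrite ?mul0n ?muln0 ?muln1 ?addn0 ?add0n //.
by rewrite addnC -mulSn prednK ?prime_gt0 // modnMr mod0n.
Qed.

Lemma is_B_rels (c : bool) (hT : finGroupType) (H : {group hT}) : is_B p c H ->
  exists a1 a2 b b1 b2 g,
    BC_rels p c 0 1 0 c 0 0 (p.-1 * c)%N H a1 a2 b b1 b2 g /\ g != 1.
Proof.
have p_gt0 := prime_gt0 p_pr.
move=> isoH; have [gT [G [a [b [d [d1 [d2 [z [rG nzG]]]]]]]]] := B_model c.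
have homG : G \homg H by rewrite isoH; apply/(B_homP _ _ p_gt0); exists a, b, d, d1, d2, z.
have /(B_homP _ _ p_gt0)[a' [b' [d' [d1' [d2' [z' rH]]]]]] := isoGrp_hom isoH.
exists a', b', d', d1', d2', z'; split=> //.
exact: BC_rels_homg_neq1 B_nondeg rG nzG rH homG.
Qed.

Lemma is_B_exists (c : bool) : exists (hT : finGroupType) (H : {group hT}), is_B p c H.
Proof.
have p_gt0 := prime_gt0 p_pr.
apply: (@isoGrp_exists (p ^ 6)).
  have [gT [G [a [b [d [d1 [d2 [z [rG _]]]]]]]]] := B_model c.
  by exists gT, G; apply/(B_homP _ _ p_gt0); exists a, b, d, d1, d2, z.
by move=> gT G /(B_homP _ _ p_gt0)[a [b [d [d1 [d2 [z /BC_rels_card_le]]]]]].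
Qed.

Section FamilyC.

Variables (nu : int) (nu_nonres : quad_nonresidue p nu).
Variables (n22 : nat) (en : ((- nu)%R = n22%:Z %[mod p%:Z])%Z).

Lemma C_nondeg : BC_nondeg p 1 0 n22.
Proof.
right; split; rewrite ?Euclid_dvd1 //; apply/negP=> /dvdnP[d def_n].
case: nu_nonres; exists 0%R; apply/eq_modzP.
have [e def_nu] := proj1 (eq_modzP _ _) en.
exists (Posz d + e)%R; move: def_nu; rewrite def_n PoszM => def_nu.
have -> : nu = (- (Posz d * Posz p + e * Posz p))%R by rewrite -def_nu GRing.opprK.
by ring.
Qed.

(** The exponents m and delta nu - c of the presentation solve the congruences that make the power
    relations consistent: -nu m = c + delta and (delta nu - c) + c - nu delta = 0, where delta is
    C(p,3) modulo p. *)
Lemma C_model (c : bool) m s2 t1 :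
    (nu * m = - (c%:Z + delta p) %[mod p%:Z])%Z -> (m = s2%:Z %[mod p%:Z])%Z ->
    ((delta p * nu - c%:Z)%R = t1%:Z %[mod p%:Z])%Z ->
  exists (hT : finGroupType) (H : {group hT}) (a' b' c' c1' c2' z' : hT),
    BC_rels p c 1 0 n22 0 s2 t1 0 H a' b' c' c1' c2' z' /\ z' != 1.
Proof.
move=> /eq_modzP[d1 e1] /eq_modzP[d2 e2] /eq_modzP[d3 e3].
have [d4 e4] := bin3_modp; have [d5 e5] := proj1 (eq_modzP _ _) en.
apply: (BC_model p_pr p_odd C_nondeg); rewrite ?mul0n ?muln0 ?muln1 ?addn0 ?add0n //.
  apply: eq_modn_modz; rewrite mul1n !PoszD PoszM; apply/eq_modzP.
  have -> : Posz c = (- (nu * m) - delta p + d1 * Posz p)%R by rewrite e1; ring.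
  have -> : Posz s2 = (m - d2 * Posz p)%R by rewrite e2; ring.
  have -> : Posz n22 = (- nu - d5 * Posz p)%R by rewrite e5; ring.
  by exists (- d1 - m * d5 + d2 * nu + d2 * d5 * Posz p - d4)%R; rewrite e4; ring.
apply: eq_modn_modz; rewrite !PoszD PoszM; apply/eq_modzP.
have -> : Posz t1 = (delta p * nu - Posz c - d3 * Posz p)%R by rewrite e3; ring.
have -> : Posz n22 = (- nu - d5 * Posz p)%R by rewrite e5; ring.
exists (- d3 - nu * d4 - d5 * delta p - d5 * d4 * Posz p)%R; rewrite e4; ring.
Qed.

Lemma is_C_rels (c : bool) (hT : finGroupType) (H : {group hT}) : is_C p nu c H ->
  exists s2 t1 a1 a2 b b1 b2 g,
    BC_rels p c 1 0 n22 0 s2 t1 0 H a1 a2 b b1 b2 g /\ g != 1.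
Proof.
case=> m [em isoH]; have [s2 es] := modz_repr m.
have [t1 et] := modz_repr (delta p * nu - c%:Z)%R.
have [gT [G [a [b [d [d1 [d2 [z [rG nzG]]]]]]]]] := C_model em es et.
have homG : G \homg H by rewrite isoH; apply/(C_homP _ en es et); exists a, b, d, d1, d2, z.
have /(C_homP _ en es et)[a' [b' [d' [d1' [d2' [z' rH]]]]]] := isoGrp_hom isoH.
exists s2, t1, a', b', d', d1', d2', z'; split=> //.
exact: BC_rels_homg_neq1 C_nondeg rG nzG rH homG.
Qed.

Lemma is_C_exists (c : bool) : exists (hT : finGroupType) (H : {group hT}), is_C p nu c H.
Proof.
have [m em] : exists m : int, (nu * m = - (c%:Z + delta p) %[mod p%:Z])%Z.
  have [u [v uv]] := Bezoutz nu p.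
  have /eqP co : coprimez nu p.
    rewrite coprimezE coprime_sym prime_coprime //; apply/negP=> p_nu.
    have /dvdzP[d def_nu] : (p %| nu)%Z by rewrite dvdzE.
    by case: nu_nonres; exists 0%R; apply/eq_modzP; exists (- d)%R; rewrite def_nu; ring.
  rewrite co in uv; exists (- (Posz c + delta p) * u)%R; apply/eq_modzP.
  exists ((Posz c + delta p) * v)%R.
  have -> : (nu * (- (Posz c + delta p) * u) =
    - (Posz c + delta p) * (u * nu + v * Posz p) + (Posz c + delta p) * v * Posz p)%R by ring.
  by rewrite uv GRing.mulr1.
have [s2 es] := modz_repr m.
have [t1 et] := modz_repr (delta p * nu - c%:Z)%R.
suff [gT [G isoG]] : exists (gT : finGroupType) (G : {group gT}), G \isog
    Grp (a1 : a2 : b : b1 : b2 : g :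
      [~ a1, a2] = b, [~ b, a1] = b1, [~ b, a2] = b2,
      [~ b1, a1] = g, [~ b2, a2] = g ^z (- nu)%R,
      [~ b1, a2], [~ b2, a1], [~ b, b1], [~ b, b2], [~ b1, b2],
      [~ g, a1], [~ g, a2], [~ g, b], [~ g, b1], [~ g, b2],
      a1 ^+ p = b2 ^z m, a2 ^+ p = b1 ^z (delta p * nu - c%:Z)%R,
      b ^+ p = g ^+ c, b1 ^+ p, b2 ^+ p, g ^+ p).
  by exists gT, G, m.
apply: (@isoGrp_exists (p ^ 6)).
  have [gT [G [a [b [d [d1 [d2 [z [rG _]]]]]]]]] := C_model em es et.
  by exists gT, G; apply/(C_homP _ en es et); exists a, b, d, d1, d2, z.
by move=> gT G /(C_homP _ en es et)[a [b [d [d1 [d2 [z /BC_rels_card_le]]]]]].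
Qed.

End FamilyC.

End Families.

(** * Central automorphisms of groups with dual central commutators *)

Section CentralAut.

Variables (gT : finGroupType) (G : {group gT}).

Lemma isog_Inn : G / 'Z(G) \isog Inn G.
Proof.
have := first_isog_loc (conj_aut G) (normG G).
by rewrite ker_conj_aut.
Qed.

Lemma card_center_Inn : #|'Z(Inn G)| = #|'Z(G / 'Z(G))|.
Proof. by rewrite (card_isog (isog_center isog_Inn)). Qed.

Lemma center_InnP s : s \in 'Z(Inn G) ->
  exists2 y, y \in G & (forall x, x \in G -> [~ x, y] \in 'Z(G) /\ s x = x ^ y).
Proof.
case/centerP=> /morphimP[y nGy Gy ->] cs; exists y => // x Gx.
have nGx := subsetP (normG G) x Gx.
split; last by rewrite norm_conj_autE.
have := cs _ (mem_morphim (conj_aut G) nGx Gx) => /esym/commgP.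
rewrite -morphR //= => /eqP/(kerP _ (groupR nGx nGy)).
by rewrite ker_conj_aut => cxy; rewrite inE cxy andbT groupR.
Qed.

Lemma Inn_sub_Aut : Inn G \subset Aut G.
Proof. by apply/subsetP=> s /morphimP[y nGy Gy ->]; apply: Aut_aut. Qed.

Lemma center_Inn_sub : 'Z(Inn G) \subset Aut_z G.
Proof.
apply/subsetP=> s Zs; have [y Gy sE] := center_InnP Zs; rewrite in_set.
apply/andP; split.
  by apply: (subsetP Inn_sub_Aut); apply: (subsetP (center_sub (Inn G))).
by apply/'forall_implyP=> x Gx; have [? ->] := sE x Gx; rewrite -commgEl.
Qed.

Lemma Aut_zP s : reflect (s \in Aut G /\ {in G, forall x, x^-1 * s x \in 'Z(G)})
  (s \in Aut_z G).
Proof.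
rewrite /Aut_z [s \in [set _ in _ | _]]in_set; apply: (iffP andP) => -[As sZ]; split=> //.
  by move=> x Gx; apply: (implyP (forallP sZ x)).
by apply/'forall_implyP.
Qed.

End CentralAut.

Lemma card_proper_pgroup (gT : finGroupType) (p : nat) (A B : {group gT}) :
  p.-group B -> A \proper B -> #|A| * p <= #|B|.
Proof.
move=> pB /properP[sAB [x Bx nAx]]; rewrite -(Lagrange sAB) leq_mul2l; apply/orP; right.
have iAB : 1 < #|B : A| by rewrite indexg_gt1; apply/subsetPn; exists x.
have /p_natP[[|k] def_i] : p.-nat #|B : A| by apply: pnat_dvd (dvdn_indexg B A) pB.
  by rewrite def_i in iAB.
have p_gt0 : 0 < p by rewrite lt0n; apply: contraTneq iAB => p0; rewrite def_i p0 exp0n.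
by rewrite def_i expnS leq_pmulr // expn_gt0 p_gt0.
Qed.

(* [c] witnesses class greater than 3 and [u], [v] are dual to [a], [b] under the
   commutator; the conditions only involve commutators and the center, so they are
   invariant under isoclinism. *)
Record inner_frame (gT : finGroupType) (G : {group gT}) (a b c u v : gT) : Prop :=
  InnerFrame {
  iF_a : a \in G; iF_b : b \in G; iF_c : c \in G; iF_u : u \in G; iF_v : v \in G;
  iF_gen : G / 'Z(G) = <[coset 'Z(G) a]> <*> <[coset 'Z(G) b]>;
  iF_ua : [~ u, a] != 1; iF_ub : [~ u, b] = 1;
  iF_va : [~ v, a] = 1; iF_vb : [~ v, b] != 1;
  iF_uv : [~ u, v] = 1; iF_cu : [~ c, u] = 1; iF_cv : [~ c, v] = 1;
  iF_uZ : {in G, forall x, [~ u, x] \in 'Z(G)};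
  iF_vZ : {in G, forall x, [~ v, x] \in 'Z(G)};
  iF_cZ : exists2 x, x \in G & [~ c, x] \notin 'Z(G) }.

Section FrameAutZ.

Variables (gT : finGroupType) (G : {group gT}) (p : nat).
Hypotheses (p_pr : prime p) (oG : #|G| = (p ^ 6)%N).
Variables (a b c u v : gT).
Hypothesis fG : inner_frame G a b c u v.

Let Z := 'Z(G)%G.
Let W1 := (Z <*> <[u]>)%G.
Let W2 := (W1 <*> <[v]>)%G.
Let W3 := (W2 <*> <[c]>)%G.

Let pG : p.-group G.
Proof. by rewrite /pgroup oG pnatX pnat_id. Qed.

Let nZG : G \subset 'N(Z).
Proof. by apply: normal_norm; apply: center_normal. Qed.

Lemma frame_sub_u : W1 \subset 'C[b].
Proof.
rewrite join_subG cycle_subG; apply/andP; split.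
  by apply/subsetP=> z /centerP[_ cz]; apply/cent1P; apply: cz; apply: (iF_b fG).
by apply/cent1P/commgP; rewrite (iF_ub fG).
Qed.

Lemma frame_card_W2 : #|Z| * p * p <= #|W2|.
Proof.
have pW2 : p.-group W2.
  apply: pgroupS pG; rewrite !join_subG !cycle_subG center_sub.
  by rewrite (iF_u fG) (iF_v fG).
have pW1 : p.-group W1 := pgroupS (joing_subl _ _) pW2.
have lt1 : Z \proper W1.
  rewrite properE joing_subl; apply/subsetPn; exists u; first exact: mem_joinr.
  apply: contra (iF_ua fG) => /centerP[_ cu]; apply/commgP/cu/(iF_a fG).
have lt2 : W1 \proper W2.
  rewrite properE joing_subl; apply/subsetPn; exists v; first exact: mem_joinr.
  apply: contra (iF_vb fG) => W1v; apply/commgP/cent1P.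
  exact: (subsetP frame_sub_u).
apply: leq_trans (card_proper_pgroup pW2 lt2).
by rewrite leq_mul2r (card_proper_pgroup pW1 lt1) orbT.
Qed.

Lemma frame_W2_comm x : x \in G -> W2 \subset centmod Z x.
Proof.
move=> Gx; have Nx := subsetP nZG x Gx.
rewrite !join_subG !cycle_subG !centmodE //.
rewrite !(subsetP nZG) ?(iF_u fG) ?(iF_v fG) // (iF_uZ fG) // (iF_vZ fG) // !andbT /=.
apply/subsetP=> z Zz; rewrite centmodE // (subsetP (normG Z)) //.
by rewrite (eqP (introT commgP _)) ?group1 //; case/centerP: Zz => _; apply.
Qed.

(** The chain Z < <Z, u> < <Z, u, v> < <Z, u, v, c> <= C_G(u, v) < C_G(u) < G has five strict
    inclusions, so |Z| p^5 <= p^6. The strict ones are witnessed by u, v, c, b and a; for c,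
    commutators of <Z, u, v> with G are central. *)
Lemma frame_card_center : #|Z| = p.
Proof.
have [x Gx cx] := iF_cZ fG.
have Nx := subsetP nZG x Gx.
have sW2 := frame_W2_comm Gx.
have lt3 : W2 \proper W3.
  rewrite properE joing_subl; apply/subsetPn; exists c; first exact: mem_joinr.
  by apply: contra cx => /(subsetP sW2); rewrite centmodE // => /andP[].
pose Cu := ('C_G[u])%G; pose Cuv := ('C_Cu[v])%G.
have lt5 : Cuv \proper Cu.
  rewrite properE subsetIl; apply/subsetPn; exists b.
    rewrite inE (iF_b fG); apply/cent1P/commute_sym/commgP.
    by rewrite (iF_ub fG).
  rewrite inE negb_and orbC; apply/orP; left; apply: contra (iF_vb fG) => /cent1P cvb.
  by apply/commgP/commute_sym.
have lt6 : Cu \proper G.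
  rewrite properE subsetIl; apply/subsetPn; exists a; first exact: (iF_a fG).
  rewrite inE negb_and orbC; apply/orP; left; apply: contra (iF_ua fG) => /cent1P cva.
  by apply/commgP/commute_sym.
have sW3 : W3 \subset Cuv.
  have cI (s t : gT) : [~ s, t] = 1 -> s \in 'C[t] by move=> e; apply/cent1P/commgP/eqP.
  have cx1 (s : gT) : s \in 'C[s] by apply/cent1P; apply: commute_refl.
  have [[Gu Gv] Gc] := (iF_u fG, iF_v fG, iF_c fG).
  have vu1 : [~ v, u] = 1 by rewrite -invg_comm (iF_uv fG) invg1.
  rewrite !join_subG !cycle_subG !subsetI center_sub !in_setI Gu Gv Gc !cx1.
  rewrite !cI ?(iF_cu fG) ?(iF_cv fG) ?(iF_uv fG) ?vu1 //= !andbT.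
  by apply/andP; split; apply/subsetP=> z /centerP[_ cz]; apply/cent1P/cz.
have pS (A : {group gT}) : A \subset G -> p.-group A by move=> sA; apply: pgroupS pG.
have le4 : #|W3| * p * p <= p ^ 6.
  rewrite -oG; apply: leq_trans (card_proper_pgroup pG lt6).
  rewrite leq_mul2r; apply/orP; right.
  have := card_proper_pgroup (pS _ (proper_sub lt6)) lt5.
  by apply: leq_trans; rewrite leq_mul2r subset_leq_card // orbT.
have le3 : #|Z| * p * p * p <= #|W3|.
  have := card_proper_pgroup (pS _ (subset_trans sW3 _)) lt3.
  move/(_ (subset_trans (subsetIl _ _) (subsetIl _ _))); apply: leq_trans.
  by rewrite leq_mul2r frame_card_W2 orbT.
have p_gt0 := prime_gt0 p_pr.
have leZ : #|Z| <= p.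
  have : #|Z| * p ^ 5 <= p * p ^ 5.
    rewrite -expnS; apply: leq_trans le4.
    by rewrite !expnS expn0 muln1 !mulnA !leq_mul2r le3 !orbT.
  by rewrite leq_pmul2r // expn_gt0 p_gt0.
have nZ : Z :!=: 1.
  apply/trivgPn; exists [~ u, a]; last exact: (iF_ua fG).
  by apply: (iF_uZ fG); apply: (iF_a fG).
have [_ + _] := pgroup_pdiv (pS _ (center_sub G)) nZ.
by move/(dvdn_leq (cardG_gt0 _)) => geZ; apply/eqP; rewrite eqn_leq leZ.
Qed.

Lemma frame_center_gen : Z :=: <[[~ u, a]]>.
Proof.
apply: nt_gen_prime; first by rewrite frame_card_center.
by rewrite in_setD1 (iF_ua fG); apply: (iF_uZ fG); apply: (iF_a fG).
Qed.

(** A central automorphism fixes every commutator, in particular the generator [u, a] of Z, hence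
    all of Z. As a and b generate G over Z, it is determined by the two central elements by which it
    moves a and b. *)
Lemma frame_card_Aut_z : #|Aut_z G| <= p * p.
Proof.
have Ga := iF_a fG; have Gb := iF_b fG; have Gu := iF_u fG.
rewrite -{1}frame_card_center -[X in _ <= _ * X]frame_card_center -cardsX.
pose val (s : {perm gT}) := (a^-1 * s a, b^-1 * s b).
have inj_val : {in Aut_z G &, injective val}.
  move=> s t /Aut_zP[As sZ] /Aut_zP[At tZ] [/mulgI sa /mulgI sb].
  apply: (eq_Aut As At) => x Gx.
  have fixZ r : r \in Aut G -> {in G, forall x, x^-1 * r x \in 'Z(G)} ->
      {in Z, forall z, r z = z}.
    move=> Ar rZ _ /[!frame_center_gen] /cycleP[i ->].
    have rE y : r y = autm Ar y by rewrite autmE.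
    rewrite rE morphX ?groupR //; congr (_ ^+ i); rewrite morphR //= -!rE.
    have Zc z y : z \in 'Z(G) -> y \in G -> [~ z, y] = 1.
      by case/centerP=> _ cz Gy; apply/eqP/commgP/cz.
    have GZ := subsetP (center_sub G).
    have [z2 Zz2 ->] : exists2 z2, z2 \in 'Z(G) & r u = u * z2.
      by exists (u^-1 * r u); rewrite ?mulKVg ?rZ.
    have [z1 Zz1 ->] : exists2 z1, z1 \in 'Z(G) & r a = a * z1.
      by exists (a^-1 * r a); rewrite ?mulKVg ?rZ.
    have Zj z y : z \in 'Z(G) -> y \in G -> y ^ z = y.
      by move=> Zz Gy; apply/conjg_fixP; rewrite -invg_comm Zc ?invg1.
    rewrite commMgJ (Zc z2) ?groupM ?(GZ z1) // mulg1 Zj ?groupR ?groupM ?(GZ z1) //.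
    by rewrite commgMJ Zj ?groupR // -[[~ u, z1]]invg_comm (Zc z1 u) // invg1 mul1g.
  have autM r : r \in Aut G -> {in G &, {morph r : y w / y * w}}.
    by move=> Ar y w Gy Gw; rewrite -(autmE Ar) morphM.
  have aut1 r : r \in Aut G -> r 1 = 1.
    by move=> Ar; rewrite -(autmE Ar) morph1.
  pose K := [set y in G | s y == t y].
  have gK : group_set K.
    apply/group_setP; split=> [|y w]; first by rewrite inE group1 !aut1 ?eqxx.
    rewrite !inE => /andP[Gy /eqP ey] /andP[Gw /eqP ew]; rewrite groupM //=.
    by rewrite !autM // ey ew.
  have sab : <[a]> <*> <[b]> \subset Group gK.
    by rewrite join_subG !cycle_subG /= !inE Ga Gb sa sb !eqxx.
  have sZ' : Z \subset Group gK.
    by apply/subsetP=> z Zz; rewrite inE (subsetP (center_sub G)) //= !fixZ.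
  have sGK : G \subset Group gK.
    have nab : <[a]> <*> <[b]> \subset 'N(Z).
      by rewrite join_subG !cycle_subG !(subsetP nZG).
    have : G \subset Z * (<[a]> <*> <[b]>).
      by rewrite -quotientSK // quotientY ?cycle_subG ?(subsetP nZG) // !quotient_cycle
        ?(subsetP nZG) // (iF_gen fG).
    by move/subset_trans; apply; rewrite mul_subG.
  by have := subsetP sGK x Gx; rewrite inE => /andP[_ /eqP].
by rewrite -(card_in_imset inj_val); apply/subset_leq_card/subsetP=> _ /imsetP[s /Aut_zP[As sZ] ->];
  rewrite inE /= !sZ.
Qed.

Theorem frame_Aut_z : Aut_z G = 'Z(Inn G).
Proof.
apply/eqP; rewrite eq_sym eqEcard center_Inn_sub (leq_trans frame_card_Aut_z) //.
rewrite card_center_Inn.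
have sW2 : W2 / Z \subset 'Z(G / 'Z(G)).
  have sW2G : W2 \subset G.
    by rewrite !join_subG !cycle_subG center_sub (iF_u fG) (iF_v fG).
  rewrite subsetI quotientS //; apply/centsP=> _ /morphimP[w Nw Ww ->] _ /morphimP[x Nx Gx ->].
  have := subsetP (frame_W2_comm Gx) w Ww; rewrite centmodE // => /andP[_ Zwx].
  by apply/commgP; rewrite -morphR //= coset_id.
rewrite (leq_trans _ (subset_leq_card sW2)) // -(leq_pmul2l (cardG_gt0 Z)) mulnA.
have sZW : Z \subset W2 := subset_trans (joing_subl Z <[u]>) (joing_subl W1 <[v]>).
rewrite (leq_trans frame_card_W2) // card_quotient ?Lagrange //.
by rewrite !join_subG !cycle_subG normG !(subsetP nZG) ?(iF_u fG) ?(iF_v fG).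
Qed.

End FrameAutZ.

Section FrameIsoclinic.

Variables (gT hT : finGroupType) (G : {group gT}) (H : {group hT}).

Lemma frame_isoclinic a b c u v : isoclinic G H -> inner_frame H a b c u v ->
  exists a' b' c' u' v', inner_frame G a' b' c' u' v'.
Proof.
case=> theta [phi [/isomP[inj_th im_th] /isomP[inj_phi im_phi] phiE]] fH.
have nZG : G \subset 'N('Z(G)) by apply: normal_norm; apply: center_normal.
have nZH : H \subset 'N('Z(H)) by apply: normal_norm; apply: center_normal.
have [NG NH] := (subsetP nZG, subsetP nZH).
(* [R x x'] says that x and x' represent cosets matched by [theta]. It is compatible with
   commutators, matches centers, and [phi] matches trivial commutators, so every condition of a
   frame transfers. *)
pose R x x' := [/\ x \in G, x' \in H & coset 'Z(H) x' = theta (coset 'Z(G) x)].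
have liftH x' : x' \in H -> exists x, R x x'.
  move=> Hx'; have: coset 'Z(H) x' \in theta @* (G / 'Z(G)) by rewrite im_th mem_quotient.
  by case/morphimP=> _ _ /morphimP[x Nx Gx ->] e; exists x.
have liftG x : x \in G -> exists x', R x x'.
  move=> Gx; have: theta (coset 'Z(G) x) \in H / 'Z(H).
    by rewrite -im_th mem_morphim ?mem_quotient.
  by case/morphimP=> x' _ Hx' e; exists x'.
have R_comm x x' y y' : R x x' -> R y y' -> R [~ x, y] [~ x', y'].
  move=> [Gx Hx ex] [Gy Hy ey]; split; rewrite ?groupR //.
  by rewrite !morphR ?NG ?NH ?mem_quotient //= ex ey.
have R_Z x x' : R x x' -> (x \in 'Z(G)) = (x' \in 'Z(H)).
  move=> [Gx Hx ex]; apply/idP/idP=> [Zx | Zx'].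
    by apply: coset_idr; rewrite ?NH // ex coset_id // morph1.
  apply: coset_idr; rewrite ?NG //; apply: (injmP inj_th); rewrite ?mem_quotient ?group1 //.
  by rewrite morph1 -ex coset_id.
have R_phi x x' y y' : R x x' -> R y y' -> phi [~ x, y] = [~ x', y'].
  by move=> [Gx Hx ex] [Gy Hy ey]; apply: phiE.
have R_1 x x' y y' : R x x' -> R y y' -> ([~ x, y] == 1) = ([~ x', y'] == 1).
  move=> Rx Ry; rewrite -(R_phi _ _ _ _ Rx Ry).
  have [Gx _ _] := Rx; have [Gy _ _] := Ry.
  by rewrite (morph_injm_eq1 inj_phi) ?mem_commg.
have [a' Ra] := liftH a (iF_a fH); have [b' Rb] := liftH b (iF_b fH).
have [c' Rc] := liftH c (iF_c fH); have [u' Ru] := liftH u (iF_u fH).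
have [v' Rv] := liftH v (iF_v fH); exists a', b', c', u', v'.
have e1 x x' y y' : R x x' -> R y y' -> [~ x', y'] = 1 -> [~ x, y] = 1.
  by move=> Rx Ry e; apply/eqP; rewrite (R_1 _ _ _ _ Rx Ry) e.
have [Ga _ ea] := Ra; have [Gb _ eb] := Rb.
split; try by [case: Ra | case: Rb | case: Rc | case: Ru | case: Rv].
- apply: (injm_morphim_inj inj_th) => //.
    by rewrite join_subG !cycle_subG !mem_quotient.
  rewrite im_th morphimY ?cycle_subG ?mem_quotient // !morphim_cycle ?mem_quotient //.
  by rewrite -ea -eb; apply: (iF_gen fH).
- by rewrite (R_1 _ _ _ _ Ru Ra) (iF_ua fH).
- by apply: (e1 _ _ _ _ Ru Rb); apply: (iF_ub fH).
- by apply: (e1 _ _ _ _ Rv Ra); apply: (iF_va fH).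
- by rewrite (R_1 _ _ _ _ Rv Rb) (iF_vb fH).
- by apply: (e1 _ _ _ _ Ru Rv); apply: (iF_uv fH).
- by apply: (e1 _ _ _ _ Rc Ru); apply: (iF_cu fH).
- by apply: (e1 _ _ _ _ Rc Rv); apply: (iF_cv fH).
- move=> x Gx; have [x' Rx] := liftG x Gx; rewrite (R_Z _ _ (R_comm _ _ _ _ Ru Rx)).
  by apply: (iF_uZ fH); case: Rx.
- move=> x Gx; have [x' Rx] := liftG x Gx; rewrite (R_Z _ _ (R_comm _ _ _ _ Rv Rx)).
  by apply: (iF_vZ fH); case: Rx.
have [x' Hx' nZ] := iF_cZ fH; have [x Rx] := liftH x' Hx'.
by exists x; [case: Rx | rewrite (R_Z _ _ (R_comm _ _ _ _ Rc Rx))].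
Qed.

End FrameIsoclinic.

Section FrameInner.

Variables (p : nat) (p_pr : prime p) (p_odd : odd p) (gT : finGroupType).
Variable G : {group gT}.

Lemma comm_gen_center (a b x : gT) : G :=: <[a]> <*> <[b]> -> x \in G ->
  [~ x, a] \in 'Z(G) -> [~ x, b] \in 'Z(G) -> {in G, forall y, [~ x, y] \in 'Z(G)}.
Proof.
move=> defG Gx Za Zb y Gy.
have nZG : G \subset 'N('Z(G)) by apply: normal_norm; apply: center_normal.
have [Ga Gb] : a \in G /\ b \in G.
  by rewrite defG mem_joinr mem_joinl ?cycle_id.
have sub : <[a]> <*> <[b]> \subset centmod 'Z(G) x.
  rewrite join_subG !cycle_subG !centmodE ?(subsetP nZG) //=.
  by rewrite -invg_comm groupV Za -invg_comm groupV.
rewrite -defG in sub.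
have := subsetP sub y Gy; rewrite centmodE ?(subsetP nZG) // => /andP[_].
by rewrite -invg_comm groupV.
Qed.

Lemma quotient_gen2 (a b : gT) : G :=: <[a]> <*> <[b]> ->
  G / 'Z(G) = <[coset 'Z(G) a]> <*> <[coset 'Z(G) b]>.
Proof.
move=> defG; have nZG : G \subset 'N('Z(G)) by apply: normal_norm; apply: center_normal.
have [Ga Gb] : a \in G /\ b \in G.
  by rewrite defG mem_joinr mem_joinl ?cycle_id.
transitivity ((<[a]> <*> <[b]>) / 'Z(G)); first by rewrite -defG.
by rewrite quotientY ?cycle_subG ?(subsetP nZG) // !quotient_cycle ?(subsetP nZG).
Qed.

Lemma gen2_center (a b z : gT) : G :=: <[a]> <*> <[b]> -> z \in G ->
  commute z a -> commute z b -> z \in 'Z(G).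
Proof.
move=> defG Gz za zb; rewrite inE Gz; apply/centP=> x Gx.
have: x \in 'C[z]; last by move/cent1P/commute_sym.
apply: subsetP x Gx; rewrite defG join_subG !cycle_subG.
by apply/andP; split; apply/cent1P/commute_sym.
Qed.

(** The elements dual to a and a1 are a3 and a^p: [a3, a] = a4, while the collection formula
    together with the power relation of a2 gives [a^p, a1] = a4^(-k), nontrivial because p does not
    divide k. *)
Lemma A_inner_frame k e a a1 a2 a3 a4 : A_frame p k e a a1 a2 a3 a4 ->
    G :=: <[a]> <*> <[a1]> -> a4 != 1 -> ~~ (p %| k) ->
  inner_frame G a a1 a2 a3 (a ^+ p).
Proof.
move=> fA defG nz4 pk; case: (fA) => r1 r2 r3 r4 r5 r6 r7 r8 r9 r10 r11 r12 r13.
have Ga : a \in G by rewrite defG mem_joinl ?cycle_id.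
have G1 : a1 \in G by rewrite defG mem_joinr.
have G2 : a2 \in G by rewrite -r1 groupR.
have G3 : a3 \in G by rewrite -r2 groupR.
have G4 : a4 \in G by rewrite -r3 groupR.
have Z4 : a4 \in 'Z(G) by apply: (gen2_center defG) => //; apply: commute_sym.
have k1 (x y : gT) : commute x y -> [~ x, y] = 1 by move=> cxy; apply/eqP/commgP.
have cV (x y : gT) : commute x y -> commute x^-1 y^-1.
  by move=> cxy; apply/commute_sym/commuteV/commute_sym/commuteV.
have e31 : [~ a3, a1] = 1 by apply/k1/commute_sym.
have eaa : [~ a ^+ p, a] = 1.
  by apply/k1/commute_sym/commuteX/commute_refl.
have e1p : [~ a ^+ p, a1] = a4 ^- k.
  have e1 : [~ a, a1] = a2^-1 by rewrite -r1 invg_comm.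
  have e2 : [~ a2^-1, a] = a3^-1 by rewrite commVg_commute r2.
  have e3 : [~ a3^-1, a] = a4^-1 by rewrite commVg_commute r3.
  rewrite (commXg_bin p e1 e2 e3); try exact: cV.
    rewrite !expgVn; have [d def_d] := dvdnP (dvdn_bin2 p_pr p_odd).
    move: r13; rewrite def_d (expg_muln d r11) invg1 !mulg1 => <-.
    rewrite -invMg; congr (_^-1); apply/commute_sym/commuteX/commute_sym/commuteX.
    exact: commute_sym.
  by apply/commute_sym/commuteV/commute_sym.
have c4Va : commute a a4^-1 by apply/commuteV/commute_sym.
have ea3 : [~ a, a3] = a4^-1 by rewrite -r3 invg_comm.
have ea2 : [~ a, a2] = a3^-1 by rewrite -r2 invg_comm.
have e_ap3 : [~ a ^+ p, a3] = 1 by rewrite commXg ea3 // expgVn r12 invg1.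
have e_ap2 : [~ a ^+ p, a2] = 1.
  have e3 : [~ a3^-1, a] = a4^-1 by rewrite commVg_commute r3.
  have e4 : [~ a4^-1, a] = 1 by apply/k1/commute_sym.
  have [d def_d] := dvdnP (dvdn_bin2 p_pr p_odd).
  rewrite (commXg_bin p ea2 e3 e4) ?expg1n ?mulg1; try exact: commute1.
  - by rewrite !expgVn def_d expg_muln // r11 invg1 mulg1.
  - exact: cV.
  - exact/commute_sym/commute1.
have o4 : #[a4] = p by apply: nt_prime_order.
split=> //; rewrite ?groupX //.
- exact: quotient_gen2.
- by rewrite r3.
- by rewrite e1p invg_eq1 -order_dvdn o4.
- by rewrite -invg_comm e_ap3 invg1.
- exact: k1.
- by rewrite -invg_comm e_ap2 invg1.
- by apply: (comm_gen_center defG); rewrite // ?r3 // e31 group1.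
- by apply: (comm_gen_center defG); rewrite ?groupX // ?eaa ?group1 // e1p groupV groupX.
exists a => //; rewrite r2; apply: contra nz4 => /centerP[_ c3].
by rewrite -r3; apply/commgP/c3.
Qed.

(** The dual elements are c1 and c2, in this order for a diagonal Gram matrix and swapped for an
    antidiagonal one. *)
Lemma BC_inner_frame q m11 m12 m22 a b c c1 c2 z :
    BC_frame p q m11 m12 m22 a b c c1 c2 z ->
    G :=: <[a]> <*> <[b]> -> z != 1 -> BC_nondeg p m11 m12 m22 ->
  exists u v, inner_frame G a b c u v.
Proof.
move=> fB defG nz nd; have nd' := BC_nondeg_exp p_pr fB nz nd.
case: (fB) => r1 r2 r3 r4 r5 r6 r7 r8 r9 r10 r11 r12 r13 r14 r15 r16 r17 r18 r19.
have Ga : a \in G by rewrite defG mem_joinl ?cycle_id.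
have Gb : b \in G by rewrite defG mem_joinr.
have Gc : c \in G by rewrite -r1 groupR.
have G1 : c1 \in G by rewrite -r2 groupR.
have G2 : c2 \in G by rewrite -r3 groupR.
have cz m : z ^+ m \in G -> z ^+ m \in 'Z(G).
  by move=> Gm; apply: (gen2_center defG Gm); apply/commute_sym/commuteX/commute_sym.
have Z1a : [~ c1, a] \in 'Z(G) by rewrite r4 cz // -r4 groupR.
have Z1b : [~ c1, b] \in 'Z(G) by rewrite r5 cz // -r5 groupR.
have Z2a : [~ c2, a] \in 'Z(G) by rewrite r6 cz // -r6 groupR.
have Z2b : [~ c2, b] \in 'Z(G) by rewrite r7 cz // -r7 groupR.
have k1 (x y : gT) : commute x y -> [~ x, y] = 1 by move=> cxy; apply/eqP/commgP.
have nc1 : c1 \notin 'Z(G).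
  case: nd' => [[nz1 _ _] | [_ nz1 _]]; apply: contra nz1 => /centerP[_ c1Z].
    by rewrite -r5; apply/commgP/c1Z.
  by rewrite -r4; apply/commgP/c1Z.
have ZZ1 := comm_gen_center defG G1 Z1a Z1b; have ZZ2 := comm_gen_center defG G2 Z2a Z2b.
have gen := quotient_gen2 defG.
case: nd' => [] [n1 n2 n3].
  exists c2, c1; split=> //.
  - by rewrite r6.
  - by rewrite r7.
  - by rewrite r4.
  - by rewrite r5.
  - exact/k1/commute_sym.
  - exact: k1.
  - exact: k1.
  by exists a; rewrite // r2.
exists c1, c2; split=> //.
- by rewrite r4.
- by rewrite r5.
- by rewrite r6.
- by rewrite r7.
- exact: k1.
- exact: k1.
- exact: k1.
by exists a; rewrite // r2.
Qed.

End FrameInner.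

(** * Structure of the groups with only inner central automorphisms *)

Section InnerCentral.

Variables (gT : finGroupType) (G : {group gT}) (p : nat).
Hypotheses (p_pr : prime p) (p_odd : odd p) (pG : p.-group G).
Hypothesis AutZ : Aut_z G = 'Z(Inn G).

Lemma ucnP1 n y : reflect (y \in G /\ {in G, forall x, [~ y, x] \in 'Z_n(G)})
  (y \in 'Z_n.+1(G)).
Proof.
rewrite ucnSnR inE; apply: (iffP andP) => -[Gy yG]; split=> //.
  by move=> x Gx; apply: (subsetP yG); rewrite mem_commg ?set11.
by rewrite gen_subG; apply/subsetP=> _ /imset2P[w x /set1P-> Gx ->]; apply: yG.
Qed.

Lemma central_hom_auto (f : {morphism G >-> gT}) :
    f @* G \subset 'Z(G) -> {in G, forall x, f x = x^-1 -> x = 1} ->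
  exists2 y, y \in G & {in G, forall x, f x = [~ x, y]}.
Proof.
move=> sfZ f_inj.
have Zf x : x \in G -> f x \in 'Z(G).
  by move=> Gx; apply: (subsetP sfZ); rewrite mem_morphim.
have hM : {in G &, {morph (fun x => x * f x) : x y / x * y}}.
  move=> x y Gx Gy /=; rewrite morphM // -!mulgA; congr (_ * _).
  by rewrite !mulgA; congr (_ * _); case/centerP: (Zf x Gx) => _ ->.
pose h := Morphism hM.
have inj_h : 'injm h.
  apply/subsetP=> x /morphpreP[Gx /set1P/= hx1]; apply/set1P/f_inj => //.
  by apply: (mulgI x); rewrite hx1 mulgV.
have im_h : h @* G = G.
  apply/morphim_fixP=> //; apply/subsetP=> _ /morphimP[x _ Gx ->] /=.
  by rewrite groupM // (subsetP (center_sub G)) ?Zf.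
have : aut inj_h im_h \in Aut_z G.
  apply/Aut_zP; split=> [|x Gx]; first exact: Aut_aut.
  by rewrite autE //= mulKg Zf.
rewrite AutZ => /center_InnP[y Gy yE]; exists y => // x Gx.
by have [_] := yE x Gx; rewrite autE //= commgEl => <-; rewrite mulKg.
Qed.

Lemma comm_center1 z y : z \in 'Z(G) -> y \in G -> [~ z, y] = 1.
Proof. by case/centerP=> _ cz Gy; apply/eqP/commgP/cz. Qed.

(* If f inverts x0 <> 1, then x |-> (f x)^-1 inverts no nontrivial element: such an x
   would be a power of x0, or x0 of x, as both lie in the cyclic p-group <z>.  So f^-1
   is inner and vanishes at the central element x0, a contradiction. *)
Lemma central_hom_inner (f : {morphism G >-> gT}) z :
    z \in 'Z(G) -> f @* G \subset <[z]> ->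
  exists2 y, y \in G & {in G, forall x, f x = [~ x, y]}.
Proof.
move=> Zz sfz; have szZ : <[z]> \subset 'Z(G) by rewrite cycle_subG.
have sfZ := subset_trans sfz szZ.
have [/existsP[x0 /and3P[Gx0 nx0 /eqP fx0]]|] :=
  boolP [exists x, [&& x \in G, x != 1 & f x == x^-1]]; last first.
  rewrite negb_exists => /forallP noX; apply: central_hom_auto => // x Gx fx.
  by apply/eqP; have := noX x; rewrite Gx fx eqxx andbT negbK.
have fz x : x \in G -> f x \in <[z]>.
  by move=> Gx; apply: (subsetP sfz); rewrite mem_morphim.
have zx0 : x0 \in <[z]> by rewrite -groupV -fx0 fz.
have czz : abelian <[z]> := cycle_abelian z.
have hM : {in G &, {morph (fun x => (f x)^-1) : x y / x * y}}.
  move=> x y Gx Gy /=; rewrite morphM // invMg.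
  by apply: (centsP czz); rewrite groupV fz.
pose h := Morphism hM.
have sq1 x : x \in G -> x * x = 1 -> x = 1.
  move=> Gx xx; apply/eqP; rewrite -order_eq1.
  have o2 : #[x] %| 2 by rewrite order_dvdn expgS expg1 xx.
  have /p_natP[[|k] def_o] := mem_p_elt pG Gx; first by rewrite def_o.
  have: p %| 2 by apply: dvdn_trans o2; rewrite def_o expnS dvdn_mulr.
  by rewrite dvdn_prime2 // => /eqP p2; move: p_odd; rewrite p2.
have comp x y : x \in <[z]> -> y \in <[z]> -> (x \in <[y]>) || (y \in <[x]>).
  move=> zx zy; have [sx sy] : <[x]> \subset <[z]> /\ <[y]> \subset <[z]>.
    by rewrite !cycle_subG.
  have Gz := subsetP (center_sub G) z Zz.
  have pz w : w \in <[z]> -> p.-nat #|<[w]>|.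
    move=> zw; apply: (mem_p_elt pG); apply: (subsetP (_ : <[z]> \subset G)) => //.
    by rewrite cycle_subG.
  have cardS := cardSg_cyclic (cycle_cyclic z).
  rewrite -!cycle_subG -(cardS _ _ sx sy) -(cardS _ _ sy sx).
  have /p_natP[i ->] := pz x zx; have /p_natP[j ->] := pz y zy.
  by apply/orP; case/orP: (leq_total i j) => le_ij; [left | right]; apply: dvdn_exp2l.
have [y Gy yE] : exists2 y, y \in G & {in G, forall x, h x = [~ x, y]}.
  apply: central_hom_auto.
    apply/subsetP=> _ /morphimP[x _ Gx ->] /=.
    by rewrite groupV (subsetP sfZ) ?mem_morphim.
  move=> x Gx /= /invg_inj fx.
  have zx : x \in <[z]> by rewrite -fx fz.
  (* On the smaller of <x> and <x0> the map f is both the identity and inversion, so its generator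
     has square 1 and is trivial, p being odd. *)
  case/orP: (comp x x0 zx zx0) => /cycleP[i def_x].
    apply: sq1 => //; rewrite -{1}fx def_x morphX // fx0.
    by rewrite expgVn mulVg.
  case/eqP: nx0; apply: sq1 => //; rewrite {1}def_x -{1}fx -morphX // -def_x fx0 mulVg //.
have := yE x0 Gx0; rewrite /= fx0 invgK comm_center1 ?(subsetP szZ) // => x01.
by rewrite x01 eqxx in nx0.
Qed.

(** The composite G -> G/K -> <z> sending x0 to z has values in a cyclic central subgroup, hence is
    commutation with some y. *)
Lemma central_comm_exists (K : {group gT}) x0 z :
    K <| G -> x0 \in G -> G / K = <[coset K x0]> -> z \in 'Z(G) ->
    #[z] %| #[coset K x0] ->
  exists y, [/\ y \in G, {in G, forall x, [~ x, y] \in <[z]>}, K \subset 'C[y]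
    & [~ x0, y] = z].
Proof.
move=> /andP[sKG nKG] Gx0 defGK Zz o_z.
have cosG x : x \in G -> coset K x \in <[coset K x0]>.
  by move=> Gx; rewrite -defGK mem_quotient.
have fM : {in G &, {morph (fun x => eltm o_z (coset K x)) : x y / x * y}}.
  move=> x y Gx Gy /=; rewrite morphM ?(subsetP nKG) //.
  by rewrite (morphM (eltm_morphism o_z)) ?cosG.
have [|y Gy yE] := @central_hom_inner (Morphism fM) z Zz.
  apply/subsetP=> _ /morphimP[x _ Gx ->] /=.
  by rewrite -(im_eltm o_z) mem_morphim ?cosG.
exists y; split.
- by [].
- by move=> x Gx; rewrite -yE //= -(im_eltm o_z) mem_morphim ?cosG.
- apply/subsetP=> x Kx; have Gx := subsetP sKG x Kx.
  by apply/cent1P/commgP; rewrite -yE //= (coset_id Kx) morph1.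
by rewrite -yE //= eltm_id.
Qed.

End InnerCentral.

(** * Index bounds for pairings, upper central terms and the Frattini subgroup *)

Section PairingBound.

Variables (gT : finGroupType) (p : nat).
Implicit Types (A Y L M : {group gT}) (x y : gT).

Lemma index_subcent1 A M y : M \subset A -> #|M : 'C_M[y]| <= #|A : 'C_A[y]|.
Proof.
move=> sMA; rewrite !index_cent1; apply/subset_leq_card/subsetP=> _ /imsetP[x Mx ->].
by apply: imset_f; apply: (subsetP sMA).
Qed.

Lemma index_cent1_comm A L y :
  {in A, forall x, [~ y, x] \in L} -> #|A : 'C_A[y]| <= #|L|.
Proof.
move=> Lyx; rewrite index_cent1 -(card_lcoset L y).
apply/subset_leq_card/subsetP=> _ /imsetP[x Ax ->].
by rewrite mem_lcoset -commgEl Lyx.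
Qed.

(** Induction along a maximal subgroup M of Y containing L: adjoining y outside M multiplies |Y : L|
    by p and cuts C_A(M) down by an index at most |A : C_A(y)| <= p. *)
Lemma pairing_bound A Y L : p.-group Y -> L \subset Y -> L \subset 'C(A) ->
  {in Y, forall y, #|A : 'C_A[y]| <= p} -> #|A : 'C_A(Y)| <= #|Y : L|.
Proof.
move=> + + cLA; move: {2}_.+1 (ltnSn #|Y|) => n.
elim: n Y => // n IHn Y leYn pY sLY bY.
have [eqLY|[M maxM sLM]] := maximal_exists sLY.
  have -> : 'C_A(Y) = A by apply/setIidPl; rewrite -eqLY centsC.
  by rewrite indexgg eqLY indexgg.
have sMY := maxgroupp maxM; have [sMY' [y Yy nMy]] := properP sMY.
have iM := p_maximal_index pY maxM.
have ltM : #|M| < n by apply: leq_trans (proper_card sMY) _.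
have := IHn M ltM (pgroupS sMY' pY) sLM (sub_in1 (subsetP sMY') bY).
have defY : 'C_A(Y) = 'C_('C_A(M))[y].
  have defM : Y :=: M <*> <[y]>.
    apply/eqP; rewrite eq_sym eqEcard join_subG sMY' cycle_subG Yy.
    rewrite -(Lagrange sMY') iM card_proper_pgroup //.
      by apply: pgroupS pY; rewrite join_subG sMY' cycle_subG.
    rewrite properE joing_subl join_subG subxx cycle_subG.
    by rewrite andTb.
  by rewrite defM centY cent_cycle setIA.
have sC : 'C_A(Y) \subset 'C_A(M) by rewrite setIS ?centS.
rewrite -(Lagrange_index (subsetIl A 'C(M)) sC) -(Lagrange_index sMY' sLM) iM => le1.
rewrite mulnC leq_mul //.
apply: leq_trans (bY y Yy); have := index_subcent1 y (subsetIl A 'C(M)).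
by rewrite -defY.
Qed.

End PairingBound.

Section UpperCentral.

Variables (gT : finGroupType) (G : {group gT}) (p : nat).
Hypotheses (p_pr : prime p) (pG : p.-group G).

(** A group modulo its center is never nontrivially cyclic, here for G/Z_n: if x generates G over
    Z_{n+1}, then x commutes with G modulo Z_n. *)
Lemma ucn_join_cycle n x : x \in G -> 'Z_n.+1(G) <*> <[x]> = G -> x \in 'Z_n.+1(G).
Proof.
move=> Gx defG; have nZ := ucn_norm n G.
have sub : 'Z_n.+1(G) <*> <[x]> \subset centmod 'Z_n(G) x.
  rewrite join_subG cycle_subG; apply/andP; split.
    apply/subsetP=> y /ucnP1[Gy yE].
    by rewrite centmodE ?(subsetP nZ) //= yE.
  by rewrite centmodE ?(subsetP nZ) //= (eqP (introT commgP (commute_refl x))) group1.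
apply/ucnP1; split=> // y Gy; rewrite defG in sub.
have := subsetP sub y Gy; rewrite centmodE ?(subsetP nZ) // => /andP[_].
by rewrite -invg_comm groupV.
Qed.

Lemma ucn_index n : 'Z_n.+1(G) != G -> p ^ 2 <= #|G : 'Z_n.+1(G)|.
Proof.
move=> nZG; have sZG := ucn_sub n.+1 G.
have /p_natP[[|[|k]] def_i] : p.-nat #|G : 'Z_n.+1(G)|.
  by apply: pnat_dvd (dvdn_indexg _ _) pG.
- by case/eqP: nZG; apply/eqP; rewrite eqEsubset sZG -indexg_eq1 def_i.
- have ltZ : 'Z_n.+1(G) \proper G by rewrite properEneq nZG.
  have [_ [x Gx nZx]] := properP ltZ.
  case/negP: (nZx); apply: ucn_join_cycle => //; apply/eqP.
  rewrite eqEcard join_subG sZG cycle_subG Gx -(Lagrange sZG) def_i expn1.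
  apply: card_proper_pgroup; first by apply: pgroupS pG; rewrite join_subG sZG cycle_subG.
  by rewrite properE joing_subl join_subG subxx cycle_subG.
by rewrite def_i leq_exp2l // prime_gt1.
Qed.

End UpperCentral.

Section Frattini.

Variables (gT : finGroupType) (G : {group gT}) (p : nat).
Hypotheses (p_pr : prime p) (pG : p.-group G).

Lemma Phi_sub_of (L : {group gT}) :
  {in G, forall x, x ^+ p \in L} -> G^`(1) \subset L -> 'Phi(G) \subset L.
Proof.
move=> Lxp sG'L; rewrite (Phi_joing pG) join_subG sG'L (MhoE 1 pG) gen_subG /=.
by apply/subsetP=> _ /imsetP[x Gx ->]; rewrite Lxp.
Qed.

Lemma expp_Phi x : x \in G -> x ^+ p \in 'Phi(G).
Proof.
move=> Gx; rewrite (Phi_joing pG); apply: (subsetP (joing_subr _ _)).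
by rewrite (MhoE 1 pG) mem_gen //; apply/imsetP; exists x.
Qed.

Lemma der1_Phi : G^`(1) \subset 'Phi(G).
Proof. by rewrite (Phi_joing pG) joing_subl. Qed.

Lemma index_Phi : ~~ abelian G -> p ^ 2 <= #|G : 'Phi(G)|.
Proof.
move=> nabG; have nPhi := normal_norm (Phi_normal G).
have /p_natP[[|[|k]] def_i] : p.-nat #|G : 'Phi(G)|.
  by apply: pnat_dvd (dvdn_indexg _ _) pG.
- case/negP: nabG; apply/cyclic_abelian/Phi_quotient_cyclic.
  have -> : 'Phi(G) = G by apply/eqP; rewrite eqEsubset Phi_sub -indexg_eq1 def_i.
  by rewrite trivg_quotient cyclic1.
- case/negP: nabG; apply/cyclic_abelian/Phi_quotient_cyclic.
  by apply: prime_cyclic; rewrite card_quotient // def_i.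
by rewrite def_i leq_exp2l // prime_gt1.
Qed.

Lemma Phi_gen2 a b : #|G : 'Phi(G)| = (p ^ 2)%N -> a \in G -> b \in G ->
  a \notin 'Phi(G) -> b \notin 'Phi(G) <*> <[a]> -> G :=: <[a]> <*> <[b]>.
Proof.
move=> iG Ga Gb na nb; have nPhi := normal_norm (Phi_normal G).
have sJG : 'Phi(G) <*> <[a]> <*> <[b]> \subset G.
  by rewrite !join_subG Phi_sub !cycle_subG Ga.
have pJ := pgroupS sJG pG.
have lt1 : 'Phi(G) \proper 'Phi(G) <*> <[a]>.
  by rewrite properE joing_subl join_subG subxx cycle_subG.
have lt2 : 'Phi(G) <*> <[a]> \proper 'Phi(G) <*> <[a]> <*> <[b]>.
  by rewrite properE joing_subl join_subG subxx cycle_subG.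
have le2 := card_proper_pgroup pJ lt2.
have le1 := card_proper_pgroup (pgroupS (joing_subl _ _) pJ) lt1.
have defG : 'Phi(G) <*> <[a]> <*> <[b]> = G.
  apply/eqP; rewrite eqEcard sJG -(Lagrange (Phi_sub G)) iG expnS expn1 mulnA.
  by apply: leq_trans le2; rewrite leq_mul2r le1 orbT.
by rewrite -joingA in defG; rewrite -(Phi_nongen defG) genGid.
Qed.

Lemma Phi_gen2_exists a : #|G : 'Phi(G)| = (p ^ 2)%N -> a \in G ->
  a \notin 'Phi(G) -> exists2 b, b \in G & b \notin 'Phi(G) <*> <[a]>.
Proof.
move=> iG Ga na; have nPhi := normal_norm (Phi_normal G).
have := card_join_cycle p_pr (subsetP nPhi a Ga) (expp_Phi Ga) na => oJ.
have sJ : 'Phi(G) <*> <[a]> \subset G by rewrite join_subG Phi_sub cycle_subG.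
suff /properP[_ [b Gb nb]] : 'Phi(G) <*> <[a]> \proper G by exists b.
rewrite properEcard sJ /= oJ -(Lagrange (Phi_sub G)) iG ltn_pmul2l //.
by rewrite (ltn_exp2l 1) // prime_gt1.
Qed.

End Frattini.

(** * Exclusion of class 3 and the upper central series in class 4 *)

Section Structure.

Variables (gT : finGroupType) (G : {group gT}) (p : nat).
Hypotheses (p_pr : prime p) (p_odd : odd p) (oG : #|G| = (p ^ 6)%N).
Hypothesis AutZ : Aut_z G = 'Z(Inn G).
Hypothesis clG : nil_class G = 3 \/ nil_class G = 4.

Let pG : p.-group G.
Proof. by rewrite /pgroup oG pnatX pnat_id. Qed.

Let nilG : nilpotent G := pgroup_nil pG.

Let nabG : ~~ abelian G.
Proof. by rewrite -nil_class1; case: clG => ->. Qed.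

Let Zp z := z \in 'Z(G) /\ #[z] = p.

(** A cyclic subgroup of maximal order in the abelian group G/G' has a complement, and [K] is the
    preimage of this complement. As G/G' is not elementary abelian, the maximal order is at least
    p^2. *)
Lemma cyclic_quotient_exists : ~~ p.-abelem (G / G^`(1)) ->
  exists K : {group gT}, exists x0, [/\ K <| G, x0 \in G, G / K = <[coset K x0]>
    & p ^ 2 %| #[coset K x0]].
Proof.
move=> nabel; pose Q := (G / G^`(1))%G.
have abQ : abelian Q := der_abelian 0 G.
have pQ : p.-group Q := quotient_pgroup _ pG.
have [X QX expX] := exponent_witness (pgroup_nil pQ).
have /p_natP[e oX] := mem_p_elt pQ QX.
have e_ge2 : 2 <= e.
  rewrite ltnNge; apply: contra nabel => le_e1; rewrite abelemE // abQ expX oX /=.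
  by apply: (dvdn_exp2l p le_e1).
have /splitsP[K' /complP[tiK defQ]] := abelian_splits QX (esym expX) abQ.
have [x0 Nx0 Gx0 /= defX] := morphimP QX.
have nG' := subsetP (der_norm 1 G).
pose K := (coset G^`(1) @*^-1 K')%G.
have sK'Q : K' \subset Q by rewrite -defQ mulG_subr.
have sKG : K \subset G by rewrite -(quotientGK (der_normal 1 G)) morphpreS.
have nKG : K <| G by apply: sub_der1_normal => //; apply: sub_cosetpre.
have nK := subsetP (normal_norm nKG).
have defGK : G / K = <[coset K x0]>.
  apply/eqP; rewrite eqEsubset cycle_subG mem_quotient // andbT.
  apply/subsetP=> _ /morphimP[g _ Gg ->].
  have: coset G^`(1) g \in <[X]> * K' by rewrite defQ mem_quotient.
  case/mulsgP=> _ k /cycleP[i ->] K'k def_g.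
  have Kh : x0 ^- i * g \in K.
    rewrite inE /= groupM ?groupV ?groupX ?nG' //= inE.
    rewrite /= morphM ?groupV ?groupX ?nG' // morphV ?groupX ?nG' // morphX ?nG' //=.
    by rewrite def_g -defX mulKg.
  have Nh : x0 ^- i * g \in 'N(K) by rewrite nK ?groupM ?groupV ?groupX.
  rewrite -[g](mulKVg (x0 ^+ i)) (morphM (coset_morphism K) _ Nh) ?nK ?groupX //=.
  by rewrite (coset_id Kh) mulg1 morphX ?nK //= mem_cycle.
exists K, x0; split=> //.
have oQ : (#[X] * #|K'|)%N = #|Q| by rewrite -defQ TI_cardMg.
have oGK : #[coset K x0] = #[X].
  rewrite orderE -defGK card_quotient ?normal_norm //.
  apply/eqP; rewrite -(eqn_pmul2l (cardG_gt0 K)) Lagrange // card_cosetpre.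
  rewrite -mulnA [(#|K'| * _)%N]mulnC oQ card_quotient ?der_norm // Lagrange ?der_sub //.
by rewrite oGK oX dvdn_exp2l.
Qed.

Lemma exists_Zp : exists z, Zp z.
Proof.
have nZ : 'Z(G) != 1.
  apply/eqP=> Z1; case/negP: nabG.
  by rewrite (trivg_center_pgroup pG Z1) abelian1.
have pZ : p.-group 'Z(G) := pgroupS (center_sub G) pG.
have [_ pdvZ _] := pgroup_pdiv pZ nZ.
by have [z Zz oz] := Cauchy p_pr pdvZ; exists z.
Qed.

Lemma comm_Zp z : Zp z -> <[z]> <| G.
Proof.
case=> Zz _; rewrite /normal cycle_subG (subsetP (center_sub G)) //=.
rewrite cents_norm // centsC cycle_subG; apply/centP=> x Gx.
by case/centerP: Zz => _; apply.
Qed.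

Definition Wgroup z := (coset <[z]> @*^-1 'Z(G / <[z]>))%G.

Lemma WgroupP z y : Zp z ->
  reflect (y \in G /\ {in G, forall x, [~ y, x] \in <[z]>}) (y \in Wgroup z).
Proof.
move=> Zpz; have /andP[szG nzG] := comm_Zp Zpz.
have nz := subsetP nzG.
apply: (iffP morphpreP) => [[Ny /centerP[Gcy cy]] | [Gy yG]].
  have Gy : y \in G by rewrite -(quotientGK (comm_Zp Zpz)) mem_morphpre.
  split=> // x Gx; apply: coset_idr; first by rewrite groupR ?nz.
  by rewrite morphR ?nz //; apply/eqP/commgP/cy; rewrite mem_quotient.
split; first exact: nz; apply/centerP; split; first exact: mem_quotient.
move=> _ /morphimP[x Nx Gx ->]; apply/commgP.
by rewrite -morphR ?nz //= coset_id ?yG.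
Qed.

(** If x lay outside a maximal subgroup M, the homomorphism G -> G/M -> <z> sending x to z would be
    commutation with some y in W, so [x, y] = z although x centralizes W. *)
Lemma Wgroup_cent z : Zp z -> 'C_G(Wgroup z) \subset 'Phi(G).
Proof.
move=> Zpz; have [Zz oz] := Zpz.
apply/subsetP=> x /setIP[Gx cWx]; apply/bigcapP=> M; rewrite /maximal_eq => /orP[/eqP->|maxM] //.
apply/negPn/negP=> nMx.
have nMG := p_maximal_normal pG maxM; have iM := p_maximal_index pG maxM.
have oGM : #|G / M| = p by rewrite card_quotient ?normal_norm.
have nMx1 : coset M x != 1.
  by apply: contra nMx => /eqP/coset_idr->; rewrite ?(subsetP (normal_norm nMG)).
have defGM : G / M = <[coset M x]>.
  apply: nt_gen_prime; first by rewrite oGM.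
  by rewrite in_setD1 nMx1 mem_quotient.
have [|y [Gy yW _ xy]] := central_comm_exists p_pr p_odd pG AutZ nMG Gx defGM Zz.
  by rewrite oz orderE -defGM oGM.
have Wy : y \in Wgroup z.
  by apply/(WgroupP _ Zpz); split=> // w Gw; rewrite -invg_comm groupV yW.
have := centP cWx y Wy => /commgP; rewrite xy => /eqP z1.
by have := prime_gt1 p_pr; rewrite -oz z1 order1.
Qed.

Lemma center_sub_W z : Zp z -> 'Z(G) \subset Wgroup z.
Proof.
move=> Zpz; apply/subsetP=> y Zy; apply/(WgroupP _ Zpz).
split=> [|x Gx]; first exact: (subsetP (center_sub G)).
by rewrite (@comm_center1 _ G) ?group1.
Qed.

Lemma W_sub_Z2 z : Zp z -> Wgroup z \subset 'Z_2(G).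
Proof.
move=> Zpz; apply/subsetP=> y /(WgroupP _ Zpz)[Gy yG]; apply/ucnP1; split=> // x Gx.
rewrite ucn1; apply: subsetP (yG x Gx); rewrite cycle_subG.
by case: Zpz.
Qed.

Lemma index_cent_W z : Zp z -> p ^ 2 <= #|G : 'C_G(Wgroup z)| <= #|Wgroup z : 'Z(G)|.
Proof.
move=> Zpz; have [Zz oz] := Zpz; apply/andP; split.
  apply: leq_trans (index_Phi p_pr pG nabG) _.
  by rewrite dvdn_leq // indexgS // Wgroup_cent.
apply: (@pairing_bound _ p G (Wgroup z) 'Z(G)%G).
- by apply: pgroupS pG; apply/subsetP=> y /(WgroupP _ Zpz)[].
- exact: center_sub_W.
- by rewrite subIset // subxx orbT.
move=> y /(WgroupP _ Zpz)[Gy yG]; rewrite -oz.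
exact: (@index_cent1_comm _ G <[z]>%G).
Qed.

Let cl_gt2 : 'Z_2(G) != G.
Proof.
by apply/eqP=> /(ucn_nil_classP 2 nilG); case: clG => ->.
Qed.

Let pS (A : {group gT}) : A \subset G -> p.-group A.
Proof. by move=> sA; apply: pgroupS pG. Qed.

Let pI (A B : {group gT}) : A \subset G -> exists k, #|A : B| = (p ^ k)%N.
Proof.
move=> sA; have /p_natP[k def_k] : p.-nat #|A : B|.
  by apply: pnat_dvd (dvdn_indexg A B) (pS sA).
by exists k.
Qed.

(** The successive indices of the upper central series are p^k1, ..., p^k4 with k1 >= 1, k2 >= 2
    from the pairing, k3 >= 1, and k4 >= 2 because the top factor is not cyclic. Their sum is 6, so
    every bound is attained. *)
Lemma structure_class4 : nil_class G = 4 ->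
  [/\ #|'Z(G)| = p, #|'Z_2(G)| = (p ^ 3)%N, #|'Z_3(G)| = (p ^ 4)%N,
      'Phi(G) = 'Z_3(G) & 'C_G('Z_2(G)) = 'Phi(G)].
Proof.
move=> cl4; have [z Zpz] := exists_Zp; have [Zz oz] := Zpz.
have p_gt1 := prime_gt1 p_pr.
have Z3G : 'Z_3(G) != G by apply/eqP=> /(ucn_nil_classP 3 nilG); rewrite cl4.
have Z4G : 'Z_4(G) = G by apply/(ucn_nil_classP 4 nilG); rewrite cl4.
have Z23 : 'Z_2(G) \proper 'Z_3(G).
  rewrite properEneq ucn_subS andbT; apply: contra Z3G => /eqP e23.
  have : 'Z_4(G) = 'Z_3(G).
    by apply/setP=> y; apply/ucnP1/ucnP1; rewrite e23.
  by move=> e34; rewrite -e34; apply/eqP.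
have s12 : 'Z(G) \subset 'Z_2(G) by rewrite -ucn1 ucn_subS.
have [k1 e1] : exists k, #|'Z(G)| = (p ^ k)%N.
  by have /p_natP[k ->] := pS (center_sub G); exists k.
have [k2 e2] := pI 'Z(G) (ucn_sub 2 G).
have [k3 e3] := pI 'Z_2(G) (ucn_sub 3 G).
have [k4 e4] := pI 'Z_3(G) (subxx G).
have sum6 : (k1 + k2 + k3 + k4 = 6)%N.
  apply/eqP; rewrite -(eqn_exp2l _ _ p_gt1) -oG -(Lagrange (ucn_sub 3 G)).
  by rewrite -(Lagrange (proper_sub Z23)) -(Lagrange s12) e1 e2 e3 e4 !expnD.
have k1_gt0 : 0 < k1.
  rewrite lt0n; apply/eqP=> k0; move: e1; rewrite k0 => /eqP/eqP/card1_trivg Z1.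
  move: oz; rewrite Z1 in Zz; move/set1gP: Zz => ->; rewrite order1 => p1.
  by rewrite -p1 in p_gt1.
have /andP[iW1 iW2] := index_cent_W Zpz.
have iWZ : #|Wgroup z : 'Z(G)| <= #|'Z_2(G) : 'Z(G)|.
  by rewrite dvdn_leq // indexSg ?center_sub_W ?W_sub_Z2.
have k2_ge2 : 2 <= k2.
  by rewrite -(leq_exp2l _ _ p_gt1) -e2 (leq_trans iW1) // (leq_trans iW2).
have k3_gt0 : 0 < k3.
  rewrite -(ltn_exp2l _ _ p_gt1) -e3 indexg_gt1; exact: proper_subn.
have k4_ge2 : 2 <= k4.
  by rewrite -(leq_exp2l _ _ p_gt1) -e4 ucn_index.
have [h1 h2 h3 h4] : [/\ k1 = 1%N, k2 = 2, k3 = 1%N & k4 = 2].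
  by move: sum6 k1_gt0 k2_ge2 k3_gt0 k4_ge2; clear; split; lia.
have o1 : #|'Z(G)| = p by rewrite e1 h1 expn1.
have o2 : #|'Z_2(G)| = (p ^ 3)%N by rewrite -(Lagrange s12) e1 e2 h1 h2 -expnD.
have o3 : #|'Z_3(G)| = (p ^ 4)%N by rewrite -(Lagrange (proper_sub Z23)) o2 e3 h3 -expnD.
have sZW := center_sub_W Zpz; have sW2 := W_sub_Z2 Zpz.
have iW : #|Wgroup z : 'Z(G)| = (p ^ 2)%N.
  by apply/eqP; rewrite eqn_leq (leq_trans iW1) // (leq_trans iWZ) // e2 h2.
have defW : Wgroup z = 'Z_2(G) :> {set gT}.
  apply/eqP; rewrite eqEcard sW2 -(Lagrange s12) e2 h2 -(Lagrange sZW).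
  by rewrite leq_mul2l iW leqnn orbT.
have iC : #|G : 'C_G('Z_2(G))| = (p ^ 2)%N.
  by rewrite -defW; apply/eqP; rewrite eqn_leq iW1 andbT -iW.
have defC : 'C_G('Z_2(G)) = 'Phi(G).
  apply/eqP; rewrite eqEcard -{1}defW Wgroup_cent //=.
  rewrite -(leq_pmul2r (_ : 0 < p ^ 2)) ?expn_gt0 ?prime_gt0 //.
  rewrite -{2}iC Lagrange ?subsetIl // -(Lagrange (Phi_sub G)) leq_mul2l.
  by rewrite (index_Phi p_pr pG nabG) orbT.
have oPhi : #|'Phi(G)| = (p ^ 4)%N.
  apply/eqP; rewrite -(eqn_pmul2r (_ : 0 < p ^ 2)) ?expn_gt0 ?prime_gt0 //.
  by rewrite -{1}iC -defC Lagrange ?subsetIl // oG -expnD.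
split=> //; apply/eqP; rewrite eqEcard o3 oPhi leqnn andbT.
apply: (Phi_sub_of pG) => [x Gx|]; last first.
  rewrite gen_subG; apply/subsetP=> _ /imset2P[x y Gx Gy ->].
  by have /ucnP1[_ ->] : x \in 'Z_4(G) by rewrite Z4G.
(* Otherwise x would have order p^2 modulo Z_3 and generate G/Z_3. *)
apply/negPn/negP=> nx; have nx1 : x \notin 'Z_3(G) by apply: contra nx; apply: groupX.
have nZ3 := subsetP (ucn_norm 3 G).
case/negP: (nx1); apply: ucn_join_cycle => //; apply/eqP.
have sJ : 'Z_3(G) <*> <[x]> \subset G by rewrite join_subG ucn_sub cycle_subG.
rewrite eqEcard sJ card_join_cycle_order ?nZ3 // o3 oG (expnD p 4 2) leq_mul2l.
have iQ : #|G / 'Z_3(G)| = (p ^ 2)%N by rewrite card_quotient ?ucn_norm // e4 h4.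
have ox : #[coset 'Z_3(G) x] %| p ^ 2.
  by rewrite -[(p ^ 2)%N]iQ; apply: order_dvdG; apply: mem_quotient.
have [[|[|k]] le_k ok] := dvdn_pfactor _ 2 p_pr ox.
- case/negP: nx1; apply: coset_idr; first exact: nZ3.
  by apply/eqP; rewrite -order_eq1 ok.
- case/negP: nx; apply: coset_idr; first by apply: nZ3; apply: groupX.
  by apply/eqP; rewrite morphX ?nZ3 // -order_dvdn ok expn1.
by rewrite ok leq_exp2l ?orbT.
Qed.

(** The successive indices of the upper central series are at least p, p^2, p^2 with product p^6.
    This leaves |Z| = p or |Z| = |Z_2 : Z| = p^2, and in both cases W = Z_2 for every central z of
    order p. *)
Lemma no_class3 : nil_class G <> 3.
Proof.
move=> cl3; have [z Zpz] := exists_Zp; have [Zz oz] := Zpz.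
have p_gt1 := prime_gt1 p_pr; have p_gt0 := prime_gt0 p_pr.
have Z3G : 'Z_3(G) = G by apply/(ucn_nil_classP 3 nilG); rewrite cl3.
have s12 : 'Z(G) \subset 'Z_2(G) by rewrite -ucn1 ucn_subS.
have comm2 x y : x \in G -> y \in G -> [~ x, y] \in 'Z_2(G).
  by move=> Gx Gy; have /ucnP1[_ ->] : x \in 'Z_3(G) by rewrite Z3G.
have [k1 e1] : exists k, #|'Z(G)| = (p ^ k)%N.
  by have /p_natP[k ->] := pS (center_sub G); exists k.
have [k2 e2] := pI 'Z(G) (ucn_sub 2 G).
have [k3 e3] := pI 'Z_2(G) (subxx G).
have sum6 : (k1 + k2 + k3 = 6)%N.
  apply/eqP; rewrite -(eqn_exp2l _ _ p_gt1) -oG -(Lagrange (ucn_sub 2 G)).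
  by rewrite -(Lagrange s12) e1 e2 e3 !expnD.
have k1_gt0 : 0 < k1.
  rewrite lt0n; apply/eqP=> k0; move: e1; rewrite k0 => /eqP/eqP/card1_trivg Z1.
  move: oz; rewrite Z1 in Zz; move/set1gP: Zz => ->; rewrite order1 => p1.
  by rewrite -p1 in p_gt1.
have /andP[iW1 iW2] := index_cent_W Zpz.
have iWZ : #|Wgroup z : 'Z(G)| <= #|'Z_2(G) : 'Z(G)|.
  by rewrite dvdn_leq // indexSg ?center_sub_W ?W_sub_Z2.
have iWZ' : #|Wgroup z : 'Z(G)| <= p ^ k2 by rewrite -e2.
have k2_ge2 : 2 <= k2.
  by rewrite -(leq_exp2l _ _ p_gt1) -e2 (leq_trans iW1) // (leq_trans iW2).
have k3_ge2 : 2 <= k3 by rewrite -(leq_exp2l _ _ p_gt1) -e3 ucn_index.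
have o2 : #|'Z_2(G)| = (p ^ (k1 + k2))%N by rewrite -(Lagrange s12) e1 e2 expnD.
have WZ2 w : Zp w -> #|'Z(G)| = p \/ k2 = 2 -> Wgroup w = 'Z_2(G) :> {set gT}.
  move=> Zpw hyp; apply/eqP; rewrite eqEsubset W_sub_Z2 //=.
  case: hyp => [o1 | k22].
    apply/subsetP=> y /ucnP1[Gy yE]; apply/(WgroupP _ Zpw); split=> // x Gx.
    have [Zw ow] := Zpw; suff -> : <[w]> = 'Z(G) by rewrite -ucn1 yE.
    by apply/eqP; rewrite eqEcard cycle_subG Zw o1 -ow leqnn.
  have /andP[iw1 iw2] := index_cent_W Zpw; have sZW := center_sub_W Zpw.
  have : #|'Z_2(G)| <= #|Wgroup w|.
    by rewrite -(Lagrange s12) -(Lagrange sZW) leq_mul2l e2 k22 (leq_trans iw1) ?orbT.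
  by move=> le; have /eqP-> : Wgroup w == 'Z_2(G) :> {set gT} by rewrite eqEcard W_sub_Z2.
have hyp : #|'Z(G)| = p \/ k2 = 2.
  have : k1 = 1%N \/ k2 = 2 by move: sum6 k1_gt0 k2_ge2 k3_ge2; clear; lia.
  by case=> [k11 | ->]; [left; rewrite e1 k11 expn1 | right].
have defW := WZ2 z Zpz hyp.
have Z2z y x : y \in 'Z_2(G) -> x \in G -> [~ y, x] \in <[z]>.
  by rewrite -defW => /(WgroupP _ Zpz)[_ yE]; apply: yE.
have zc u x : u \in <[z]> -> x \in G -> commute x u.
  move=> zu Gx; apply/commute_sym/commgP; rewrite (@comm_center1 _ G) //.
  by apply: subsetP zu; rewrite cycle_subG.
have zp u : u \in <[z]> -> u ^+ p = 1.
  by case/cycleP=> i ->; rewrite -expgM mulnC expgM -oz expg_order expg1n.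
have G2 := subsetP (ucn_sub 2 G).
have Z2p y : y \in 'Z_2(G) -> y ^+ p \in 'Z(G).
  move=> Z2y; have Gy := G2 y Z2y; rewrite -ucn1; apply/ucnP1; split; first exact: groupX.
  move=> x Gx; rewrite ucn0; apply/set1P.
  by rewrite commXg ?zp ?Z2z //; apply: zc => //; apply: Z2z.
have commp x y : x \in G -> y \in G ->
    [~ x ^+ p, y] = [~ x, y] ^+ p * [~ x, y, x] ^+ 'C(p, 2).
  move=> Gx Gy; have Z2c := comm2 x y Gx Gy; have zcx := Z2z _ x Z2c Gx.
  have e0 : [~ [~ x, y, x], x] = 1 by apply/eqP/commgP/commute_sym/zc.
  rewrite (commXg_bin p (erefl _) (erefl _) e0) ?expg1n ?mulg1 //; try exact: commute1.
    by apply: zc => //; apply: G2.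
  by apply/commute_sym/commute1.
have sPhi2 : 'Phi(G) \subset 'Z_2(G).
  apply: (Phi_sub_of pG) => [x Gx|]; last first.
    by rewrite gen_subG; apply/subsetP=> _ /imset2P[x y Gx Gy ->]; apply: comm2.
  apply/ucnP1; split=> [|y Gy]; first exact: groupX.
  rewrite ucn1 commp // groupM ?Z2p ?comm2 // groupX //.
  apply: subsetP (Z2z _ x (comm2 x y Gx Gy) Gx); by rewrite cycle_subG.
have sCPhi : 'C_G('Z_2(G)) \subset 'Phi(G) by rewrite -defW Wgroup_cent.
have iC : #|G : 'C_G('Z_2(G))| <= p ^ k2.
  by apply: leq_trans iWZ'; move: iW2; rewrite defW.
(* If |Z| = p^2 then Z is cyclic, and G / G' has a cyclic quotient of order p^2; a
   homomorphism onto Z is not of the form x |-> [x, y], as y would lie in Z_2. *)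
have [k11 | k1_gt1] := leqP k1 1; last first.
  have [k12 k22 k32] : [/\ k1 = 2, k2 = 2 & k3 = 2].
    by move: sum6 k1_gt1 k2_ge2 k3_ge2; clear; split; lia.
  have iPhi : #|G : 'Phi(G)| = (p ^ 2)%N.
    apply/eqP; rewrite eqn_leq (index_Phi p_pr pG nabG) andbT -k22.
    by apply: leq_trans iC; rewrite dvdn_leq // indexgS.
  have oPhi : #|'Phi(G)| = (p ^ 4)%N.
    apply/eqP; rewrite -(eqn_pmul2r (_ : 0 < p ^ 2)) ?expn_gt0 ?p_gt0 //.
    by rewrite -{1}iPhi Lagrange ?Phi_sub // oG -expnD.
  have defPhi : 'Phi(G) = 'Z_2(G).
    by apply/eqP; rewrite eqEcard sPhi2 o2 k12 k22 oPhi leqnn.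
  (* G' lies in <z, c> with c^p in <z>. Being this small it cannot contain Phi(G), so G/G' is not
     elementary abelian. *)
  have sG' : #|G^`(1)| <= p ^ 2.
    have [a Ga na] : exists2 a, a \in G & a \notin 'Phi(G).
      have /properP[_ [a Ga na]] : 'Phi(G) \proper G; last by exists a.
      by rewrite properEcard Phi_sub oPhi oG ltn_exp2l.
    have [b Gb nb] := Phi_gen2_exists p_pr pG iPhi Ga na.
    have defG := Phi_gen2 pG iPhi Ga Gb na nb.
    have Z2c := comm2 a b Ga Gb; set c := [~ a, b] in Z2c.
    have zca := Z2z _ a Z2c Ga; have zcb := Z2z _ b Z2c Gb.
    have zcp : c ^+ p \in <[z]>.
      have : [~ a ^+ p, b] \in <[z]> by apply: Z2z; rewrite // -defPhi (expp_Phi pG).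
      by rewrite commp // groupMr // groupX.
    have nz := subsetP (normal_norm (comm_Zp Zpz)).
    apply: (@leq_trans #|<[z]> <*> <[c]>|).
      rewrite defG; apply/subset_leq_card/der1_gen2; last exact: mem_joinr.
        by apply: norm_join_cycle; rewrite ?nz.
      by apply: norm_join_cycle; rewrite ?nz.
    apply: leq_trans (card_join_cycle_le p_gt0 _ zcp) _; first by rewrite nz // groupR.
    by rewrite -[#|<[z]>|]/#[z] oz expnS expn1.
  have nabel : ~~ p.-abelem (G / G^`(1)).
    apply/negP=> /(Phi_min pG (der_norm 1 G)) /subset_leq_card.
    rewrite oPhi leqNgt; case/negP; apply: leq_ltn_trans sG' _.
    by rewrite ltn_exp2l.
  have [w Zw nw] : exists2 w, w \in 'Z(G) & w \notin <[z]>.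
    apply/subsetPn; apply/negP=> /subset_leq_card.
    by rewrite -[#|<[z]>|]/#[z] oz e1 k12 leqNgt (ltn_exp2l 1).
  have Gw := subsetP (center_sub G) w Zw.
  have : #[w] %| p ^ 2 by rewrite -k12 -e1 order_dvdG.
  case/(dvdn_pfactor _ 2 p_pr) => [[|[|[|//]]]] _ ow.
  - by case/negP: nw; have /eqP := ow; rewrite order_eq1 => /eqP->.
  (* Taking W for w and for z gives Z_2 both times, so [Z_2, G] lies in the intersection of <w> and
     <z>, which is trivial; Z_2 would be central. *)
  - have Zpw : Zp w by split.
    have : #|'Z_2(G)| <= #|'Z(G)|; last by rewrite o2 e1 k12 k22 leq_exp2l.
    apply/subset_leq_card/subsetP=> y Z2y; rewrite -ucn1; apply/ucnP1.
    split=> [|x Gx]; first exact: G2.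
    have : [~ y, x] \in <[w]> :&: <[z]>.
      rewrite inE Z2z // andbT.
      by have := Z2y; rewrite -(WZ2 w Zpw hyp) => /(WgroupP _ Zpw)[_]; apply.
    rewrite prime_TIg -?[#|<[w]>|]/#[w] ?ow ?expn1 ?cycle_subG ?ucn0 //.
  have [K [x0 [nKG Gx0 defGK ox0]]] := cyclic_quotient_exists nabel.
  have o_w : #[w] %| #[coset K x0] by rewrite ow.
  have [y [Gy yw _ xy]] := central_comm_exists p_pr p_odd pG AutZ nKG Gx0 defGK Zw o_w.
  case/negP: nw; rewrite -xy -invg_comm groupV; apply: Z2z => //.
  apply/ucnP1; split=> // x Gx; rewrite ucn1 -invg_comm groupV.
  by apply: subsetP (yw x Gx); rewrite cycle_subG.
(* If |Z| = p then Phi(G) = Z_2 is its own centralizer, and the pairing of Z_2 / Z with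
   G / Z_2 bounds the order of Z_2. *)
have k1_1 : k1 = 1%N by apply/eqP; rewrite eqn_leq k11.
have o1 : #|'Z(G)| = p by rewrite e1 k1_1 expn1.
have cP : 'C_G('Z_2(G)) \subset 'Z_2(G) := subset_trans sCPhi sPhi2.
have [j1 ej] : exists j, #|'C_G('Z_2(G))| = (p ^ j)%N.
  by have /p_natP[j ->] := pS (subsetIl G 'C('Z_2(G))); exists j.
have le_j : j1 <= k1 + k2 by rewrite -(leq_exp2l _ _ p_gt1) -ej -o2 subset_leq_card.
have ge_j : 6 <= j1 + k2.
  rewrite -(leq_exp2l _ _ p_gt1) -oG expnD -ej -(Lagrange (subsetIl G 'C('Z_2(G)))).
  by rewrite leq_mul2l iC orbT.
have [k23 j34] : k2 = 3 /\ (j1 = 3 \/ j1 = 4).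
  by move: sum6 k1_1 k2_ge2 k3_ge2 le_j ge_j; clear; lia.
have {}o2 : #|'Z_2(G)| = (p ^ 4)%N by rewrite o2 k1_1 k23.
case: j34 => j_eq; rewrite j_eq in ej.
  (* A center of index p in Z_2 would make Z_2 abelian. *)
  have [y Z2y ny] : exists2 y, y \in 'Z_2(G) & y \notin 'C_G('Z_2(G)).
    apply/subsetPn; apply/negP=> /subset_leq_card.
    by rewrite ej o2 leqNgt ltn_exp2l.
  have sJ : 'C_G('Z_2(G)) <*> <[y]> \subset 'Z_2(G) by rewrite join_subG cP cycle_subG.
  have pJ := pS (subset_trans sJ (ucn_sub 2 G)).
  have ltJ : 'C_G('Z_2(G)) \proper 'C_G('Z_2(G)) <*> <[y]>.
    by rewrite properE joing_subl join_subG subxx cycle_subG.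
  have defZ2 : 'C_G('Z_2(G)) <*> <[y]> = 'Z_2(G).
    apply/eqP; rewrite eqEcard sJ o2 (leq_trans _ (card_proper_pgroup pJ ltJ)) //.
    by rewrite ej -expnSr.
  case/negP: ny; rewrite inE G2 //=; apply/centP=> u Z2u.
  have: u \in 'C[y]; last by move/cent1P/commute_sym.
  apply: subsetP Z2u; rewrite -defZ2 join_subG cycle_subG; apply/andP; split.
    apply/subsetP=> v /setIP[_ /centP cv]; apply/cent1P.
    by apply: cv.
  by apply/cent1P; apply: commute_refl.
have defC : 'C_G('Z_2(G)) = 'Z_2(G) by apply/eqP; rewrite eqEcard cP ej o2 leqnn.
have defPhi : 'Phi(G) = 'Z_2(G).
  by apply/eqP; rewrite eqEsubset sPhi2 /=; move: sCPhi; rewrite defC.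
suff: #|'Z_2(G) : 'C_('Z_2(G))(G)| <= #|G : 'Phi(G)|; last first.
  apply: (@pairing_bound _ p 'Z_2(G)%G G 'Phi(G)%G pG (Phi_sub G)).
    by rewrite /= defPhi -{1}defC subsetIr.
  move=> x Gx; rewrite -o1; apply: (@index_cent1_comm _ 'Z_2(G)%G 'Z(G)%G) => y Z2y.
  rewrite -invg_comm groupV; apply: subsetP (Z2z y x Z2y Gx).
  by rewrite cycle_subG.
have sC1 : 'C_('Z_2(G))(G) \subset 'Z(G).
  by rewrite subsetI subIset ?ucn_sub //= subsetIr.
have iPhi : #|G : 'Phi(G)| = (p ^ 2)%N.
  apply/eqP; rewrite -(eqn_pmul2l (cardG_gt0 'Phi(G))) Lagrange ?Phi_sub //.
  by rewrite /= defPhi o2 oG -expnD.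
rewrite /= iPhi leqNgt => /negP[]; apply: (@leq_trans #|'Z_2(G) : 'Z(G)|).
  by rewrite e2 k23 ltn_exp2l.
by rewrite dvdn_leq // indexgS.
Qed.

End Structure.

(** * Normal forms in class 4 *)

Section Class4.

Variables (gT : finGroupType) (G : {group gT}) (p : nat).
Hypotheses (p_pr : prime p) (p_odd : odd p) (oG : #|G| = (p ^ 6)%N).
Hypotheses (oZ : #|'Z(G)| = p) (o2 : #|'Z_2(G)| = (p ^ 3)%N).
Hypotheses (o3 : #|'Z_3(G)| = (p ^ 4)%N) (defPhi : 'Phi(G) = 'Z_3(G)).
Hypothesis defC : 'C_G('Z_2(G)) = 'Phi(G).
Implicit Types (m u x y : gT).

Let pG : p.-group G.
Proof. by rewrite /pgroup oG pnatX pnat_id. Qed.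

Let p_gt1 : 1 < p := prime_gt1 p_pr.
Let p_gt0 : 0 < p := prime_gt0 p_pr.

Let s23 : 'Z_2(G) \subset 'Phi(G).
Proof. by rewrite defPhi ucn_subS. Qed.

Let s12 : 'Z(G) \subset 'Z_2(G).
Proof. by rewrite -ucn1 ucn_subS. Qed.

Let GZ z : z \in 'Z(G) -> z \in G. Proof. exact: (subsetP (center_sub G)). Qed.
Let GM m : m \in 'Phi(G) -> m \in G. Proof. exact: (subsetP (Phi_sub G)). Qed.
Let G2 u : u \in 'Z_2(G) -> u \in G. Proof. exact: (subsetP (ucn_sub 2 G)). Qed.
Let M2 u : u \in 'Z_2(G) -> u \in 'Phi(G). Proof. exact: (subsetP s23). Qed.
Let Z2Z z : z \in 'Z(G) -> z \in 'Z_2(G). Proof. exact: (subsetP s12). Qed.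

Let expn_bin2 (w : gT) : w ^+ p = 1 -> w ^+ 'C(p, 2) = 1.
Proof. by move=> wp; have /dvdnP[d ->] := dvdn_bin2 p_pr p_odd; rewrite expg_muln. Qed.

Let Zc (z x : gT) : z \in 'Z(G) -> x \in G -> commute z x.
Proof. by case/centerP=> _; apply. Qed.

(** Z_2 is central in Phi(G) = C_G(Z_2) and has index p there. *)
Lemma abelian_Phi : abelian 'Phi(G).
Proof.
have sZ : 'Z_2(G) \subset 'Z('Phi(G)).
  by rewrite subsetI s23 centsC -defC subsetIr.
apply: (cyclic_factor_abelian sZ); apply: prime_cyclic.
rewrite card_quotient; last exact: subset_trans (Phi_sub G) (ucn_norm 2 G).
suff -> : #|'Phi(G) : 'Z_2(G)| = p by [].
apply/eqP; rewrite -(eqn_pmul2l (cardG_gt0 'Z_2(G))) Lagrange //= o2 defPhi o3.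
by rewrite -expnSr.
Qed.

Lemma Phi_commute : {in 'Phi(G) &, forall m m', commute m m'}.
Proof. by move=> m m' Mm Mm'; apply: (centsP abelian_Phi). Qed.

Lemma comm_Phi x y : x \in G -> y \in G -> [~ x, y] \in 'Phi(G).
Proof. by move=> Gx Gy; apply: (subsetP (der1_Phi pG)); apply: mem_commg. Qed.

Lemma commM_Z2 m x : m \in 'Phi(G) -> x \in G -> [~ m, x] \in 'Z_2(G).
Proof. by rewrite defPhi => /ucnP1[_ mE] /mE. Qed.

Lemma comm2_Z u x : u \in 'Z_2(G) -> x \in G -> [~ u, x] \in 'Z(G).
Proof. by case/ucnP1=> _ uE /uE; rewrite ucn1. Qed.

Lemma exp_Z z : z \in 'Z(G) -> z ^+ p = 1.
Proof. by move=> Zz; apply/eqP; rewrite -order_dvdn -oZ order_dvdG. Qed.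

(* m ^ (x * y) = m ^ (y * x), because [x, y] lies in the abelian group Phi(G). *)
Lemma commPhi_sym m x y : m \in 'Phi(G) -> x \in G -> y \in G ->
  [~ m, x, y] = [~ m, y, x].
Proof.
move=> Mm Gx Gy; have Mx w : w \in G -> [~ m, w] \in 'Phi(G).
  by move=> Gw; rewrite M2 ?commM_Z2.
have conjE w v : w \in G -> v \in G -> m ^ (w * v) = m * [~ m, v] * [~ m, w] * [~ m, w, v].
  by move=> Gw Gv; rewrite conjgM [m ^ w]conjg_mulR conjMg !conjg_mulR !mulgA.
have : m ^ (x * y) = m ^ (y * x).
  rewrite (commgC x y) conjgM; apply/conjg_fixP/commgP.
  by apply: Phi_commute; rewrite ?comm_Phi // memJ_norm ?groupM ?(subsetP (gFnorm _ _)) ?groupM.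
by rewrite !conjE // -!(mulgA m) (Phi_commute (Mx x Gx) (Mx y Gy)) => /mulgI/mulgI.
Qed.

Lemma commPhiM m m' x : x \in G -> m \in 'Phi(G) -> m' \in 'Phi(G) ->
  [~ m * m', x] = [~ m, x] * [~ m', x].
Proof.
move=> Gx Mm Mm'; apply: commMg_commute; apply: Phi_commute => //.
by rewrite M2 ?commM_Z2.
Qed.

Lemma commPhiX x m n : x \in G -> m \in 'Phi(G) -> [~ m ^+ n, x] = [~ m, x] ^+ n.
Proof.
move=> Gx Mm; elim: n => [|n IHn]; first by rewrite comm1g.
by rewrite !expgS commPhiM ?groupX // IHn.
Qed.

Lemma comm2M u x y : u \in 'Z_2(G) -> x \in G -> y \in G ->
  [~ u, x * y] = [~ u, x] * [~ u, y].
Proof.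
move=> Zu Gx Gy; have Zux := comm2_Z Zu Gx.
rewrite commgMJ (conjg_fixP _); last exact/commgP/Zc.
by apply/commute_sym/Zc => //; rewrite groupR ?(G2 Zu).
Qed.

Lemma comm2X u x n : u \in 'Z_2(G) -> x \in G -> [~ u, x ^+ n] = [~ u, x] ^+ n.
Proof.
move=> Zu Gx; elim: n => [|n IHn]; first by rewrite commg1.
by rewrite !expgS comm2M ?groupX // IHn.
Qed.

Lemma commM_mod m x y : m \in 'Phi(G) -> x \in G -> y \in G ->
  exists2 z, z \in 'Z(G) & [~ m, x * y] = [~ m, x] * [~ m, y] * z.
Proof.
move=> Mm Gx Gy; exists [~ m, x, y]; first by rewrite comm2_Z ?commM_Z2.
rewrite commgMJ conjg_mulR mulgA; congr (_ * _).
by apply: Phi_commute; rewrite M2 ?commM_Z2.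
Qed.

Definition beta m x y := [~ m, x, y].

Lemma beta_Z m x y : m \in 'Phi(G) -> x \in G -> y \in G -> beta m x y \in 'Z(G).
Proof. by move=> Mm Gx Gy; rewrite comm2_Z ?commM_Z2. Qed.

Lemma beta_sym m x y : m \in 'Phi(G) -> x \in G -> y \in G -> beta m x y = beta m y x.
Proof. exact: commPhi_sym. Qed.

Lemma betaM m m' x y : m \in 'Phi(G) -> m' \in 'Phi(G) -> x \in G -> y \in G ->
  beta (m * m') x y = beta m x y * beta m' x y.
Proof. by move=> Mm Mm' Gx Gy; rewrite /beta (commPhiM Gx Mm) // commPhiM // M2 ?commM_Z2. Qed.

Lemma betaX m x y n : m \in 'Phi(G) -> x \in G -> y \in G ->
  beta (m ^+ n) x y = beta m x y ^+ n.
Proof. by move=> Mm Gx Gy; rewrite /beta (commPhiX _ Gx Mm) commPhiX // M2 ?commM_Z2. Qed.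

Lemma betaMr m x y y' : m \in 'Phi(G) -> x \in G -> y \in G -> y' \in G ->
  beta m x (y * y') = beta m x y * beta m x y'.
Proof. by move=> Mm Gx Gy Gy'; rewrite /beta comm2M ?commM_Z2. Qed.

Lemma betaXr m x y n : m \in 'Phi(G) -> x \in G -> y \in G ->
  beta m x (y ^+ n) = beta m x y ^+ n.
Proof. by move=> Mm Gx Gy; rewrite /beta comm2X ?commM_Z2. Qed.

Lemma betaMl m x x' y : m \in 'Phi(G) -> x \in G -> x' \in G -> y \in G ->
  beta m (x * x') y = beta m x y * beta m x' y.
Proof.
by move=> Mm Gx Gx' Gy; rewrite !(beta_sym Mm _ Gy) ?betaMr ?groupM.
Qed.

Lemma betaXl m x y n : m \in 'Phi(G) -> x \in G -> y \in G ->
  beta m (x ^+ n) y = beta m x y ^+ n.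
Proof. by move=> Mm Gx Gy; rewrite !(beta_sym Mm _ Gy) ?betaXr ?groupX. Qed.

Lemma beta2 u x y : u \in 'Z_2(G) -> x \in G -> y \in G -> beta u x y = 1.
Proof. by move=> Zu Gx Gy; apply/eqP/commgP/Zc => //; apply: comm2_Z. Qed.

(** x^p lies in the abelian group Phi(G), so [x^p, m] = 1. Its expansion reduces to [x, m]^p, the
    other factor being a C(p,2)-th power of a central element. *)
Lemma comm_Phi_p m x : m \in 'Phi(G) -> x \in G -> [~ m, x] ^+ p = 1.
Proof.
move=> Mm Gx; have Mxm : [~ x, m] \in 'Phi(G) by rewrite comm_Phi ?(GM Mm).
have Z2xm : [~ x, m] \in 'Z_2(G) by rewrite -invg_comm groupV commM_Z2.
have Zd : [~ x, m, x] \in 'Z(G) by rewrite comm2_Z.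
have d2 : [~ [~ x, m, x], x] = 1 by apply/eqP/commgP/Zc.
have Gd : [~ x, m, x] \in G by rewrite GZ.
rewrite -invg_comm expgVn; apply/eqP; rewrite invg_eq1; apply/eqP.
have := commXg_bin p (erefl _) (erefl _) d2.
rewrite expg1n mulg1 (expn_bin2 (exp_Z Zd)) mulg1 => <- //; last first.
- exact: Zc.
- exact: commute1.
- by apply: commute1.
- by apply/commute_sym/Zc; rewrite ?GM.
by apply/eqP/commgP/Phi_commute; rewrite ?expp_Phi.
Qed.

Lemma exp_Phi_Z m : m \in 'Phi(G) -> m ^+ p \in 'Z(G).
Proof.
move=> Mm; apply/centerP; split=> [|x Gx]; first by rewrite groupX ?GM.
by apply/commgP; rewrite commPhiX // comm_Phi_p.
Qed.

Lemma center_cycle z w : z \in 'Z(G) -> z != 1 -> w \in 'Z(G) -> exists i, w = z ^+ i.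
Proof.
move=> Zz nz Zw; apply/cycleP; suff <- : 'Z(G) = <[z]> by [].
by apply: nt_gen_prime; rewrite ?oZ // in_setD1 nz.
Qed.

Lemma center_eqX z i j : z \in 'Z(G) -> z != 1 -> (z ^+ i == z ^+ j) = (i == j %[mod p]).
Proof.
by move=> Zz nz; rewrite eq_expg_mod_order (nt_prime_order p_pr (exp_Z Zz) nz).
Qed.

Lemma index_Phi_p2 : #|G : 'Phi(G)| = (p ^ 2)%N.
Proof.
apply/eqP; rewrite -(eqn_pmul2l (cardG_gt0 'Phi(G))) Lagrange ?Phi_sub //= defPhi o3 oG.
by rewrite -expnD.
Qed.

Lemma gen2_comm a b : G :=: <[a]> <*> <[b]> -> [~ a, b] \notin 'Z_2(G).
Proof.
move=> defG; have [Ga Gb] : a \in G /\ b \in G.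
  by rewrite defG mem_joinr mem_joinl ?cycle_id.
have nZ := subsetP (ucn_norm 2 G).
apply/negP=> Zab; have := der1_gen2 (nZ a Ga) (nZ b Gb) Zab; rewrite -defG => sG'.
have : #|G| <= #|'Z_3(G)|.
  apply/subset_leq_card/subsetP=> x Gx; apply/ucnP1; split=> // y Gy.
  by apply: (subsetP sG'); apply: mem_commg.
by rewrite oG o3 leqNgt ltn_exp2l.
Qed.

(** Together with [gen2_comm] this recognises generating pairs by their commutator: an element b of
    <Phi(G), a> would commute with a modulo Z_2. *)
Lemma gen2_of_comm a b : a \in G -> b \in G -> [~ a, b] \notin 'Z_2(G) ->
  G :=: <[a]> <*> <[b]>.
Proof.
move=> Ga Gb nab; have nZ := subsetP (ucn_norm 2 G).
apply: (Phi_gen2 pG index_Phi_p2) => //; first by apply: contra nab => Ma; apply: commM_Z2.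
apply: contra nab => Jb; have sub : 'Phi(G) <*> <[a]> \subset centmod 'Z_2(G) a.
  rewrite join_subG cycle_subG !centmodE ?nZ //=.
  rewrite (eqP (introT commgP (commute_refl a))) group1 andbT.
  by apply/subsetP=> m Mm; rewrite centmodE ?nZ ?(GM Mm) //=; apply: commM_Z2.
have := subsetP sub b Jb; rewrite centmodE ?nZ // => /andP[_].
by rewrite -invg_comm groupV.
Qed.

Lemma not_Z2_expX c i : c \in 'Phi(G) -> c \notin 'Z_2(G) -> ~~ (p %| i) -> c ^+ i \notin 'Z_2(G).
Proof.
move=> Mc nc ni; apply: contra nc => Zi; have nZ := subsetP (ucn_norm 2 G) c (GM Mc).
have ci1 : coset 'Z_2(G) c ^+ i = 1 by rewrite -morphX //= coset_id.
have cp1 : coset 'Z_2(G) c ^+ p = 1.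
  by rewrite -morphX //= coset_id // Z2Z ?exp_Phi_Z.
apply: coset_idr => //; apply/eqP; rewrite -order_eq1 -dvdn1.
have g1 : gcdn i p = 1%N by apply/eqP; rewrite gcdnC -/(coprime p i) prime_coprime.
suff: #[coset 'Z_2(G) c] %| gcdn i p by rewrite g1.
by rewrite dvdn_gcd !order_dvdn; apply/andP; split; apply/eqP.
Qed.

Lemma Phi_decomp c m : c \in 'Phi(G) -> c \notin 'Z_2(G) -> m \in 'Phi(G) ->
  exists i, exists2 w, w \in 'Z_2(G) & m = c ^+ i * w.
Proof.
move=> Mc nc Mm; have nZ := subsetP (ucn_norm 2 G) c (GM Mc).
have cp : c ^+ p \in 'Z_2(G) by rewrite Z2Z ?exp_Phi_Z.
have defM : 'Phi(G) = 'Z_2(G) <*> <[c]>.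
  apply/eqP; rewrite eq_sym eqEcard join_subG s23 cycle_subG Mc.
  by rewrite (card_join_cycle p_pr) //= o2 defPhi o3 -expnSr.
have := Mm; rewrite defM norm_joinEr ?cycle_subG // => /mulsgP[w _ Zw /cycleP[i ->] ->].
exists i, w => //; apply: Phi_commute; rewrite ?groupX //; exact: M2.
Qed.

(** G/Z_2 has class at most 2 and the commutator there has p-th power 1, so the commutator is an
    alternating bilinear form modulo p and [d] is the determinant of the change of generators,
    written without subtraction. *)
Lemma comm_bilinear a b i j k l d : a \in G -> b \in G -> i * l = d + j * k %[mod p] ->
  exists2 w, w \in 'Z_2(G) &
    [~ a ^+ i * b ^+ j, a ^+ k * b ^+ l] = [~ a, b] ^+ d * w.
Proof.
move=> Ga Gb eij; have nZ := subsetP (ucn_norm 2 G).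
have [c def_c] : {c | [~ a, b] = c} by exists [~ a, b].
rewrite def_c; have Mc : c \in 'Phi(G) by rewrite -def_c comm_Phi.
have Gc := GM Mc.
exists (c ^- d * [~ a ^+ i * b ^+ j, a ^+ k * b ^+ l]); last by rewrite mulKVg.
have GG : [~ a ^+ i * b ^+ j, a ^+ k * b ^+ l] \in G by rewrite groupR ?groupM ?groupX.
apply: coset_idr; first by rewrite nZ // groupMr // groupV groupX.
rewrite morphM ?nZ ?groupV ?groupX // morphV ?nZ ?groupX // morphX ?nZ //=.
rewrite [coset _ [~ _ * _, _]]morphR ?nZ ?groupM ?groupX //.
rewrite !morphM ?nZ ?groupX // !morphX ?nZ //=.
set A := coset _ a; set B := coset _ b.
have cC x y w : x \in G -> y \in G -> w \in G ->
    commute [~ coset 'Z_2(G) x, coset 'Z_2(G) y] (coset 'Z_2(G) w).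
  move=> Gx Gy Gw; apply/commgP; rewrite -!morphR ?nZ ?groupR //= coset_id //.
  by rewrite commM_Z2 ?comm_Phi.
have eC : [~ A, B] = coset 'Z_2(G) c by rewrite -morphR ?nZ //= def_c.
have cCA : commute [~ A, B] A := cC a b a Ga Gb Ga.
have cCB : commute [~ A, B] B := cC a b b Ga Gb Gb.
rewrite -eC.
have r1 : [~ A ^+ i, B ^+ l] = [~ A, B] ^+ (i * l).
  by rewrite commXXg //; apply: commute_sym.
have r2 : [~ B ^+ j, A ^+ k] = [~ A, B] ^- (j * k).
  by rewrite -(invg_comm (A ^+ k)) commXXg 1?mulnC //; apply: commute_sym.
have cX (v : coset_of 'Z_2(G)) n : commute [~ A, B] v -> commute [~ A, B] (v ^+ n).
  by move=> ?; apply: commuteX.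
have cXX (v : coset_of 'Z_2(G)) n r : commute [~ A, B] v -> commute ([~ A, B] ^+ r) (v ^+ n).
  by move=> ?; apply/commute_sym/commuteX/commute_sym/cX.
have -> : [~ A ^+ i * B ^+ j, A ^+ k * B ^+ l] = [~ A, B] ^+ (i * l) * [~ A, B] ^- (j * k).
  rewrite commMgJ !commgMJ r1 r2.
  have -> : [~ A ^+ i, A ^+ k] = 1 by apply/eqP/commgP/commuteX2.
  have -> : [~ B ^+ j, B ^+ l] = 1 by apply/eqP/commgP/commuteX2.
  rewrite conj1g mulg1 mul1g !(conjg_fixP _) //; apply/commgP; last exact: cXX.
  exact/commute_sym/commuteV/commute_sym/cXX.
have oC : [~ A, B] ^+ p = 1.
  by rewrite eC -morphX ?nZ //= coset_id // Z2Z ?exp_Phi_Z.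
have -> : [~ A, B] ^+ (i * l) = [~ A, B] ^+ (d + j * k).
  by rewrite -(expg_mod (i * l) oC) eij expg_mod.
by rewrite expgD mulgK mulVg.
Qed.

(** * Degenerate form: the groups A *)

Section CaseA.

Variables a a1 : gT.
Hypotheses (defG : G :=: <[a]> <*> <[a1]>) (Z_211 : [~ a1, a, a1] \in 'Z(G)).

Let a2 := [~ a1, a].
Let a3 := [~ a2, a].
Let a4 := [~ a3, a].

Let Ga : a \in G. Proof. by rewrite defG mem_joinl ?cycle_id. Qed.
Let Ga1 : a1 \in G. Proof. by rewrite defG mem_joinr. Qed.
Let M_2 : a2 \in 'Phi(G). Proof. exact: comm_Phi. Qed.
Let Z2_3 : a3 \in 'Z_2(G). Proof. exact: commM_Z2. Qed.
Let Z_4 : a4 \in 'Z(G). Proof. exact: comm2_Z. Qed.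

Let c13 : commute a1 a3.
Proof.
apply/commute_sym/commgP; rewrite /a3 commPhi_sym //; apply/commgP.
exact: Zc.
Qed.

(** If a3 commuted with a it would be central, because it commutes with a1 by the symmetry of the
    form; then a2 would lie in Z_2. *)
Lemma A_a4_neq1 : a4 != 1.
Proof.
apply: contra (gen2_comm defG) => /commgP c3a.
have Z_3 : a3 \in 'Z(G).
  by apply: (gen2_center defG); rewrite ?(G2 Z2_3) //; apply: commute_sym.
rewrite -invg_comm groupV; apply/ucnP1; split=> [|x Gx]; first exact: GM.
by rewrite ucn1; apply: (comm_gen_center defG) => //; apply: GM.
Qed.

(** For n = p the right side is the left side of [A_2p], so the parameter k is read off from
    [a1, a^p]. *)
Lemma A_a1_aX n : [~ a1, a ^+ n] = a2 ^+ n * a3 ^+ 'C(n, 2) * a4 ^+ 'C(n, 3).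
Proof.
have commVl m x : m \in 'Phi(G) -> x \in G -> [~ m^-1, x] = [~ m, x]^-1.
  by move=> Mm Gx; apply: commVg_commute; apply: Phi_commute => //; apply/M2/commM_Z2.
have M_3 : a3 \in 'Phi(G) := M2 Z2_3; have M_4 : a4 \in 'Phi(G) := M2 (Z2Z Z_4).
have e1 : [~ a, a1] = a2^-1 by rewrite invg_comm.
have e2 : [~ a2^-1, a] = a3^-1 by rewrite commVl.
have e3 : [~ a3^-1, a] = a4^-1 by rewrite commVl.
have cV m m' : m \in 'Phi(G) -> m' \in 'Phi(G) -> commute m^-1 m'^-1.
  by move=> Mm Mm'; apply: Phi_commute; rewrite groupV.
have c4a : commute a4^-1 a by apply: Zc; rewrite ?groupV.
rewrite -invg_comm (commXg_bin n e1 e2 e3 (cV _ _ M_2 M_3) (cV _ _ M_2 M_4) (cV _ _ M_3 M_4) c4a).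
rewrite !expgVn -!invMg invgK (Phi_commute (groupX _ M_3) (groupX _ M_2)).
by apply: Phi_commute; rewrite ?groupM ?groupX.
Qed.

Lemma A_a1_ap_Z : [~ a1, a ^+ p] \in 'Z(G).
Proof.
rewrite A_a1_aX groupM ?groupX // groupM ?exp_Phi_Z // expn_bin2 ?group1 //.
exact: comm_Phi_p.
Qed.

Lemma A_frame_of k e : [~ a1, a ^+ p] = a4 ^+ k -> [~ a1, a2] = a4 ^+ e ->
  A_frame p k e a a1 a2 a3 a4.
Proof.
move=> def_k def_e; split; rewrite // -?A_a1_aX //.
- exact: Zc.
- exact/commute_sym/Zc.
- by apply: Phi_commute => //; apply: M2.
- by apply/commute_sym/Zc; rewrite ?GM.
- by apply/commute_sym/Zc; rewrite ?(G2 Z2_3).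
- exact: comm_Phi_p.
exact: exp_Z.
Qed.

(** Otherwise a^p is central, and so is a1^p a3^(-j) with a2^p = a4^j. Then a^p and a1^p lie in G',
    so Phi(G) is contained in G', which has order only p^3. *)
Lemma A_a1_ap_neq1 : [~ a1, a ^+ p] != 1.
Proof.
apply/negP=> /eqP ap1; have nz4 := A_a4_neq1.
have [e def_e] : exists e, [~ a1, a2] = a4 ^+ e.
  by apply: center_cycle => //; rewrite -invg_comm groupV.
have fA := A_frame_of (ap1 : _ = a4 ^+ 0) def_e.
have oG' : #|G^`(1)| = (p ^ 3)%N by rewrite defG (A_frame_card_der p_pr fA).
have G'2 : a2 \in G^`(1) by apply: mem_commg.
have G'3 : a3 \in G^`(1) by apply: mem_commg => //; apply: GM.
have G'Z : {subset 'Z(G) <= G^`(1)}.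
  move=> w /(center_cycle Z_4 nz4)[i ->]; rewrite groupX //.
  by apply: mem_commg; rewrite ?(G2 Z2_3).
have G'a : a ^+ p \in G^`(1).
  apply/G'Z/(gen2_center defG); rewrite ?groupX //; first exact/commute_sym/commuteX.
  by apply/commute_sym/commgP/eqP.
have G'a1 : a1 ^+ p \in G^`(1).
  have [j def_j] := center_cycle Z_4 nz4 (exp_Phi_Z M_2).
  have M1p : a1 ^+ p \in 'Phi(G) := expp_Phi pG Ga1.
  have M3j : a3 ^- j \in 'Phi(G) by rewrite groupV groupX ?M2.
  rewrite -(mulgKV (a3 ^+ j) (a1 ^+ p)) groupMr ?groupX //; apply: G'Z.
  apply: (gen2_center defG); first by rewrite GM ?groupM.
    have M3V : a3^-1 \in 'Phi(G) by rewrite groupV M2.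
    apply/commgP; rewrite commPhiM // -expgVn (commPhiX j Ga M3V).
    rewrite (@commVg_commute _ a3) -/a4; last by apply/commute_sym/Zc; rewrite ?(G2 Z2_3).
    have c1a1 : [~ [~ a2, a1], a1] = 1 by apply/eqP/commgP/Zc.
    have e1 : [~ a1 ^+ p, a] = a2 ^+ p.
      rewrite (commXg_bin p (erefl _) (erefl _) c1a1) -/a2.
      - by rewrite expg1n mulg1 expn_bin2 ?mulg1 //; apply: exp_Z.
      - by apply/commute_sym/Zc; rewrite ?GM.
      - exact: commute1.
      - exact: commute1.
      exact/commute_sym/commute1.
    by rewrite e1 def_j expgVn mulgV.
  apply/commute_sym/commuteM; first exact/commuteX.
  by apply/commuteV/commuteX.
have sPhi : 'Phi(G) \subset G^`(1).
  apply: (Phi_sub_of pG) => // x Gx; have nG' := subsetP (der_norm 1 G).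
  have abQ : abelian (G / G^`(1)) := der_abelian 0 G.
  apply: coset_idr; rewrite ?nG' ?groupX // morphX ?nG' //=.
  have : coset G^`(1) x \in <[coset G^`(1) a]> <*> <[coset G^`(1) a1]>.
    rewrite -!quotient_cycle ?nG' // -quotientY ?cycle_subG ?nG' //.
    by rewrite -defG mem_quotient.
  have cQ : commute (coset G^`(1) a) (coset G^`(1) a1).
    by apply: (centsP abQ); rewrite mem_quotient.
  rewrite norm_joinEr; last first.
    exact: cents_norm (cents_cycle (commute_sym cQ)).
  case/mulsgP=> _ _ /cycleP[i ->] /cycleP[j ->] ->.
  rewrite expgMn; last exact: commuteX2.
  rewrite -!expgM ![(_ * p)%N]mulnC !expgM -!morphX ?nG' ?groupX //=.
  by rewrite !coset_id ?(groupX _ G'a) ?(groupX _ G'a1) ?mulg1 ?groupX; rewrite ?groupX.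
have := subset_leq_card sPhi; rewrite oG' /= defPhi o3 leqNgt.
by rewrite ltn_exp2l.
Qed.

End CaseA.

(* Replacing [a] by [a ^+ s] and [a1] by [a1 ^+ t] turns [k] into k / s^2 and [e] into
   e t / s^2. *)
Lemma A_scale a a1 k e k' e' s t : G :=: <[a]> <*> <[a1]> ->
    [~ a1, a, a1] \in 'Z(G) ->
    [~ a1, a ^+ p] = [~ a1, a, a, a] ^+ k ->
    [~ a1, [~ a1, a]] = [~ a1, a, a, a] ^+ e ->
    ~~ (p %| s) -> ~~ (p %| t) -> k = k' * s ^ 2 %[mod p] -> e * t = e' * s ^ 2 %[mod p] ->
  exists b b1 b2 b3 b4,
    [/\ A_frame p k' e' b b1 b2 b3 b4, G :=: <[b]> <*> <[b1]> & b4 != 1].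
Proof.
move=> defG Z_211 def_k def_e ps pt ek ee.
have [Ga Ga1] : a \in G /\ a1 \in G by rewrite defG mem_joinr mem_joinl ?cycle_id.
have Z_ap := A_a1_ap_Z defG; have nz4 := A_a4_neq1 defG Z_211.
set a2 := [~ a1, a] in Z_211 def_k def_e nz4 *; set a4 := [~ a2, a, a] in def_k def_e nz4.
have M_2 : a2 \in 'Phi(G) by apply: comm_Phi.
have Z2_3 : [~ a2, a] \in 'Z_2(G) by apply: commM_Z2.
have Z_4 : a4 \in 'Z(G) by apply: comm2_Z.
have oa4 : a4 ^+ p = 1 := exp_Z Z_4.
pose b := a ^+ s; pose b1 := a1 ^+ t; pose b2 := [~ b1, b].
have Gb : b \in G by apply: groupX.
have Gb1 : b1 \in G by apply: groupX.
have [w Zw def_b2] : exists2 w, w \in 'Z_2(G) & b2 = a2 ^+ (s * t) * w.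
  have := @comm_bilinear a1 a t 0 0 s (s * t) Ga1 Ga.
  by rewrite mul0n addn0 mulnC !expg0 mulg1 mul1g; apply.
have nb2 : b2 \notin 'Z_2(G).
  rewrite def_b2 groupMr // not_Z2_expX //; last by rewrite Euclid_dvdM // negb_or ps.
  by rewrite -groupV invg_comm; apply: gen2_comm.
have defGb : G :=: <[b]> <*> <[b1]>.
  by apply: gen2_of_comm; rewrite // -groupV invg_comm.
have M2st : a2 ^+ (s * t) \in 'Phi(G) by apply: groupX.
have def_b4 : [~ b2, b, b] = a4 ^+ (s * t * s * s).
  rewrite -/(beta b2 b b) def_b2 (betaM M2st (M2 Zw) Gb Gb) (beta2 Zw Gb Gb) mulg1 betaX //.
  rewrite betaXl ?betaXr ?groupX // -/a4 -!expgM.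
  by congr (_ ^+ _); clear; lia.
exists b, b1, b2, [~ b2, b], [~ b2, b, b].
have Z_g2 x : x \in 'Z(G) -> [~ x, a] = 1 by move=> Zx; apply/eqP/commgP/Zc.
have Z_g x : x \in 'Z(G) -> [~ x, a1] = 1 by move=> Zx; apply/eqP/commgP/Zc.
have [g def_g] : {g | [~ a1, b] = g} by exists [~ a1, b].
have Mg : g \in 'Phi(G) by rewrite -def_g comm_Phi.
have ga1 : [~ g, a1] = [~ a2, a1] ^+ s.
  have e31 n : [~ [~ a2, a] ^+ n, a1] = 1.
    by rewrite commPhiX ?(M2 Z2_3) // commPhi_sym // (Z_g2 _ Z_211) expg1n.
  have M_4 : a4 \in 'Phi(G) := M2 (Z2Z Z_4).
  have [Ma Mb] : a2 ^+ s \in 'Phi(G) /\ [~ a2, a] ^+ 'C(s, 2) \in 'Phi(G).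
    by split; apply: groupX => //; apply: M2.
  rewrite -def_g (A_a1_aX defG) // (commPhiM Ga1 (groupM Ma Mb) (groupX _ M_4)).
  rewrite (commPhiM Ga1 Ma Mb).
  by rewrite (Z_g _ (groupX _ Z_4)) e31 !mulg1 commPhiX.
have Z_ga1 : [~ g, a1] \in 'Z(G) by rewrite ga1 groupX.
have b2a1 : [~ b2, a1] = [~ a2, a1] ^+ (s * t).
  have e1 := Z_g _ Z_ga1.
  rewrite /b2 /b1 (commXg_bin t def_g (erefl _) e1); last exact/commute_sym/commute1.
  - rewrite expg1n mulg1 commPhiM ?groupX ?(M2 (Z2Z Z_ga1)) //.
    by rewrite (Z_g _ (groupX _ Z_ga1)) mulg1 commPhiX // ga1 -expgM.
  - by apply/commute_sym/Zc; rewrite ?GM.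
  - exact: commute1.
  exact: commute1.
have b2b1 : [~ b2, b1] = [~ a2, a1] ^+ (s * t * t).
  rewrite commgX ?b2a1 -?expgM //; apply/commute_sym/Zc => //.
  by rewrite groupX.
have Z_b211 : [~ b2, b1] \in 'Z(G) by rewrite b2b1 groupX.
split=> //; last exact: (A_a4_neq1 defGb Z_b211).
apply: (A_frame_of defGb Z_b211).
  have -> : b ^+ p = (a ^+ p) ^+ s by rewrite -!expgM mulnC.
  have e1 : [~ a1, (a ^+ p) ^+ s] = [~ a1, a ^+ p] ^+ s.
    by rewrite commgX //; apply/commute_sym/Zc; rewrite ?groupX.
  rewrite commXg e1; last by apply/commute_sym/Zc; rewrite ?groupX.
  rewrite def_b4 def_k -!expgM; apply/eqP; rewrite (center_eqX _ _ Z_4 nz4).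
  rewrite -mulnA -modnMml ek modnMml; apply/eqP; congr (_ %% _)%N; clear; lia.
rewrite def_b4 -invg_comm b2b1 -expgVn invg_comm def_e -!expgM.
apply/eqP; rewrite (center_eqX _ _ Z_4 nz4).
have -> : (e * (s * t * t) = e * t * (s * t))%N by clear; lia.
rewrite -modnMml ee modnMml; apply/eqP; congr (_ %% _)%N; clear; lia.
Qed.

Lemma A_normal_form a a1 n : G :=: <[a]> <*> <[a1]> -> [~ a1, a, a1] \in 'Z(G) ->
    (forall r : nat, r ^ 2 != n %[mod p]) ->
  exists (e : bool) k b b1 b2 b3 b4, [/\ k = 1%N \/ k = n,
    A_frame p k e b b1 b2 b3 b4, G :=: <[b]> <*> <[b1]> & b4 != 1].
Proof.
move=> defG Z_211 nsq; have nz4 := A_a4_neq1 defG Z_211.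
have [Ga Ga1] : a \in G /\ a1 \in G by rewrite defG mem_joinr mem_joinl ?cycle_id.
have Z_4 : [~ a1, a, a, a] \in 'Z(G) by rewrite comm2_Z ?commM_Z2 ?comm_Phi.
have [k def_k] := center_cycle Z_4 nz4 (A_a1_ap_Z defG).
have [e def_e] : exists e, [~ a1, [~ a1, a]] = [~ a1, a, a, a] ^+ e.
  by apply: center_cycle => //; rewrite -invg_comm groupV.
have pk : ~~ (p %| k).
  apply: contra (A_a1_ap_neq1 defG Z_211) => p_k.
  by rewrite def_k -order_dvdn (nt_prime_order p_pr (exp_Z Z_4) nz4).
have [s ps ek] := modn_square_or p_pr nsq pk.
have [k' [def_k' {}ek]] : exists k', (k' = 1%N \/ k' = n) /\ k = k' * s ^ 2 %[mod p].
  by case: ek => ek; [exists 1%N; rewrite mul1n | exists n]; split; auto.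
(* s is already fixed by k, while t is still free to absorb a nonzero e. *)
have [e' [t pt ee]] : exists e' : bool, exists2 t, ~~ (p %| t) & e * t = e' * s ^ 2 %[mod p].
  have [p_e | ne] := boolP (p %| e).
    exists false, 1%N; first by rewrite dvdn1 neq_ltn p_gt1 orbT.
    by rewrite mul0n muln1 mod0n; apply/eqP.
  have [t et] := modn_solve p_pr (s ^ 2) ne.
  exists true, t; rewrite ?mul1n //; apply: contra ps => p_t.
  have : p %| s ^ 2 by rewrite /dvdn -et; apply: dvdn_mull.
  by rewrite Euclid_dvdX // => /andP[].
have [b [b1 [b2 [b3 [b4 [fA defGb nzb]]]]]] := A_scale defG Z_211 def_k def_e ps pt ek ee.
by exists e', k', b, b1, b2, b3, b4.
Qed.

(** * Nondegenerate form: the groups B and C *)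

Section CaseBC.

Hypothesis nd : forall c x, c \in 'Phi(G) -> c \notin 'Z_2(G) -> x \in G ->
  [~ c, x] \in 'Z(G) -> x \in 'Phi(G).

(** For c in Phi(G) outside Z_2, the map x |-> [c, x] modulo Z has kernel Phi(G) by nondegeneracy,
    so it is onto Z_2/Z by orders. Hence an element of Z_2 is some [c, x] times a central element,
    and both factors have p-th power 1. *)
Lemma exp_Z2 : {in 'Z_2(G), forall u, u ^+ p = 1}.
Proof.
have /properP[_ [c Mc nc]] : 'Z_2(G) \proper 'Phi(G).
  by rewrite properEcard s23 o2 /= defPhi o3 ltn_exp2l.
have nZG : G \subset 'N('Z(G)) by apply: normal_norm; apply: center_normal.
have nZ := subsetP nZG.
have cG x : x \in G -> [~ c, x] \in G by move=> Gx; rewrite groupR ?(GM Mc).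
have cM u v : u \in G -> v \in G -> coset 'Z(G) (u * v) = coset 'Z(G) u * coset 'Z(G) v.
  by move=> Gu Gv; rewrite morphM ?nZ.
have fM : {in G &, {morph (fun x => coset 'Z(G) [~ c, x]) : x y / x * y}}.
  move=> x y Gx Gy /=; have [z Zz ->] := commM_mod Mc Gx Gy.
  by rewrite (cM _ _ (groupM (cG x Gx) (cG y Gy)) (GZ Zz)) (coset_id Zz) mulg1 cM ?cG.
pose f := Morphism fM.
have kerf : 'ker f = 'Phi(G).
  apply/setP=> x; apply/idP/idP=> [/morphpreP[Gx /set1P/= fx1] | Mx].
    by apply: (nd Mc nc Gx); apply: coset_idr fx1; rewrite nZ ?cG.
  apply/morphpreP; split; first exact: GM.
  apply/set1P; rewrite /= coset_id // (_ : [~ c, x] = 1) ?group1 //.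
  exact/eqP/commgP/Phi_commute.
have imf : f @* G = 'Z_2(G) / 'Z(G).
  apply/eqP; rewrite eqEcard; apply/andP; split.
    apply/subsetP=> _ /morphimP[x _ Gx ->] /=.
    by rewrite mem_quotient // commM_Z2.
  rewrite card_morphim kerf setIid index_Phi_p2 card_quotient; last first.
    exact: subset_trans (ucn_sub 2 G) nZG.
  by rewrite -(leq_pmul2l (cardG_gt0 'Z(G))) Lagrange // oZ o2 -expnS.
move=> u Z2u; have : coset 'Z(G) u \in f @* G by rewrite imf mem_quotient.
case/morphimP=> x _ Gx /= eux.
have Zux : [~ c, x]^-1 * u \in 'Z(G).
  have GV : [~ c, x]^-1 \in G by rewrite groupV cG.
  have Gu := G2 Z2u; apply: coset_idr; first by rewrite nZ ?(groupM GV Gu).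
  by rewrite (cM _ _ GV Gu) morphV ?nZ ?cG //= eux mulVg.
have cux : commute [~ c, x] ([~ c, x]^-1 * u) by apply/commute_sym/Zc; rewrite ?cG.
by rewrite -(mulKVg [~ c, x] u) (expgMn _ cux) comm_Phi_p ?exp_Z ?mulg1.
Qed.

Lemma beta_expand c a b i j k l : c \in 'Phi(G) -> a \in G -> b \in G ->
  beta c (a ^+ i * b ^+ j) (a ^+ k * b ^+ l) =
    beta c a a ^+ (i * k) * beta c a b ^+ (i * l + j * k) * beta c b b ^+ (j * l).
Proof.
move=> Mc Ga Gb; have Zb x y : x \in G -> y \in G -> beta c x y \in G.
  by move=> Gx Gy; rewrite GZ ?beta_Z.
rewrite betaMl ?betaMr ?groupM ?groupX // !betaXl ?groupX // !betaXr //.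
rewrite (beta_sym Mc Gb Ga) -!expgM ![(k * _)%N]mulnC ![(l * _)%N]mulnC expgD.
by rewrite !mulgA.
Qed.

Lemma BC_frame_of a b q (m11 m12 m22 : nat) z : a \in G -> b \in G -> z \in 'Z(G) ->
    [~ a, b] ^+ p = z ^+ q -> beta [~ a, b] a a = z ^+ m11 ->
    beta [~ a, b] a b = z ^+ m12 -> beta [~ a, b] b b = z ^+ m22 ->
  BC_frame p q m11 m12 m22 a b [~ a, b] [~ a, b, a] [~ a, b, b] z.
Proof.
move=> Ga Gb Zz; have Mc := comm_Phi Ga Gb.
have [M1 M2'] := (M2 (commM_Z2 Mc Ga), M2 (commM_Z2 Mc Gb)).
move=> cp e11 e12 e22; split; rewrite ?(comm_Phi_p Mc) ?(exp_Z Zz) //.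
- by rewrite -e12; apply: beta_sym.
- exact: Phi_commute.
- exact: Phi_commute.
- exact: Phi_commute.
- exact: Zc.
- exact: Zc.
- by apply: Zc; rewrite ?GM.
- by apply: Zc; rewrite ?(GM M1).
- by apply: Zc; rewrite ?(GM M2').
Qed.

(** The commutator becomes c^d modulo Z_2. Factors from Z_2 affect neither its p-th power, by
    [exp_Z2], nor the form. *)
Lemma gen2_change a b i j k l d : G :=: <[a]> <*> <[b]> ->
    i * l = d + j * k %[mod p] -> ~~ (p %| d) ->
    let a' := a ^+ i * b ^+ j in let b' := a ^+ k * b ^+ l in
  [/\ a' \in G, b' \in G, G :=: <[a']> <*> <[b']>,
      [~ a', b'] ^+ p = ([~ a, b] ^+ p) ^+ d
    & {in G &, forall x y, beta [~ a', b'] x y = beta [~ a, b] x y ^+ d}].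
Proof.
move=> defG eij pd; have [Ga Gb] : a \in G /\ b \in G.
  by rewrite defG mem_joinr mem_joinl ?cycle_id.
have [w Zw def_c] := comm_bilinear Ga Gb eij.
have nc := gen2_comm defG; have Mc := comm_Phi Ga Gb.
move=> a' b'; rewrite -/a' -/b' in def_c.
have Ga' : a' \in G by rewrite groupM ?groupX.
have Gb' : b' \in G by rewrite groupM ?groupX.
have nc' : [~ a', b'] \notin 'Z_2(G) by rewrite def_c groupMr // not_Z2_expX.
have Mcd : [~ a, b] ^+ d \in 'Phi(G) by apply: groupX.
split=> //; first exact: gen2_of_comm.
  rewrite def_c (expgMn _ (Phi_commute Mcd (M2 Zw))) (exp_Z2 Zw) mulg1.
  by rewrite -!expgM mulnC.
by move=> x y Gx Gy; rewrite def_c (betaM Mcd (M2 Zw) Gx Gy) (beta2 Zw) // mulg1 betaX.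
Qed.

(** Phi(G)/Z_2 is generated by c, so the form of c' is a multiple of the form of c. *)
Lemma beta_Phi_indep c c' x : c \in 'Phi(G) -> c \notin 'Z_2(G) -> c' \in 'Phi(G) -> x \in G ->
  beta c x x = 1 -> beta c' x x = 1.
Proof.
move=> Mc nc Mc' Gx bc; have [i [w Zw ->]] := Phi_decomp Mc nc Mc'.
by rewrite (betaM (groupX _ Mc) (M2 Zw)) // (beta2 Zw) // betaX // bc expg1n mulg1.
Qed.

Lemma gen2_not_Phi a b : G :=: <[a]> <*> <[b]> -> b \notin 'Phi(G).
Proof.
move=> defG; have [Ga Gb] : a \in G /\ b \in G.
  by rewrite defG mem_joinr mem_joinl ?cycle_id.
apply: contra (gen2_comm defG) => Mb.
by rewrite -invg_comm groupV commM_Z2.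
Qed.

Lemma gen2_exists a : a \in G -> a \notin 'Phi(G) -> exists b, G :=: <[a]> <*> <[b]>.
Proof.
move=> Ga na; have [b Gb nb] := Phi_gen2_exists p_pr pG index_Phi_p2 Ga na.
by exists b; apply: (Phi_gen2 pG index_Phi_p2).
Qed.

Lemma B_normal_form c0 a : a \in G -> a \notin 'Phi(G) ->
    c0 \in 'Phi(G) -> c0 \notin 'Z_2(G) -> beta c0 a a = 1 ->
  exists (q : bool) b c c1 c2 z, [/\ BC_frame p q 0 1 0 a b c c1 c2 z,
    G :=: <[a]> <*> <[b]> & z != 1].
Proof.
move=> Ga na Mc0 nc0 bc0; have [b0 defG0] := gen2_exists Ga na.
have Gb0 : b0 \in G by rewrite defG0 mem_joinr.
have Mc := comm_Phi Ga Gb0; have nc := gen2_comm defG0.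
have b_aa := beta_Phi_indep Mc0 nc0 Mc Ga bc0.
pose z := beta [~ a, b0] a b0.
have Zz : z \in 'Z(G) by apply: beta_Z.
have nz : z != 1.
  apply: contra na => z1; apply: (nd Mc nc Ga); apply: (gen2_center defG0).
  - by rewrite (G2 (commM_Z2 Mc Ga)).
  - exact/commgP/eqP.
  exact/commgP.
have zp i : p %| i -> z ^+ i = 1 by case/dvdnP=> d ->; rewrite expg_muln ?exp_Z.
have [m def_m] := center_cycle Zz nz (beta_Z Mc Gb0 Gb0).
(* (p - 1)/2 is -1/2 modulo p, so 2 k + m, the exponent of the new value at [b], vanishes modulo
   p. *)
pose k := (m * p.-1./2)%N.
have p1 : ~~ (p %| 1) by rewrite dvdn1 neq_ltn p_gt1 orbT.
have [_ Gb defG cp bE] := gen2_change (i := 1) (j := 0) (k := k) (l := 1) defG0 (erefl _) p1.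
set b := a ^+ k * b0 ^+ 1 in Gb defG cp bE.
rewrite expg1 expg0 mulg1 in defG cp bE.
have e11 : beta [~ a, b] a a = 1 by rewrite bE // b_aa expg1n.
have e12 : beta [~ a, b] a b = z.
  have := beta_expand 1 0 k 1 Mc Ga Gb0.
  by rewrite bE // expg1 b_aa !expg1n mul1g mulg1 expg1 expg0 mulg1 => ->.
have e22 : beta [~ a, b] b b = 1.
  rewrite bE // expg1 /b beta_expand // b_aa expg1n mul1g def_m -expgM -expgD zp //.
  have -> : (k * 1 + 1 * k + m * (1 * 1) = m * (p.-1./2.*2).+1)%N.
    by rewrite /k -addnn; clear; lia.
  by rewrite even_halfK ?prednK ?dvdn_mull // -subn1 oddB // p_odd.
have [q def_q] := center_cycle Zz nz (exp_Phi_Z (comm_Phi Ga Gb)).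
have [p_q | nq] := boolP (p %| q).
  exists false, b, [~ a, b], [~ a, b, a], [~ a, b, b], z; split=> //.
  by apply: BC_frame_of; rewrite // def_q zp.
(* Replacing b by b^q raises c^p = z^q to the power q, and the off-diagonal value z to the power q
   twice; with z^(q q) as new z both exponents are 1. *)
have Mc1 := comm_Phi Ga Gb; have edet : 1 * q = q + 0 * 0 %[mod p] by rewrite mul1n addn0.
have [_ Gb' defG' cp' bE'] := gen2_change defG edet nq.
set b' := a ^+ 0 * b ^+ q in Gb' defG' cp' bE'.
rewrite expg1 expg0 mulg1 in defG' cp' bE'.
have def_b' : b' = b ^+ q by rewrite /b' mul1g.
exists true, b', [~ a, b'], [~ a, b', a], [~ a, b', b'], (z ^+ (q * q)); split=> //.
  apply: BC_frame_of => //; first exact: groupX.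
  - by rewrite cp' def_q -!expgM muln1.
  - by rewrite bE' // e11 expg1n.
  - by rewrite bE' // def_b' (betaXr _ Mc1 Ga Gb) e12 -!expgM muln1.
  by rewrite bE' // def_b' (betaXl _ Mc1 Gb) ?(betaXr _ Mc1) ?groupX // e22 !expg1n.
by rewrite -order_dvdn (nt_prime_order p_pr (exp_Z Zz) nz) Euclid_dvdM // (negPf nq).
Qed.

Lemma C_normal_form n n' : (forall r : nat, r ^ 2 != n %[mod p]) -> p %| n + n' ->
    (forall c x, c \in 'Phi(G) -> c \notin 'Z_2(G) -> x \in G -> beta c x x = 1 ->
      x \in 'Phi(G)) ->
  exists (q : bool) a b c c1 c2 z, [/\ BC_frame p q 1 0 n' a b c c1 c2 z,
    G :=: <[a]> <*> <[b]> & z != 1].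
Proof.
move=> nsq nn' aniso.
have [a Ga na] : exists2 a, a \in G & a \notin 'Phi(G).
  have /properP[_ [a Ga na]] : 'Phi(G) \proper G; last by exists a.
  by rewrite properEcard Phi_sub /= defPhi o3 oG ltn_exp2l.
have [b0 defG0] := gen2_exists Ga na.
have Gb0 : b0 \in G by rewrite defG0 mem_joinr.
have Mc := comm_Phi Ga Gb0; have nc := gen2_comm defG0.
pose z := beta [~ a, b0] a a.
have Zz : z \in 'Z(G) by apply: beta_Z.
have nz : z != 1 by apply: contra na => /eqP; apply: aniso.
have zp w i : w \in 'Z(G) -> p %| i -> w ^+ i = 1.
  by move=> Zw /dvdnP[d ->]; rewrite expg_muln ?exp_Z.
have p1 : ~~ (p %| 1) by rewrite dvdn1 neq_ltn p_gt1 orbT.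
have [k ek] : exists k, beta [~ a, b0] a (a ^+ k * b0 ^+ 1) = 1.
  have [m def_m] := center_cycle Zz nz (beta_Z Mc Ga Gb0).
  (* Orthogonalisation: p - 1 is -1 modulo p, so the component of [b0] along [a] is subtracted. *)
  exists (m * p.-1)%N; have := beta_expand 1 0 (m * p.-1) 1 Mc Ga Gb0.
  rewrite expg1 expg0 mulg1 => ->; rewrite def_m -/z -!expgM -!expgD expg0 mulg1 zp //.
  have -> : (1 * (m * p.-1) + m * (1 * 1 + 0 * (m * p.-1)) = m * p.-1.+1)%N.
    by clear; lia.
  by rewrite prednK // dvdn_mull.
have [_ Gb defG cp bE] := gen2_change (i := 1) (j := 0) (k := k) (l := 1) defG0 (erefl _) p1.
set b := a ^+ k * b0 ^+ 1 in ek Gb defG cp bE.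
rewrite expg1 expg0 mulg1 in defG cp bE.
have e11 : beta [~ a, b] a a = z by rewrite bE.
have e12 : beta [~ a, b] a b = 1 by rewrite bE // ek expg1n.
have Mc1 := comm_Phi Ga Gb; have nc1 := gen2_comm defG.
have [m e22] := center_cycle Zz nz (beta_Z Mc1 Gb Gb).
(* The value of the form at [a ^+ s * b] is s^2 + m, so anisotropy makes -m a nonresidue. *)
have nm s : ~~ (p %| s ^ 2 + m).
  apply/negP=> p_sm.
  have edet : 1 * 1 = 1 + 0 * s %[mod p] by rewrite mul0n.
  have [_ Gx defGx _ _] := gen2_change defG edet p1.
  case/negP: (gen2_not_Phi defGx); apply: (aniso _ _ Mc1 nc1 Gx).
  rewrite beta_expand // e11 e12 e22 expg1n mulg1 -!expgM -expgD zp //.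
  by rewrite mulnn !muln1.
(* Passing from b to b^t also multiplies the form by the determinant t; the new central generator
   z^t absorbs it, leaving m t^2 = n'. *)
have [t pt et] := modn_square_ratio p_pr nsq nn' nm.
have edt : 1 * t = t + 0 * 0 %[mod p] by rewrite mul1n addn0.
have [_ Gbt defGt cpt bEt] := gen2_change defG edt pt.
have def_b2 : a ^+ 0 * b ^+ t = b ^+ t by rewrite mul1g.
rewrite def_b2 expg1 expg0 mulg1 in defGt cpt bEt Gbt.
set b2 := b ^+ t in defGt cpt bEt Gbt.
have [z2 def_z2] : {z2 | z ^+ t = z2} by exists (z ^+ t).
have Zz2 : z2 \in 'Z(G) by rewrite -def_z2 groupX.
have oz := nt_prime_order p_pr (exp_Z Zz) nz.
have nz2 : z2 != 1 by rewrite -def_z2 -order_dvdn oz.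
have f11 : beta [~ a, b2] a a = z2 by rewrite bEt // e11.
have f12 : beta [~ a, b2] a b2 = 1.
  by rewrite bEt // (betaXr _ Mc1 Ga Gb) e12 !expg1n.
have f22 : beta [~ a, b2] b2 b2 = z2 ^+ n'.
  rewrite bEt // (betaXl _ Mc1 Gb Gbt) (betaXr _ Mc1 Gb Gb) e22 -def_z2 -!expgM.
  apply/eqP; rewrite (center_eqX _ _ Zz nz).
  apply/eqP; transitivity (t * (m * t ^ 2) %% p)%N; last by rewrite -modnMmr et modnMmr.
  by congr (_ %% _)%N; clear; lia.
have Mc2 := comm_Phi Ga Gbt.
have [q def_q] := center_cycle Zz2 nz2 (exp_Phi_Z Mc2).
have [p_q | nq] := boolP (p %| q).
  exists false, a, b2, [~ a, b2], [~ a, b2, a], [~ a, b2, b2], z2; split=> //.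
  by apply: BC_frame_of; rewrite // def_q zp.
(* The basis change a^x b^y, a^(n y) b^x has determinant x^2 - n y^2 and multiplies the
   Gram matrix by it. *)
have [x [y exy]] := modn_norm_form p_pr nsq nn' nq.
have edet : x * x = q + y * (n * y) %[mod p].
  rewrite -modnDml -exy modnDml.
  have -> : (x ^ 2 + n' * y ^ 2 + y * (n * y) = (n + n') * y ^ 2 + x * x)%N by clear; lia.
  by case/dvdnP: nn' => d ->; rewrite mulnAC modnMDl.
have [Ga' Gb' defG' cp' bE'] := gen2_change defGt edet nq.
set a3 := a ^+ x * b2 ^+ y in Ga' defG' cp' bE'.
set b3 := a ^+ (n * y) * b2 ^+ x in Gb' defG' cp' bE'.
have z2E i j : i = j %[mod p] -> z2 ^+ i = z2 ^+ j.
  by move=> eij; apply/eqP; rewrite (center_eqX _ _ Zz2 nz2); apply/eqP.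
(* The determinant and the norm are both q, so the Gram matrix acquires the factor q q, and c^p =
   z2^q is raised to the power q; z2^(q q) serves both. *)
exists true, a3, b3, [~ a3, b3], [~ a3, b3, a3], [~ a3, b3, b3], (z2 ^+ (q * q)).
split=> //; last first.
  by rewrite -order_dvdn (nt_prime_order p_pr (exp_Z Zz2) nz2) Euclid_dvdM // (negPf nq).
have bexp i j k' l : beta [~ a, b2] (a ^+ i * b2 ^+ j) (a ^+ k' * b2 ^+ l) =
    z2 ^+ (i * k' + n' * (j * l)).
  by rewrite beta_expand // f11 f12 f22 expg1n mulg1 -expgM -expgD.
apply: BC_frame_of => //; first exact: groupX.
- by rewrite cp' def_q -!expgM muln1.
- rewrite bE' // bexp -!expgM muln1; apply: z2E.
  have -> : (x * x + n' * (y * y) = x ^ 2 + n' * y ^ 2)%N by clear; lia.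
  by rewrite -modnMml exy modnMml.
- rewrite bE' // bexp -!expgM muln0; apply: z2E.
  have -> : ((x * (n * y) + n' * (y * x)) * q = (n + n') * (x * y * q))%N by clear; lia.
  by case/dvdnP: nn' => d ->; rewrite mulnAC modnMl mod0n.
rewrite bE' // bexp -!expgM; apply: z2E.
have nn : n ^ 2 = n' ^ 2 %[mod p].
  apply/eqP; rewrite -(eqn_modDr (n * n')).
  have -> : (n ^ 2 + n * n' = (n + n') * n)%N by clear; lia.
  have -> : (n' ^ 2 + n * n' = (n + n') * n')%N by clear; lia.
  by case/dvdnP: nn' => d ->; rewrite ![(d * p * _)%N]mulnAC !modnMl.
have -> : (n * y * (n * y) + n' * (x * x) = n ^ 2 * y ^ 2 + n' * x ^ 2)%N by clear; lia.
have e1 : n ^ 2 * y ^ 2 + n' * x ^ 2 = n' * (x ^ 2 + n' * y ^ 2) %[mod p].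
  rewrite -modnDml -[(n ^ 2 * _ %% p)%N]modnMml nn modnMml modnDml.
  by congr (_ %% _)%N; clear; lia.
rewrite -modnMml e1 modnMml -mulnA mulnCA -modnMml exy modnMml.
by congr (_ %% _)%N; clear; lia.
Qed.

End CaseBC.

Lemma structure_frames n n' : (forall r : nat, r ^ 2 != n %[mod p]) -> p %| n + n' ->
  [\/ exists (e : bool) k b b1 b2 b3 b4, [/\ k = 1%N \/ k = n,
        A_frame p k e b b1 b2 b3 b4, G :=: <[b]> <*> <[b1]> & b4 != 1],
      exists (q : bool) a b c c1 c2 z, [/\ BC_frame p q 0 1 0 a b c c1 c2 z,
        G :=: <[a]> <*> <[b]> & z != 1]
    | exists (q : bool) a b c c1 c2 z, [/\ BC_frame p q 1 0 n' a b c c1 c2 z,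
        G :=: <[a]> <*> <[b]> & z != 1]].
Proof.
move=> nsq nn'.
have [/existsP[c /and3P[nc Mc /existsP[x /and3P[Gx nx Zcx]]]]|] :=
  boolP [exists c, [&& c \notin 'Z_2(G), c \in 'Phi(G)
    & [exists x, [&& x \in G, x \notin 'Phi(G) & [~ c, x] \in 'Z(G)]]]].
  (* The degenerate direction x takes the role of a1, hence the swap. The commutator [x, a] is c^i w
     with w in Z_2, so its commutator with x is central. *)
  have [a defG] := gen2_exists Gx nx; rewrite joingC in defG.
  constructor 1; apply: (A_normal_form defG) => //.
  have Ga : a \in G by rewrite defG mem_joinl ?cycle_id.
  have [i [w Zw ->]] := Phi_decomp Mc nc (comm_Phi Gx Ga).
  by rewrite (commPhiM Gx (groupX _ Mc) (M2 Zw)) (commPhiX _ Gx Mc) groupM ?(comm2_Z Zw) ?groupX.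
rewrite negb_exists => /forallP nA.
have nd c x : c \in 'Phi(G) -> c \notin 'Z_2(G) -> x \in G ->
    [~ c, x] \in 'Z(G) -> x \in 'Phi(G).
  move=> Mc nc Gx Zcx; apply: contraNT (nA c) => nx.
  by rewrite nc Mc; apply/existsP; exists x; rewrite Gx nx.
have [/existsP[c /and3P[nc Mc /existsP[x /and3P[Gx nx /eqP bx]]]]|] :=
  boolP [exists c, [&& c \notin 'Z_2(G), c \in 'Phi(G)
    & [exists x, [&& x \in G, x \notin 'Phi(G) & beta c x x == 1]]]].
  have [q [b [c0 [c1 [c2 [z fB]]]]]] := B_normal_form nd Gx nx Mc nc bx.
  by constructor 2; exists q, x, b, c0, c1, c2, z.
rewrite negb_exists => /forallP nB; constructor 3.
apply: (C_normal_form nd nsq nn') => c x Mc nc Gx bx.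
apply: contraNT (nB c) => nx.
by rewrite nc Mc; apply/existsP; exists x; rewrite Gx nx bx eqxx.
Qed.

End Class4.

(** * Comparison of the normal forms with the presented groups *)

Section Characterization.

Variables (p : nat) (p_pr : prime p) (p_odd : odd p).
Variables (nu : int) (nu_nonres : quad_nonresidue p nu).
Variables (n n' : nat) (nu_n : (nu = n%:Z %[mod p%:Z])%Z).
Variable nu_n' : ((- nu)%R = n'%:Z %[mod p%:Z])%Z.

Lemma modn_nonresidue (r : nat) : r ^ 2 != n %[mod p].
Proof.
apply/negP=> /eqP er; case: nu_nonres; exists (Posz r); rewrite nu_n.
by rewrite GRing.expr2 -PoszM mulnn !modz_nat er.
Qed.

Lemma dvdn_nonresidue_opp : p %| n + n'.
Proof.
have [d def_nu] := proj1 (eq_modzP _ _ _) nu_n.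
have [d' def_nu'] := proj1 (eq_modzP _ _ _) nu_n'.
have : (p %| Posz (n + n'))%Z.
  apply/dvdzP; exists (- (d + d'))%R; rewrite PoszD.
  have -> : Posz n = (nu - d * Posz p)%R by rewrite def_nu; ring.
  have -> : Posz n' = (- nu - d' * Posz p)%R by rewrite def_nu'; ring.
  by ring.
by rewrite dvdzE.
Qed.

Lemma ndvdn_nonresidue : ~~ (p %| n).
Proof.
by have := modn_nonresidue 0; rewrite exp0n // mod0n eq_sym.
Qed.

Lemma family_Aut_z (gT : finGroupType) (G : {group gT}) : #|G| = (p ^ 6)%N ->
  in_the_eight_families p nu G -> Aut_z G = 'Z(Inn G).
Proof.
move=> oG [hT [H [isoGH famH]]].
suff [a [b [c [u [v fH]]]]] : exists a b c u v, inner_frame H a b c u v.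
  have [a' [b' [c' [u' [v' fG]]]]] := frame_isoclinic isoGH fH.
  exact: (frame_Aut_z p_pr oG fG).
have frA k m (e : bool) : (k = m%:Z %[mod p%:Z])%Z -> ~~ (p %| m) -> is_A p k e H ->
    exists a b c u v, inner_frame H a b c u v.
  move=> km nm /(is_A_rels p_pr p_odd km)[a [a1 [a2 [a3 [a4 [[defH fA _ _] nz4]]]]]].
  exists a, a1, a2, a3, (a ^+ p); exact: (A_inner_frame p_pr p_odd fA defH nz4 nm).
case: famH => -[e famH].
- by apply: (frA _ 1%N e _ _ famH); rewrite // dvdn1 neq_ltn prime_gt1 ?orbT.
- exact: (frA _ n e nu_n ndvdn_nonresidue famH).
- have [a [b [c [c1 [c2 [z [[defH fB _ _] nz]]]]]]] := is_B_rels p_pr p_odd famH.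
  have [u [v fH]] := BC_inner_frame p_pr fB defH nz (B_nondeg p_pr).
  by exists a, b, c, u, v.
have [s2 [t1 [a [b [c [c1 [c2 [z [[defH fB _ _] nz]]]]]]]]] :=
  is_C_rels p_pr p_odd nu_nonres nu_n' famH.
have [u [v fH]] := BC_inner_frame p_pr fB defH nz (C_nondeg p_pr nu_nonres nu_n').
by exists a, b, c, u, v.
Qed.

(** The normal form fixes the frame parameters of G; the presented group with these parameters
    exists and satisfies the same frame, and nontrivial frames with equal parameters give isoclinic
    groups. *)
Lemma Aut_z_family (gT : finGroupType) (G : {group gT}) : #|G| = (p ^ 6)%N ->
  nil_class G = 3 \/ nil_class G = 4 -> Aut_z G = 'Z(Inn G) ->
  in_the_eight_families p nu G.
Proof.
move=> oG clG AutZ.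
have cl4 : nil_class G = 4 by case: (clG) => // /(no_class3 p_pr p_odd oG AutZ clG).
have [oZ o2 o3 defPhi defC] := structure_class4 p_pr p_odd oG AutZ clG cl4.
have [] := structure_frames p_pr p_odd oG oZ o2 o3 defPhi defC
  modn_nonresidue dvdn_nonresidue_opp.
- case=> e [k [b [b1 [b2 [b3 [b4 [def_k fA defG nz]]]]]]].
  have famA k' : (k' = k%:Z %[mod p%:Z])%Z -> exists (hT : finGroupType) (H : {group hT}),
      isoclinic G H /\ is_A p k' e H.
    move=> kk; have [hT [H isoH]] := is_A_exists p_pr p_odd k' e; exists hT, H; split=> //.
    have [a [a1 [a2 [a3 [a4 [[defH fH _ _] nzH]]]]]] := is_A_rels p_pr p_odd kk isoH.
    exact: (A_isoclinic p_pr fA fH defG defH nz nzH).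
  case: def_k => def_k; rewrite def_k in famA.
    have [hT [H [isoGH isoH]]] := famA 1%R (erefl _).
    by exists hT, H; split=> //; constructor 1; exists e.
  have [hT [H [isoGH isoH]]] := famA nu nu_n.
  by exists hT, H; split=> //; constructor 2; exists e.
- case=> q [a [b [c [c1 [c2 [z [fB defG nz]]]]]]].
  have [hT [H isoH]] := is_B_exists p_pr p_odd q.
  have [a' [b' [c' [c1' [c2' [z' [[defH fH _ _] nzH]]]]]]] := is_B_rels p_pr p_odd isoH.
  exists hT, H; split; last by constructor 3; exists q.
  exact: (BC_isoclinic p_pr fB fH (B_nondeg p_pr) defG defH nz nzH).
case=> q [a [b [c [c1 [c2 [z [fB defG nz]]]]]]].
have [hT [H isoH]] := is_C_exists p_pr p_odd nu_nonres nu_n' q.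
have [s2 [t1 [a' [b' [c' [c1' [c2' [z' [[defH fH _ _] nzH]]]]]]]]] :=
  is_C_rels p_pr p_odd nu_nonres nu_n' isoH.
exists hT, H; split; last by constructor 4; exists q.
exact: (BC_isoclinic p_pr fB fH (C_nondeg p_pr nu_nonres nu_n') defG defH nz nzH).
Qed.

End Characterization.

Theorem theorem4p2 (p : nat) (nu : int) (gT : finGroupType) (G : {group gT})
    (p_prime : prime p) (p_odd : odd p) (nu_nonres : quad_nonresidue p nu)
    (cardG : #|G| = (p ^ 6)%N)
    (clG : nil_class G = 3 \/ nil_class G = 4) :
  Aut_z G = 'Z(Inn G) <-> in_the_eight_families p nu G.
Proof.
have [n nu_n] := modz_repr p_prime nu; have [n' nu_n'] := modz_repr p_prime (- nu)%R.
split; first exact: (Aut_z_family p_prime p_odd nu_nonres nu_n nu_n' cardG clG).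
exact: (family_Aut_z p_prime p_odd nu_nonres nu_n nu_n' cardG).
Qed.
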